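(* For $a>0$ let $\lambda_a$ be the lowest eigenvalue of the self-adjoint operator $A_a$ on $L^2(-a,a)$ associated with the localized Weil quadratic form $Q_W^{\,a}$. For all sufficiently small $a>0$, $\lambda_a$ is positive and is a simple eigenvalue of $A_a$, and there is a constant $\mu_1>0$ (independent of $a$) such that $$\lambda_a=\log\frac1a+\mu_1-\log(2\pi)+\psi(2)-1+O(a)\qquad(a\to0+),$$ where $\psi$ is the digamma function. Furthermore, for all sufficiently small $a>0$ the eigenfunction of $A_a$ corresponding to $\lambda_a$ is even.
   Context: All function spaces are complex; $\langle v_1,v_2\rangle_{L^2}=\int v_1\overline{v_2}\,dx$; $L^2(-a,a)$ is viewed as a closed subspace of $L^2(\mathbb R)$ by extending functions by zero. Weil functional: with $\Lambda$ the von Mangoldt function and $C_0$ the Euler--Mascheroni constant, $$W(f)=\int_{-\infty}^{\infty} f(x)(e^{x/2}+e^{-x/2})\,dx-\sum_{n\ge1}\frac{\Lambda(n)}{\sqrt n}\bigl(f(\log n)+f(-\log n)\bigr)-(\log 4\pi+C_0)f(0)-\int_0^\infty\{f(x)+f(-x)-2e^{-x/2}f(0)\}\frac{e^{x/2}\,dx}{e^x-e^{-x}}.$$ With $\widetilde v(x)=\overline{v(-x)}$ and $*$ denoting convolution, put $Q_W(v_1,v_2)=W(v_1*\widetilde{v_2})$ and $Q_W(v)=Q_W(v,v)$. For $v\in L^2(-a,a)$ the function $f=v*\widetilde v$ is continuous with compact support and $\mathrm{Re}\,f(x)\le f(0)$, so $Q_W(v)\in(-\infty,+\infty]$ is well defined.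 $Q_W^{\,a}$ is the restriction of $Q_W$ to $L^2(-a,a)$, with form domain $\mathfrak D(Q_W^{\,a})=\{v\in L^2(-a,a): |Q_W^{\,a}(v)|<\infty\}$. It is known that $Q_W^{\,a}$ is a densely defined, lower bounded, closed symmetric form. $A_a$ is the self-adjoint operator associated with it: $v\in\mathfrak D(A_a)$ with $A_av=h$ iff $v\in\mathfrak D(Q_W^{\,a})$, $h\in L^2(-a,a)$ and $Q_W^{\,a}(v,w)=\langle h,w\rangle_{L^2}$ for all $w\in\mathfrak D(Q_W^{\,a})$. It is known that the spectrum of $A_a$ is discrete, bounded below, and accumulates only at $+\infty$; its lowest eigenvalue is $\lambda_a=\inf_{0\ne v\in\mathfrak D(Q_W^{\,a})}Q_W^{\,a}(v)/\|v\|_{L^2}^2$. *)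

(* Defs.v *)
From HB Require Import structures.
From mathcomp Require Import all_boot all_order all_algebra.
From mathcomp Require Import all_classical all_reals all_analysis.
From mathcomp Require Import complex.

Set Implicit Arguments.
Unset Strict Implicit.
Unset Printing Implicit Defensive.

Import Order.TTheory GRing.Theory Num.Theory.
Import numFieldNormedType.Exports.

Local Open Scope classical_set_scope.
Local Open Scope ring_scope.
Local Open Scope complex_scope.

Section special_functions.
Context {R : realType}.

Definition euler_mascheroni : R :=
  limn (fun n => series harmonic n - ln n%:R).

Definition Gamma (x : R) : R :=
  Rintegral lebesgue_measure `]0, +oo[ (fun t : R => t `^ (x - 1) * expR (- t)).

Definition digamma (x : R) : R := derive1 Gamma x / Gamma x.

(* [n] is a power of a prime [p], with positive exponent, iff [p] is its only
   prime divisor. *)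
Definition von_mangoldt (n : nat) : R :=
  if primes n is [:: p] then ln p%:R else 0.

End special_functions.

Section weil.
Context {R : realType}.
Local Notation mu := (@lebesgue_measure R).
Implicit Types (a l : R) (f g v w h : R -> R[i]).

Definition cintegral f : R[i] :=
  (\int[mu]_x complex.Re (f x))%R +i* (\int[mu]_x complex.Im (f x))%R.

Definition inner f g : R[i] := cintegral (fun x => f x * (g x)^*).

Definition convolution f g (x : R) : R[i] :=
  cintegral (fun y => f y * g (x - y)).

Definition involution f (x : R) : R[i] := (f (- x))^*.

(* The Weil functional on real-valued functions.  For f = Re (v * v~) with v in
   L^2(-a, a), every term is finite except possibly the last integral, whose
   integrand has an integrable positive part; the value is then in ]-oo, +oo]. *)
Definition weil_real (f : R -> R) : \bar R :=
  (\int[mu]_x (f x * (expR (x / 2) + expR (- x / 2)))%:E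
   - \sum_(1 <= n <oo)
       (von_mangoldt n / Num.sqrt n%:R * (f (ln n%:R) + f (- ln n%:R)))%:E
   - ((ln (4 * pi) + euler_mascheroni) * f 0)%:E
   - \int[mu]_(x in `]0%R, +oo[)
       ((f x + f (- x) - 2 * expR (- x / 2) * f 0)
        * (expR (x / 2) / (expR x - expR (- x))))%:E)%E.

(* All the coefficients in W are real, so Re (W f) = W (Re f) and
   Im (W f) = W (Im f). *)
Definition reW f : \bar R := weil_real (fun x => complex.Re (f x)).
Definition imW f : \bar R := weil_real (fun x => complex.Im (f x)).

(* [reW] and [imW] are extended-real-valued; this is meaningful when both are
   finite, which is the case on the form domain below. *)
Definition QW v w : R[i] :=
  let f := convolution v (involution w) in fine (reW f) +i* fine (imW f).

Definition QW_finite v : Prop :=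
  let f := convolution v (involution v) in
  reW f \is a fin_num /\ imW f \is a fin_num.

(* Elements of L^2(-a, a) are represented by functions on the whole line that
   vanish outside ]-a, a[; two functions represent the same element iff they
   are equal almost everywhere. *)
Definition L2 a v : Prop :=
  [/\ (fun x => complex.Re (v x)) \in Lfun mu 2%:E,
      (fun x => complex.Im (v x)) \in Lfun mu 2%:E &
      forall x, x \notin `]- a, a[ -> v x = 0].

Definition form_domain a v : Prop := L2 a v /\ QW_finite v.

(* The graph of A_a: [v] is in the domain of A_a and A_a v = h. *)
Definition weil_operator a v h : Prop :=
  [/\ form_domain a v, L2 a h &
      forall w, form_domain a w -> QW v w = inner h w].

(* As A_a is self-adjoint, its eigenvalues are real. *)
Definition eigenfunction a l v : Prop :=
  weil_operator a v (fun x => l%:C * v x) /\ ~ {ae mu, forall x, v x = 0}.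

Definition is_eigenvalue a l : Prop := exists v, eigenfunction a l v.

Definition is_simple_eigenvalue a l : Prop :=
  is_eigenvalue a l /\
  forall v w, eigenfunction a l v -> eigenfunction a l w ->
    exists c : R[i], {ae mu, forall x, w x = c * v x}.

(* The infimum is attained, so this is the lowest eigenvalue of A_a. Junk values
   of [inf] are 0, and are thus excluded by [0 < lambda a]. *)
Definition lambda a : R := inf [set l | is_eigenvalue a l].

Definition ae_even v : Prop := {ae mu, forall x, v (- x) = v x}.

End weil.

(* Main.v *)
(* For g = v * v~ supported in [-2a, 2a] with 2a < log 2, no prime contributes to
   W(g), and splitting off the part of the last integral with x > 2a gives
   Q_W(v) = c(a) |v|^2 + int_0^{2a} (2 g(0) - g(x) - g(-x)) k(x) dx, where
   c(a) = log(1/a) - log(4 pi) - C_0 + O(a) and k(x) = 1/(2x) + O(1).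
   Replacing k by 1/(2x) perturbs the form by O(a) |v|^2 and makes it invariant
   under dilation, so the infimum of its Rayleigh quotient is a constant r
   independent of a; then mu_1 = r - log 2, since psi(2) = 1 - C_0.
   The indicator function of ]-a, a[ shows r <= 1. Reflecting [0, a] onto [a, 2a]
   and bounding the autocorrelation of v gives r > log 2, that is mu_1 > 0. On the
   functions of mean zero the autocorrelation has integral 0, and the bathtub
   principle bounds the Rayleigh quotient below by 2 log 2 > 1.
   This gap replaces compactness: it makes a minimizing sequence normalized by its
   mean a Cauchy sequence in L^2, so a ground state exists, and an eigenfunction of
   mean zero for the lowest eigenvalue vanishes. Hence that eigenvalue is simple,
   and, v(x) - v(-x) having mean zero, its eigenfunctions are even. *)
From HB Require Import structures.
From mathcomp Require Import all_boot all_order all_algebra.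
From mathcomp Require Import all_classical all_reals all_analysis.
From mathcomp Require Import measurable_realfun.
From mathcomp Require Import ring lra.
From mathcomp Require Import complex.
Require Import Defs.

Set Implicit Arguments.
Unset Strict Implicit.
Unset Printing Implicit Defensive.

Import Order.TTheory GRing.Theory Num.Theory.
Import numFieldNormedType.Exports.

Local Open Scope classical_set_scope.
Local Open Scope ring_scope.

(** * Affine changes of variable *)

(** The minimizer is built for the actual kernel [local_kernel] at each fixed [a]; the limit kernel
    1/(2x) only supplies numbers: the Rayleigh quotient 1 of the window, the bound 2 ln 2 at mean
    zero and the constant [rayleigh0]. The gap 2 ln 2 - 1 is a fixed positive number, so errors of
    order [a] cannot close it. Most estimates go through the autocorrelation [corr] and the forms
    [corr_diff], positive semi-definite for each translation x: an inequality is proved at fixed x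
    and then integrated against the kernel. Real-valued integrals take a default value on
    non-integrable functions, so integrability is carried in the domain [jump_dom]. The value of
    psi(2) is found without differentiating the Gamma integral: two-sided bounds on Gamma(x + s) /
    Gamma(x), transported by the functional equation, determine ln Gamma at 2 up to second order. *)

Section affine.
Context {R : realType}.
Local Notation mu := (@lebesgue_measure R).

Local Notation T := (measurableTypeR R).

Lemma measurable_affine (s t : R) :
  measurable_fun [set: T] (fun x : T => s * x + t : T).
Proof. exact: measurable_funD. Qed.

(** The right-hand side is the pushforward of Lebesgue measure under the affine map, scaled by |s|.
    By uniqueness of Lebesgue measure only half-open intervals are computed; a negative [s] swaps
    the brackets but not the length. *)
Lemma lebesgue_measure_affine (s t : R) (A : set R) : s != 0 -> measurable A ->
  mu A = (`|s|%:E * mu ((fun x : R => (s * x + t)%R) @^-1` A))%E.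
Proof.
move=> s0 mA.
have mphi := measurable_affine s t.
pose k := NngNum (normr_ge0 s).
pose m := mscale k
  (measure_function_pushforward__canonical__measure_function_Measure mu mphi).
rewrite [RHS](_ : _ = m A)//.
apply: (@lebesgue_measure_unique R m) => // X [[x y] _ <-].
transitivity (`|s|%:E * mu ((fun z : R => (s * z + t)%R) @^-1` `]x, y]%classic))%E;
  last by [].
have [sp|sn|s0'] := ltgtP 0 s; last by rewrite -s0' eqxx in s0.
- rewrite (_ : _ @^-1` _ = `](x - t) / s, (y - t) / s]%classic); last first.
    apply/seteqP; split => z /=; rewrite !in_itv/= => /andP[h1 h2]; apply/andP; split.
    + by rewrite ltr_pdivrMr// ltrBlDr mulrC.
    + by rewrite ler_pdivlMr// lerBrDr mulrC.
    + by move: h1; rewrite ltr_pdivrMr// ltrBlDr mulrC.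
    + by move: h2; rewrite ler_pdivlMr// lerBrDr mulrC.
  rewrite !lebesgue_measure_itv/= !lte_fin ltr_pM2r ?invr_gt0// ltrD2r.
  case: ifPn => _; last by rewrite mule0.
  by rewrite -!EFinB -EFinM gtr0_norm//; congr EFin; field.
- rewrite (_ : _ @^-1` _ = `[(y - t) / s, (x - t) / s[%classic); last first.
    apply/seteqP; split => z /=; rewrite !in_itv/= => /andP[h1 h2]; apply/andP; split.
    + by rewrite ler_ndivrMr// lerBrDr mulrC.
    + by rewrite ltr_ndivlMr// ltrBlDr mulrC.
    + by move: h2; rewrite ltr_ndivlMr// ltrBlDr mulrC.
    + by move: h1; rewrite ler_ndivrMr// lerBrDr mulrC.
  rewrite !lebesgue_measure_itv/= !lte_fin ltr_nM2r ?invr_lt0// ltrD2r.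
  case: ifPn => _; last by rewrite mule0.
  by rewrite -!EFinB -EFinM ltr0_norm//; congr EFin; field; rewrite ?lt_eqF.
Qed.

Lemma ge0_integral_affine (s t : R) (f : R -> \bar R) : s != 0 ->
  measurable_fun setT f -> (forall x, 0 <= f x)%E ->
  (\int[mu]_x f x = `|s|%:E * \int[mu]_x f (s * x + t)%R)%E.
Proof.
move=> s0 mf f0.
have mphi := measurable_affine s t.
rewrite -[X in (_ * X)%E](@ge0_integral_pushforward _ _ _ _ R _ mphi mu setT f)//.
rewrite -(@ge0_integral_mscale _ _ _ _ setT _ `|s|%:nng)//.
by apply: eq_measure_integral => A mA _; apply: lebesgue_measure_affine.
Qed.

Lemma integrable_affine (s t : R) (f : R -> R) : s != 0 ->
  mu.-integrable setT (EFin \o f) ->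
  mu.-integrable setT (EFin \o (fun x => f (s * x + t))).
Proof.
move=> s0 /integrableP[mf fi]; apply/integrableP; split.
  by apply: (measurableT_comp mf); exact: measurable_affine.
move: fi; rewrite (@ge0_integral_affine s t _ s0)//; last exact: measurableT_comp.
rewrite ltey => h; rewrite ltey; apply: contra_neq h => /= ->.
by rewrite gt0_muley// lte_fin normr_gt0.
Qed.

Lemma Rintegral_affine (s t : R) (f : R -> R) : s != 0 ->
  mu.-integrable setT (EFin \o f) ->
  \int[mu]_x f x = `|s| * \int[mu]_x f (s * x + t).
Proof.
move=> s0 fi; have fi' := integrable_affine t s0 fi.
have [mf _] := integrableP _ _ _ fi.
rewrite -RintegralZl// /Rintegral; congr fine.
rewrite integralE [RHS]integralE.
rewrite (@ge0_integral_affine s t)//; last exact: measurable_funepos.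
rewrite [X in (_ - X)%E](@ge0_integral_affine s t)//; last exact: measurable_funeneg.
have [mf' _] := integrableP _ _ _ fi'.
have m1 (g : R -> \bar R) : measurable_fun [set: T] g ->
    measurable_fun [set: T] (fun x : T => g (s * x + t)).
  by move=> mg; apply: (measurableT_comp mg); exact: measurable_affine.
have mp := m1 _ (measurable_funepos mf).
have mn := m1 _ (measurable_funeneg mf).
rewrite -[X in (X - _)%E](ge0_integralZl mu measurableT mp)//.
rewrite -[X in (_ - X)%E](ge0_integralZl mu measurableT mn)//.
congr (_ - _)%E; apply: eq_integral => x _.
- by rewrite !funeposE maxe_pMr// mule0.
- by rewrite !funenegE maxe_pMr// mule0 muleN.
Qed.

End affine.

(** * Autocorrelation of square-integrable functions *)

Section square_integrable.
Context {R : realType}.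
Local Notation mu := (@lebesgue_measure R).
Local Notation T := (measurableTypeR R).
Implicit Types (u v w : R -> R) (c x : R).

Definition sq u := measurable_fun [set: T] u /\
  mu.-integrable setT (EFin \o (fun x => u x ^+ 2)).
(** One coefficient is enough: differences are [lc (-1)], and the multiple c u is [lc (c - 1) u u],
    so closure under [lc] includes closure under scaling. *)
Definition lc c u w := fun x => u x + c * w x.
Definition ip u w := \int[mu]_x (u x * w x).
Definition sh x w := fun y => w (y - x).
Definition corr u w x := ip u (sh x w).
(* [corr_diff u u x] is the squared distance between [u] and its translate
   [sh x u]. *)
Definition corr_diff u w x := 2 * ip u w - corr u w x - corr u w (- x).

Lemma Lfun2E u : u \in Lfun mu 2%:E <-> sq u.
Proof.
split=> [ul|[mu' ui]].
  split; last exact: Lfun2_integrable_sqr.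
  by move: ul; rewrite inE => /andP[]; rewrite inE.
rewrite inE; apply/andP; split; rewrite inE//=.
rewrite /finite_norm unlock poweR_lty//.
have /integrableP[_] := ui; apply: le_lt_trans.
rewrite le_eqVlt; apply/orP; left; apply/eqP.
by apply: eq_integral => x _ /=; rewrite powR_mulrn// normrX.
Qed.

Lemma sqM u w : sq u -> sq w -> mu.-integrable setT (EFin \o (fun x => u x * w x)).
Proof.
move=> [mu' ui] [mw wi].
have := integrableD measurableT ui wi; apply: le_integrable => //.
  by apply/measurable_EFinP; exact: measurable_funM.
move=> x _ /=; rewrite lee_fin [leRHS]ger0_norm ?addr_ge0 ?sqr_ge0//.
have [h|h] := leP 0 (u x * w x).
  rewrite ger0_norm//; nra.
rewrite ltr0_norm//; nra.
Qed.

Lemma sq_lc c u w : sq u -> sq w -> sq (lc c u w).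
Proof.
move=> su sw; have uw := sqM su sw; move: su sw => [mu' ui] [mw wi]; split.
  by apply: measurable_funD => //; exact: measurable_funM.
have h1 := integrableZl measurableT (2 * c) uw.
have h2 := integrableZl measurableT (c ^+ 2) wi.
have := integrableD measurableT (integrableD measurableT ui h1) h2.
apply: eq_integrable => // x _ /=; rewrite -!EFinM -!EFinD; congr EFin.
by rewrite /lc; ring.
Qed.

Lemma sq_affine s t u : s != 0 -> sq u -> sq (fun x => u (s * x + t)).
Proof.
move=> s0 [mu' ui]; split; last exact: (integrable_affine t s0 ui).
by apply: (measurableT_comp mu'); exact: measurable_affine.
Qed.

Lemma shE x w : sh x w = fun y => w (1 * y + - x).
Proof. by apply/funext => y; rewrite mul1r. Qed.

Lemma sq_sh x w : sq w -> sq (sh x w).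
Proof. by rewrite shE; apply: sq_affine; rewrite oner_eq0. Qed.

Lemma ipC u w : ip u w = ip w u.
Proof. by apply: eq_Rintegral => x _; rewrite mulrC. Qed.

Lemma ip_lcl c u w v : sq u -> sq w -> sq v ->
  ip (lc c u w) v = ip u v + c * ip w v.
Proof.
move=> su sw sv; rewrite /ip -RintegralZl//; last exact: sqM.
rewrite -RintegralD//; last 2 first.
- exact: sqM.
- by have := integrableZl measurableT c (sqM sw sv); apply: eq_integrable.
by apply: eq_Rintegral => x _; rewrite /lc; ring.
Qed.

Lemma ip_lcr c u w v : sq u -> sq w -> sq v ->
  ip v (lc c u w) = ip v u + c * ip v w.
Proof. by move=> su sw sv; rewrite ipC ip_lcl// !(ipC v). Qed.

Lemma ip_ge0 u : 0 <= ip u u.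
Proof. by apply: Rintegral_ge0 => x _; rewrite -expr2 sqr_ge0. Qed.

Lemma ip_affine s t u w : s != 0 -> sq u -> sq w ->
  ip u w = `|s| * ip (fun x => u (s * x + t)) (fun x => w (s * x + t)).
Proof. by move=> s0 su sw; rewrite /ip (Rintegral_affine t s0 (sqM su sw)). Qed.

Lemma ip_sh x u w : sq u -> sq w -> ip (sh x u) (sh x w) = ip u w.
Proof.
move=> su sw; rewrite !shE (@ip_affine 1 (- x) u w)// ?oner_eq0//.
by rewrite normr1 mul1r.
Qed.

(** Positivity of [ip] at u + w and u - w. The bound is linear in the squared norms, and loses
    nothing for the autocorrelation, where both norms agree. *)
Lemma ip_bound u w : sq u -> sq w -> `|ip u w| <= (ip u u + ip w w) / 2.
Proof.
move=> su sw.
have h1 := ip_ge0 (lc 1 u w); have h2 := ip_ge0 (lc (-1) u w).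
have s1 := sq_lc 1 su sw; have s2 := sq_lc (-1) su sw.
rewrite ip_lcl// !ip_lcr// (ipC w u) in h1; rewrite ip_lcl// !ip_lcr// (ipC w u) in h2.
by rewrite ler_norml; apply/andP; split; lra.
Qed.

Lemma ip_CS u w : sq u -> sq w -> ip u w ^+ 2 <= ip u u * ip w w.
Proof.
move=> su sw.
have h c : 0 <= ip u u + 2 * c * ip u w + c ^+ 2 * ip w w.
  have := ip_ge0 (lc c u w); rewrite ip_lcl ?ip_lcr ?(ipC w u) //; last exact: sq_lc.
  by move=> h; lra.
have u0 := ip_ge0 u; have w0 := ip_ge0 w.
have [w00|wn0] := eqVneq (ip w w) 0; last first.
  have := h (- (ip u w / ip w w)).
  have wp : 0 < ip w w by rewrite lt_def wn0.
  rewrite (_ : _ + _ = (ip u u * ip w w - ip u w ^+ 2) / ip w w); last by field.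
  by rewrite pmulr_lge0 ?invr_gt0// subr_ge0.
rewrite w00 mulr0; have [->|i0] := eqVneq (ip u w) 0; first by rewrite expr0n.
(* With [ip w w = 0] the polynomial is affine in c, and this c gives it the value -1. *)
have := h (- ((ip u u + 1) / (2 * ip u w))); rewrite w00 mulr0 addr0.
rewrite (_ : _ + _ = -1); last by field.
by rewrite ler0N1.
Qed.

Lemma corrC u w x : sq u -> sq w -> corr u w (- x) = corr w u x.
Proof.
move=> su sw; rewrite /corr [RHS]ipC -(@ip_sh x u (sh (- x) w))//; last exact: sq_sh.
by congr ip; apply/funext => y; rewrite /sh; congr w; ring.
Qed.

Lemma corr_bound u w x : sq u -> sq w -> `|corr u w x| <= (ip u u + ip w w) / 2.
Proof.
by move=> su sw; rewrite -(ip_sh x sw sw); apply: ip_bound => //; exact: sq_sh.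
Qed.

Lemma corr_lcl c u w v x : sq u -> sq w -> sq v ->
  corr (lc c u w) v x = corr u v x + c * corr w v x.
Proof. by move=> su sw sv; rewrite /corr ip_lcl//; exact: sq_sh. Qed.

Lemma corr0 u w : corr u w 0 = ip u w.
Proof. by congr ip; apply/funext => y; rewrite /sh subr0. Qed.

Lemma corr_diffC u w x : sq u -> sq w -> corr_diff u w x = corr_diff w u x.
Proof. by move=> su sw; rewrite /corr_diff !corrC// (ipC u) -[x in corr u w x]opprK corrC//;
  ring. Qed.

Lemma corr_diff_lcl c u w v x : sq u -> sq w -> sq v ->
  corr_diff (lc c u w) v x = corr_diff u v x + c * corr_diff w v x.
Proof. by move=> su sw sv; rewrite /corr_diff ip_lcl// !corr_lcl//; ring. Qed.

Lemma corr_diffE u x : sq u -> corr_diff u u x = 2 * (ip u u - corr u u x).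
Proof. by move=> su; rewrite /corr_diff corrC//; ring. Qed.

Lemma corr_diff_ge0 u x : sq u -> 0 <= corr_diff u u x.
Proof.
by move=> su; rewrite corr_diffE//; have := corr_bound x su su; rewrite ler_norml => /andP[]; lra.
Qed.

Lemma corr_diff_le u x : sq u -> corr_diff u u x <= 4 * ip u u.
Proof.
by move=> su; rewrite corr_diffE//; have := corr_bound x su su; rewrite ler_norml => /andP[]; lra.
Qed.

(* [corr_diff] is a positive semi-definite form. *)
Lemma corr_diff_bound u w x : sq u -> sq w ->
  `|corr_diff u w x| <= (corr_diff u u x + corr_diff w w x) / 2.
Proof.
move=> su sw.
have h1 := corr_diff_ge0 x (sq_lc 1 su sw); have h2 := corr_diff_ge0 x (sq_lc (-1) su sw).
have s1 := sq_lc 1 su sw; have s2 := sq_lc (-1) su sw.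
rewrite corr_diff_lcl// (corr_diffC _ su)// (corr_diffC _ sw)// !corr_diff_lcl//
  (corr_diffC x sw su) in h1.
rewrite corr_diff_lcl// (corr_diffC _ su)// (corr_diffC _ sw)// !corr_diff_lcl//
  (corr_diffC x sw su) in h2.
by rewrite ler_norml; apply/andP; split; lra.
Qed.

(** The second difference [u - 2 sh x u + sh (2 * x) u] has nonnegative squared norm. On the Fourier
    side this is 1 - cos 2t <= 4 (1 - cos t). *)
Lemma corr_double u x : sq u ->
  ip u u - corr u u (2 * x) <= 4 * (ip u u - corr u u x).
Proof.
move=> su; have s1 := sq_sh x su; have s2 := sq_sh (2 * x) su.
have := ip_ge0 (lc 1 (lc (- 2) u (sh x u)) (sh (2 * x) u)).
have E : ip (sh x u) (sh (2 * x) u) = corr u u x.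
  rewrite (_ : sh (2 * x) u = sh x (sh x u)) ?ip_sh//.
  by apply/funext => y; rewrite /sh; congr u; ring.
have s3 := sq_lc (-2) su s1; have s4 := sq_lc 1 s3 s2.
rewrite !(ip_lcl, ip_lcr)//.
rewrite (ipC (sh (2 * x) u) (sh x u)) E (ipC (sh x u) u) (ipC (sh (2 * x) u) u).
by rewrite !ip_sh// -/(corr u u x) -/(corr u u (2 * x)); lra.
Qed.

(** Polarization makes [corr] an affine function of the squared distance between u and a translate
    of w. That is a parameter integral of a nonnegative function, so its measurability is part of
    Tonelli's theorem. *)
Lemma measurable_corr u w : sq u -> sq w -> measurable_fun [set: T] (corr u w).
Proof.
move=> su sw.
have -> : corr u w = fun x => (ip u u + ip w w) / 2 -
   2^-1 * fine (\int[mu]_y ((u y - w (y - x)) ^+ 2)%:E).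
  apply/funext => x; have sw' := sq_sh x sw; have s := sq_lc (-1) su sw'.
  have -> : fine (\int[mu]_y ((u y - w (y - x)) ^+ 2)%:E) =
      ip (lc (-1) u (sh x w)) (lc (-1) u (sh x w)).
    congr fine; apply: eq_integral => y _; congr EFin; rewrite /lc /sh; ring.
  rewrite ip_lcl// !ip_lcr// ip_sh// (ipC (sh x w)) /corr; lra.
apply: measurable_funB => //; apply: measurable_funM => //.
apply: (measurableT_comp (fine_measurable measurableT)).
pose F (z : T * T) : \bar R := ((u z.2 - w (z.2 - z.1)) ^+ 2)%:E.
apply: (@measurable_fun_fubini_tonelli_F _ _ T T R mu F).
  apply/measurable_EFinP; apply: measurable_funX; apply: measurable_funB.
    by apply: (measurableT_comp su.1); exact: measurable_snd.
  by apply: (measurableT_comp sw.1); apply: measurable_funB;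
    [exact: measurable_snd|exact: measurable_fst].
by move=> z; rewrite lee_fin sqr_ge0.
Qed.

Lemma measurable_corr_diff u w : sq u -> sq w -> measurable_fun [set: T] (corr_diff u w).
Proof.
move=> su sw; have m := measurable_corr su sw.
apply: measurable_funB; first by apply: measurable_funB.
by have := measurableT_comp m (@oppr_measurable R setT).
Qed.

End square_integrable.

(** * Integrals over bounded intervals *)

Section interval_integrals.
Context {R : realType}.
Local Notation mu := (@lebesgue_measure R).
Local Notation T := (measurableTypeR R).

Lemma measurable_itvT (i : interval R) : measurable ([set` i] : set T).
Proof. exact: measurable_itv. Qed.

Lemma lebesgue_measure_oo (a b : R) :
  mu `]a, b[%classic = (if a < b then b - a else 0)%:E.
Proof. by rewrite lebesgue_measure_itv/= lte_fin; case: ifP. Qed.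

Lemma bounded_integrable (f : R -> R) (a b M : R) :
  measurable_fun (`]a, b[ : set T) f -> (forall x, a < x < b -> `|f x| <= M) ->
  mu.-integrable `]a, b[ (EFin \o f).
Proof.
move=> mf real_weil_form; apply: measurable_bounded_integrable => //.
  by have := ltry (if a < b then b - a else 0); rewrite -lebesgue_measure_oo.
exists M; split; first exact: num_real.
move=> N MN x /=; rewrite in_itv/= => h; exact/(le_trans (real_weil_form _ h))/ltW.
Qed.

Lemma Rintegral_cst_itv (a b c : R) : a <= b -> \int[mu]_(x in `]a, b[) c = c * (b - a).
Proof.
move=> ab.
have -> : \int[mu]_(x in `]a, b[) c = c * fine (mu `]a, b[%classic).
  exact: Rintegral_cst (measurable_itvT _) c.
rewrite lebesgue_measure_oo /=; congr (c * _).
by case: ltgtP ab => // ->; rewrite subrr.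
Qed.

Lemma integrable_cst_itv (a b c : R) : mu.-integrable `]a, b[ (EFin \o (fun=> c)).
Proof. by apply: (@bounded_integrable _ _ _ `|c|). Qed.

Lemma within_continuous_inv (a b : R) : 0 < a ->
  {within `[a, b], continuous (fun x : R => x^-1)}.
Proof.
move=> a0; apply: continuous_in_subspaceT => x; rewrite inE/= in_itv/= => /andP[ax _].
by apply: inv_continuous; rewrite gt_eqF// (lt_le_trans a0).
Qed.

Lemma integrable_inv (a b : R) : 0 < a -> mu.-integrable `]a, b[ (EFin \o (fun x => x^-1)).
Proof.
move=> a0; have [ab|ba] := leP b a; first by rewrite set_itv_ge ?bnd_simp -?leNgt//;
  exact: integrable_set0.
apply: (@integrableS _ T _ mu `[a, b] `]a, b[) => //; first exact: subset_itv_oo_cc.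
apply: continuous_compact_integrable; first exact: segment_compact.
exact: within_continuous_inv.
Qed.

Lemma Rintegral_inv (a b : R) : 0 < a -> a < b ->
  \int[mu]_(x in `]a, b[) x^-1 = ln b - ln a.
Proof.
move=> a0 ab.
have ii : mu.-integrable `[a, b] (EFin \o (fun x : R => x^-1)).
  apply: continuous_compact_integrable; first exact: segment_compact.
  exact: within_continuous_inv.
have i1 : mu.-integrable `[a, b[ (EFin \o (fun x : R => x^-1)).
  by apply: integrableS ii => //; exact: subset_itv_co_cc.
rewrite Rintegral_itv_obnd_cbnd ?Rintegral_itv_bndo_bndc//; last exact: integrable_inv.
rewrite /Rintegral (@continuous_FTC2 _ _ (@ln R))//.
- exact: within_continuous_inv.
- split.
  + by move=> x; rewrite in_itv/= => /andP[ax _]; apply: ex_derive; apply: is_derive1_ln;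
    exact: lt_trans ax.
  + by apply/cvg_at_right_filter/continuous_ln.
  + by apply/cvg_at_left_filter/continuous_ln; exact: lt_trans ab.
- move=> x; rewrite in_itv/= => /andP[ax _]; rewrite derive1E.
  by have [_ ->] := is_derive1_ln (lt_trans a0 ax).
Qed.

End interval_integrals.

(** * Dirichlet forms on functions supported in an interval *)

Section forms.
Context {R : realType}.
Local Notation mu := (@lebesgue_measure R).
Local Notation T := (measurableTypeR R).
Implicit Types (u v w K : R -> R) (a c x : R).

Definition L2on a u := sq u /\ forall x, x \notin `]- a, a[ -> u x = 0.
(** The Dirichlet form of a symmetric jump kernel, organized by jump length x. Longer jumps separate
    the supports completely and contribute only a multiple of [ip u w], accounted for elsewhere. *)
Definition jump_form K a u w := \int[mu]_(x in `]0, 2 * a[) (corr_diff u w x * K x).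
(** Integrability is part of the domain: otherwise a function of infinite energy would get the
    default value 0 as its [jump_form]. *)
Definition jump_dom K a u := L2on a u /\
  mu.-integrable `]0, 2 * a[ (EFin \o (fun x => corr_diff u u x * K x)).
(** For u in [L2on a], [ip u (window a)] is the integral of u. Mean zero is thus orthogonality to
    the window. *)
Definition window a : R -> R := \1_`]- a, a[.

Lemma L2on_lc a c u w : L2on a u -> L2on a w -> L2on a (lc c u w).
Proof.
move=> [su u0] [sw w0]; split; first exact: sq_lc.
by move=> x xa; rewrite /lc u0// w0// mulr0 addr0.
Qed.

Lemma corr_diff_lc2 c u w x : sq u -> sq w -> corr_diff (lc c u w) (lc c u w) x =
  corr_diff u u x + 2 * c * corr_diff u w x + c ^+ 2 * corr_diff w w x.
Proof.
move=> su sw; have s1 := sq_lc c su sw.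
rewrite corr_diff_lcl// (corr_diffC x su s1) (corr_diffC x sw s1) !corr_diff_lcl//
  (corr_diffC x sw su); ring.
Qed.

Section kernel.
Variables (K : R -> R) (a : R).
Hypothesis mK : measurable_fun (`]0, 2 * a[ : set T) K.
Hypothesis K0 : forall x, 0 < x < 2 * a -> 0 <= K x.

(** [corr_diff_bound] dominates the mixed integrand by the mean of the two diagonal ones. *)
Lemma jump_form_integrable u w : jump_dom K a u -> jump_dom K a w ->
  mu.-integrable `]0, 2 * a[ (EFin \o (fun x => corr_diff u w x * K x)).
Proof.
move=> [[su _] ui] [[sw _] wi].
have := integrableD (measurable_itvT _) ui wi; apply: le_integrable => //.
  apply/measurable_EFinP; apply: measurable_funM => //.
  by apply: measurable_funTS; exact: measurable_corr_diff.
move=> x; rewrite /= in_itv/= => xa; have k0 := K0 xa.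
have d1 := corr_diff_ge0 x su; have d2 := corr_diff_ge0 x sw; have d3 := corr_diff_bound x su sw.
rewrite lee_fin [leRHS]ger0_norm ?addr_ge0 ?mulr_ge0// normrM (ger0_norm k0) -mulrDl.
by apply: ler_wpM2r => //; lra.
Qed.

Lemma jump_formC u w : jump_dom K a u -> jump_dom K a w -> jump_form K a u w = jump_form K a w u.
Proof.
by move=> [[su _] _] [[sw _] _]; apply: eq_Rintegral => x _; rewrite corr_diffC.
Qed.

Lemma jump_dom_lc c u w : jump_dom K a u -> jump_dom K a w -> jump_dom K a (lc c u w).
Proof.
move=> du dw; have uw := jump_form_integrable du dw; move: du dw => [lu ui] [lw wi].
split; first exact: L2on_lc.
have mi := measurable_itvT `]0, 2 * a[.
have h1 := integrableZl mi (2 * c) uw.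
have h2 := integrableZl mi (c ^+ 2) wi.
have := integrableD mi (integrableD mi ui h1) h2.
move: lu lw => [su _] [sw _]; have s1 := sq_lc c su sw.
apply: eq_integrable => // x _ /=; rewrite -!EFinM -!EFinD; congr EFin.
by rewrite corr_diff_lc2//; ring.
Qed.

Lemma jump_form_lcl c u w v : jump_dom K a u -> jump_dom K a w -> jump_dom K a v ->
  jump_form K a (lc c u w) v = jump_form K a u v + c * jump_form K a w v.
Proof.
move=> du dw dv; rewrite /jump_form -RintegralZl//; last exact: jump_form_integrable.
have mi := measurable_itvT `]0, 2 * a[.
rewrite -RintegralD//; last 2 first.
- exact: jump_form_integrable.
- by have := integrableZl mi c (jump_form_integrable dw dv); apply: eq_integrable.
apply: eq_Rintegral => x _; rewrite corr_diff_lcl//; first by ring.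
- by case: du => -[].
- by case: dw => -[].
- by case: dv => -[].
Qed.

Lemma jump_form_ge0 u : jump_dom K a u -> 0 <= jump_form K a u u.
Proof.
move=> [[su _] _]; apply: Rintegral_ge0 => x; rewrite /= in_itv/= => xa.
by rewrite mulr_ge0 ?corr_diff_ge0 ?K0.
Qed.

End kernel.

Lemma sq_window a : sq (window a).
Proof.
split; first exact: measurable_indic.
have h : mu.-integrable setT (EFin \o window a) by exact: integrable_indic_itv.
apply: eq_integrable h => // x _ /=.
by rewrite /window indicE; case: (x \in _); rewrite ?expr1n ?expr0n.
Qed.

Lemma L2on_window a : L2on a (window a).
Proof.
split; first exact: sq_window.
by move=> x xa; rewrite /window indicE mem_setE (negbTE xa).
Qed.

Lemma mul_window a u y : L2on a u -> u y * window a y = u y.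
Proof.
move=> [_ u0]; rewrite /window indicE mem_setE.
by have [h|h] := boolP (y \in `]- a, a[); rewrite ?mulr1// mulr0 u0.
Qed.

Lemma ip_window a : 0 < a -> ip (window a) (window a) = 2 * a.
Proof.
move=> a0; transitivity (\int[mu]_(x in `]- a, a[) (1 : R)); last first.
  by rewrite Rintegral_cst_itv ?mul1r; lra.
rewrite [RHS]Rintegral_mkcond; apply: eq_Rintegral => x _.
by rewrite (mul_window _ (L2on_window a)) /window indicE patchE; case: (x \in _).
Qed.

(** * Bounds on the autocorrelation by cutting off tails *)

Definition gt_part a u : R -> R := fun y => if a < y then u y else 0.
Definition lt_part a u : R -> R := fun y => if y < a then u y else 0.

Lemma sq_cut (D : set R) u : measurable (D : set T) -> sq u -> sq (u \_ D).
Proof.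
move=> mD [mu' ui]; split.
  by apply/(measurable_restrictT _ mD); exact: measurable_funTS.
apply: le_integrable ui => //.
  by apply/measurable_EFinP/measurable_funX/(measurable_restrictT _ mD); exact: measurable_funTS.
move=> x _ /=; rewrite lee_fin !ger0_norm ?sqr_ge0// patchE.
by case: ifP => //; rewrite expr0n sqr_ge0.
Qed.

Lemma sq_gt a u : sq u -> sq (gt_part a u).
Proof.
move=> su; rewrite (_ : gt_part a u = u \_ `]a, +oo[); first exact: sq_cut.
apply/funext => y; rewrite /gt_part patchE mem_setE in_itv/= andbT.
by case: ifP.
Qed.

Lemma sq_lt a u : sq u -> sq (lt_part a u).
Proof.
move=> su; rewrite (_ : lt_part a u = u \_ `]-oo, a[); first exact: sq_cut.
apply/funext => y; rewrite /lt_part patchE mem_setE in_itv/=.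
by case: ifP.
Qed.

Lemma ip_parts s t u : s <= t -> sq u ->
  ip (gt_part t u) (gt_part t u) + ip (lt_part s u) (lt_part s u) <= ip u u.
Proof.
move=> st su; have sg := sq_gt t su; have sl := sq_lt s su.
rewrite /ip -RintegralD//; [|exact: sqM|exact: sqM].
apply: le_Rintegral => //; last 1 first.
- move=> x _; rewrite /gt_part /lt_part.
  have [h1|h1] := ltP t x; have [h2|h2] := ltP x s;
    rewrite ?mulr0 ?addr0 ?add0r ?lexx -?expr2 ?sqr_ge0//; lra.
- by have := integrableD measurableT (sqM sg sg) (sqM sl sl); apply: eq_integrable.
- exact: sqM.
Qed.

(** The product u(y) u(y - x) is nonzero only if y > x - a and y - x < a - x. So the first factor
    may be cut to its right tail and the second to its left tail before applying [corr_bound]. *)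
Lemma corr_parts a u x : L2on a u ->
  corr u u x <= (ip (gt_part (x - a) u) (gt_part (x - a) u) +
                 ip (lt_part (a - x) u) (lt_part (a - x) u)) / 2.
Proof.
move=> [su u0]; have sg := sq_gt (x - a) su; have sl := sq_lt (a - x) su.
have -> : corr u u x = corr (gt_part (x - a) u) (lt_part (a - x) u) x.
  apply: eq_Rintegral => y _; rewrite /sh /gt_part /lt_part.
  have [h1|h1] := ltP (x - a) y; last first.
    by rewrite mul0r (u0 (y - x)) ?mulr0// in_itv/=; lra.
  have [h2|h2] := ltP (y - x) (a - x) => //.
  by rewrite mulr0 (u0 y) ?mul0r// in_itv/=; lra.
have := corr_bound x sg sl; rewrite ler_norml => /andP[]; lra.
Qed.

(** The tails given by [corr_parts] at x and at 2a - x are cut at the same two points, x - a and a -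
    x. Regrouped by cutting point they form two disjoint pairs, each of total squared norm at most
    [ip u u]. *)
Lemma corr_reflect a u x : L2on a u -> corr u u x + corr u u (2 * a - x) <= ip u u.
Proof.
move=> lu; have [su _] := lu.
have h1 := corr_parts x lu; have h2 := corr_parts (2 * a - x) lu.
have h3 := ip_parts (lexx (x - a)) su; have h4 := ip_parts (lexx (a - x)) su.
rewrite (_ : 2 * a - x - a = a - x) in h2; last by ring.
rewrite (_ : a - (2 * a - x) = x - a) in h2; last by ring.
lra.
Qed.

(** For x >= a the two tails of [corr_parts] are disjoint. *)
Lemma corr_half a u x : L2on a u -> a <= x -> corr u u x <= ip u u / 2.
Proof.
move=> lu ax; have h1 := corr_parts x lu.
have h : a - x <= x - a by lra.
by have := ip_parts h lu.1; lra.
Qed.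

(** Doubling brings x beyond a, where [corr_half] leaves at least half of [ip u u]; [corr_double]
    divides this by 4. *)
Lemma corr_quarter a u x : L2on a u -> a / 2 <= x -> ip u u / 8 <= ip u u - corr u u x.
Proof.
move=> lu ax; have h := corr_double x lu.1.
have h2 : a <= 2 * x by lra.
by have := corr_half lu h2; lra.
Qed.

Lemma corr_far a u w x : L2on a u -> L2on a w -> 2 * a <= `|x| -> corr u w x = 0.
Proof.
move=> [_ u0] [_ w0] ax; rewrite /corr /ip (_ : (fun y => _) = fun=> 0).
  by rewrite /Rintegral integral0.
apply/funext => y; rewrite /sh.
have [h|h] := boolP (y \in `]- a, a[); last by rewrite u0// mul0r.
rewrite (w0 (y - x)) ?mulr0//; move: h; rewrite !in_itv/= => /andP[h1 h2].
apply/negP => /andP[h3 h4]; move: ax; apply/negP; rewrite -ltNge ltr_norml; lra.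
Qed.

(** * The energy for the dilation-invariant kernel 1/(2x) *)

Local Notation E a u := (jump_form (fun x => (2 * x)^-1) a u u).

Lemma measurable_inv2 b : measurable_fun (`]0, b[ : set T) (fun x : R => (2 * x)^-1).
Proof.
apply: open_continuous_measurable_fun; first exact: interval_open.
move=> x; rewrite inE /= in_itv/= => /andP[x0 _].
apply: (@cvgV R R _ _ (fun y : R => 2 * y)); last exact: mulrl_continuous.
by rewrite gt_eqF// mulr_gt0.
Qed.

Lemma inv2_ge0 a x : 0 < x < 2 * a -> 0 <= (2 * x)^-1.
Proof. by move=> /andP[x0 _]; rewrite invr_ge0 mulr_ge0// ltW. Qed.

Lemma corr_diff_window a x : 0 < x < 2 * a -> corr_diff (window a) (window a) x = 2 * x.
Proof.
move=> /andP[x0 xa]; have a0 : 0 < a by lra.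
rewrite corr_diffE ?ip_window//; last exact: sq_window.
rewrite (_ : corr _ _ _ = 2 * a - x); first by ring.
transitivity (\int[mu]_(y in `]x - a, a[) (1 : R)); last first.
  by rewrite Rintegral_cst_itv ?mul1r; lra.
rewrite [RHS]Rintegral_mkcond; apply: eq_Rintegral => y _.
rewrite /sh /window !indicE !mem_setE patchE mem_setE !in_itv/=.
have [h1|h1] := ltP (- a) y; have [h2|h2] := ltP y a; have [h3|h3] := ltP (x - a) y;
 rewrite /= ?mul0r ?mul1r//; try lra.
- by rewrite (_ : (_ < _) && _) //; lra.
- by rewrite (_ : (_ < _) && _ = false) //; apply/negbTE; lra.
Qed.

(** By [corr_diff_window] the integrand is 2 x K(x): the factor x compensates a singularity of K of
    order 1/x. *)
Lemma jump_dom_window K a : measurable_fun (`]0, 2 * a[ : set T) K ->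
  (forall x, 0 < x < 2 * a -> 0 <= K x <= x^-1) -> jump_dom K a (window a).
Proof.
move=> mK hK; split; first exact: L2on_window.
apply: (@bounded_integrable _ _ _ _ 2).
  by apply: measurable_funM => //; apply: measurable_funTS; apply: measurable_corr_diff;
    exact: sq_window.
move=> x xa; rewrite corr_diff_window//; have /andP[k1 k2] := hK _ xa.
have x0 : 0 < x by lra.
rewrite ger0_norm ?mulr_ge0 ?(ltW x0)// -mulrA -[leRHS]mulr1 ler_pM2l//.
by rewrite mulrC -ler_pdivlMr// mul1r.
Qed.

Lemma energy_window a : 0 < a -> E a (window a) = ip (window a) (window a).
Proof.
move=> a0; rewrite ip_window//.
transitivity (\int[mu]_(x in `]0, 2 * a[) (1 : R)); last first.
  by rewrite Rintegral_cst_itv ?mul1r; lra.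
apply: eq_Rintegral => x; rewrite inE /= in_itv/= => xa.
by rewrite corr_diff_window// mulfV//; apply/lt0r_neq0; lra.
Qed.

Lemma energyE a u x : L2on a u -> 0 < x ->
  corr_diff u u x * (2 * x)^-1 = (ip u u - corr u u x) / x.
Proof. by move=> [su _] x0; rewrite corr_diffE//; field; rewrite ?gt_eqF. Qed.

Lemma ler_Rintegral_pw (a b : R) (f g : R -> R) :
  mu.-integrable `]a, b[ (EFin \o f) -> mu.-integrable `]a, b[ (EFin \o g) ->
  (forall x, a < x < b -> f x <= g x) ->
  \int[mu]_(x in `]a, b[) f x <= \int[mu]_(x in `]a, b[) g x.
Proof.
move=> fi gi fg; apply: le_Rintegral => //; exact: measurable_itvT.
Qed.

Lemma integrable_oo (f : R -> R) (a b c d : R) : c <= a -> b <= d ->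
  mu.-integrable `]c, d[ (EFin \o f) -> mu.-integrable `]a, b[ (EFin \o f).
Proof.
move=> ca bd; apply: integrableS; try exact: measurable_itvT.
by apply: subset_itv; rewrite bnd_simp.
Qed.

Lemma Rintegral_split (f : R -> R) (a b c : R) : a < b -> b < c ->
  mu.-integrable `]a, c[ (EFin \o f) ->
  \int[mu]_(x in `]a, c[) f x =
  \int[mu]_(x in `]a, b[) f x + \int[mu]_(x in `]b, c[) f x.
Proof.
move=> ab bc fi.
have := @Rintegral_itvB R f (BRight a) (BLeft c) b fi.
rewrite !bnd_simp => /(_ (ltW ab) bc) <-.
rewrite -Rintegral_itv_bndo_bndc; last by apply: integrable_oo fi => //; exact: ltW.
by ring.
Qed.

Lemma RintegralD_oo (a b : R) (f g : R -> R) :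
  mu.-integrable `]a, b[ (EFin \o f) -> mu.-integrable `]a, b[ (EFin \o g) ->
  mu.-integrable `]a, b[ (EFin \o (fun x => f x + g x)) /\
  \int[mu]_(x in `]a, b[) (f x + g x) =
  \int[mu]_(x in `]a, b[) f x + \int[mu]_(x in `]a, b[) g x.
Proof.
move=> fi gi; split; last by apply: RintegralD => //; exact: measurable_itvT.
exact: (integrableD (measurable_itvT _) fi gi).
Qed.

Lemma RintegralZ_oo (a b c : R) (f : R -> R) :
  mu.-integrable `]a, b[ (EFin \o f) ->
  mu.-integrable `]a, b[ (EFin \o (fun x => c * f x)) /\
  \int[mu]_(x in `]a, b[) (c * f x) = c * \int[mu]_(x in `]a, b[) f x.
Proof.
move=> fi; split; last by apply: RintegralZl => //; exact: measurable_itvT.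
exact: (integrableZl (measurable_itvT _) c fi).
Qed.

Lemma corr_integrable_oo a b u : sq u ->
  mu.-integrable `]a, b[ (EFin \o (corr u u)).
Proof.
move=> su; apply: (@bounded_integrable _ _ _ _ (ip u u)).
  by apply: measurable_funTS; exact: measurable_corr.
by move=> x _; apply: le_trans (corr_bound x su su) _; lra.
Qed.

Lemma Rintegral_affine_oo (f : R -> R) (a b s t : R) : s != 0 ->
  mu.-integrable `]a, b[ (EFin \o f) ->
  \int[mu]_(x in `]a, b[) f x =
  `|s| * \int[mu]_x (if a < s * x + t < b then f (s * x + t) else 0).
Proof.
move=> s0 fi; rewrite Rintegral_mkcond.
have := fi => /(integrable_mkcond _ (measurable_itvT _)).
rewrite restrict_EFin => h.
rewrite (Rintegral_affine t s0 h); congr (_ * _); apply: eq_Rintegral => x _.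
by rewrite patchE mem_setE in_itv.
Qed.

Lemma Rintegral_mkif (f : R -> R) (a b : R) :
  \int[mu]_(x in `]a, b[) f x = \int[mu]_x (if a < x < b then f x else 0).
Proof.
by rewrite Rintegral_mkcond; apply: eq_Rintegral => x _; rewrite patchE mem_setE in_itv.
Qed.

Lemma Rintegral_reflect (f : R -> R) (a b t : R) :
  mu.-integrable `]a, b[ (EFin \o f) ->
  \int[mu]_(x in `]a, b[) f x = \int[mu]_(x in `]t - b, t - a[) f (t - x).
Proof.
move=> fi; rewrite (@Rintegral_affine_oo _ _ _ (-1) t)// ?oppr_eq0 ?oner_eq0//.
rewrite normrN1 mul1r Rintegral_mkif; apply: eq_Rintegral => x _.
rewrite (_ : -1 * x + t = t - x); last by ring.
by congr (if _ then _ else _); apply/idP/idP => /andP[h1 h2]; apply/andP; split; lra.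
Qed.

Lemma Rintegral_dilate (f : R -> R) (b s : R) : 0 < s ->
  mu.-integrable `]0, s * b[ (EFin \o f) ->
  \int[mu]_(x in `]0, s * b[) f x = s * \int[mu]_(x in `]0, b[) f (s * x).
Proof.
move=> s0 fi; rewrite (@Rintegral_affine_oo _ _ _ s 0)// ?gt_eqF//.
rewrite gtr0_norm// Rintegral_mkif; congr (_ * _); apply: eq_Rintegral => x _.
by rewrite addr0 pmulr_rgt0// ltr_pM2l.
Qed.

(* The reflection [x |-> 2a - x] together with [corr_reflect] shows that the
   energy is at least [ln 2 * ip u u] plus the integral of
   [p(x) (1/x - 1/(2a - x))] over ]0, a[, where [p = ip u u - corr u u].  On
   ]a/2, 3a/4[, [p] is at least [ip u u / 8] and the weight at least 4/(9a). *)
Lemma energy_lower a u : 0 < a -> jump_dom (fun x => (2 * x)^-1) a u ->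
  (ln 2 + 72^-1) * ip u u <= E a u.
Proof.
move=> a0 [lu ui]; have su := lu.1; have c0 := ip_ge0 u.
pose p x := ip u u - corr u u x.
have p0 x : 0 <= p x by have := corr_diff_ge0 x su; rewrite corr_diffE// /p; lra.
have pM x : p x <= 2 * ip u u by have := corr_diff_le x su; rewrite corr_diffE// /p; lra.
have mp (D : set T) : measurable_fun D p.
  by apply: measurable_funTS; apply: measurable_funB => //; exact: measurable_corr.
have pi : mu.-integrable `]0, 2 * a[ (EFin \o (fun x => p x * x^-1)).
  apply: eq_integrable ui; first exact: measurable_itvT.
  move=> x; rewrite inE /= in_itv/= => /andP[x0 _]; congr EFin.
  exact: (energyE lu x0).
have EE : E a u = \int[mu]_(x in `]0, 2 * a[) (p x * x^-1).
  apply: eq_Rintegral => x; rewrite inE/= in_itv/= => /andP[x0 _].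
  exact: (energyE lu x0).
have a2 : a < 2 * a by lra.
rewrite EE (Rintegral_split a0 a2 pi).
have i1 : mu.-integrable `]0, a[ (EFin \o (fun x => p x * x^-1)).
  by apply: integrable_oo pi => //; exact: ltW.
have i2 : mu.-integrable `]a, 2 * a[ (EFin \o (fun x => p x * x^-1)).
  by apply: integrable_oo pi => //; exact: ltW.
have [i3 e3] := RintegralZ_oo (ip u u) (@integrable_inv R a (2 * a) a0).
have i4 : mu.-integrable `]a, 2 * a[ (EFin \o (fun x => p (2 * a - x) * x^-1)).
  have [h _] := RintegralZ_oo (2 * ip u u) (@integrable_inv R a (2 * a) a0).
  apply: le_integrable h; first exact: measurable_itvT.
    apply/measurable_EFinP; apply: measurable_funM.
      apply: measurable_funTS; apply: (measurableT_comp (mp setT)).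
      exact: measurable_funB.
    by have [/measurable_EFinP] := integrableP _ _ _ (@integrable_inv R a (2 * a) a0).
  move=> x; rewrite /= in_itv/= => /andP[x0 _]; rewrite lee_fin !normrM.
  have xp : 0 < x by lra.
  by apply: ler_wpM2r => //; rewrite !ger0_norm ?mulr_ge0.
have s1 : ip u u * ln 2 <= \int[mu]_(x in `]a, 2 * a[) (p x * x^-1) +
    \int[mu]_(x in `]a, 2 * a[) (p (2 * a - x) * x^-1).
  have [i5 <-] := RintegralD_oo i2 i4.
  rewrite (_ : ln 2 = ln (2 * a) - ln a); last by rewrite lnM ?posrE//; ring.
  rewrite -(Rintegral_inv a0 a2) -e3; apply: ler_Rintegral_pw => // x /andP[x0 _].
  rewrite -mulrDl ler_wpM2r ?invr_ge0//; first by lra.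
  by have := corr_reflect x lu; rewrite /p; lra.
rewrite (Rintegral_reflect (2 * a) i4) in s1.
rewrite (_ : 2 * a - 2 * a = 0) in s1; last by ring.
rewrite (_ : 2 * a - a = a) in s1; last by ring.
have es : \int[mu]_(x in `]0, a[) (p (2 * a - (2 * a - x)) * (2 * a - x)^-1) =
    \int[mu]_(x in `]0, a[) (p x * (2 * a - x)^-1).
  by apply: eq_Rintegral => x _; congr (p _ * _); ring.
rewrite {}es in s1.
have i6 : mu.-integrable `]0, a[ (EFin \o (fun x => p x * (2 * a - x)^-1)).
  apply: le_integrable i1; first exact: measurable_itvT.
    apply/measurable_EFinP; apply: measurable_funM => //.
    apply: open_continuous_measurable_fun; first exact: interval_open.
    move=> x; rewrite inE /= in_itv/= => /andP[x0 xa].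
    apply: (@cvgV R R _ _ (fun y : R => 2 * a - y)); first by apply/lt0r_neq0; lra.
    by apply: cvgB; [exact: cvg_cst|exact: cvg_id].
  move=> x; rewrite /= in_itv/= => /andP[x0 xa]; rewrite lee_fin !normrM.
  clear -a0 x0 xa; apply: ler_wpM2l => //; rewrite !ger0_norm ?invr_ge0; try lra.
  by rewrite lef_pV2 ?posrE; lra.
suff : ip u u / 72 + \int[mu]_(x in `]0, a[) (p x * (2 * a - x)^-1) <=
   \int[mu]_(x in `]0, a[) (p x * x^-1) by lra.
have ic := @integrable_cst_itv R 0 a (ip u u / (18 * a)).
(* The height is the product of [ip u u / 8] and 4/(9a); over an interval of length a/4 it
   integrates to [ip u u / 72]. *)
pose g x := if a / 2 < x < 3 / 4 * a then ip u u / (18 * a) else 0.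
have [ig eg] : mu.-integrable `]0, a[ (EFin \o g) /\
    \int[mu]_(x in `]0, a[) g x = ip u u / 72.
  split.
    apply: le_integrable ic; first exact: measurable_itvT.
      apply/measurable_EFinP; apply: measurable_funTS.
      rewrite (_ : g = (fun=> ip u u / (18 * a)) \_ `]a / 2, 3 / 4 * a[).
        by apply/(measurable_restrictT _ (measurable_itvT _)).
      by apply/funext => x; rewrite patchE mem_setE in_itv.
    move=> x _; rewrite /= lee_fin /g; case: ifP => //.
    by rewrite normr0.
  rewrite Rintegral_mkif; transitivity (\int[mu]_(x in `]a / 2, 3 / 4 * a[) (ip u u / (18 * a))).
    rewrite Rintegral_mkif; apply: eq_Rintegral => x _; rewrite /g.
    have [/andP[h1 h2]|//] := boolP (a / 2 < x < 3 / 4 * a); last by rewrite if_same.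
    by rewrite (_ : 0 < x < a)//; clear -a0 h1 h2; lra.
  rewrite Rintegral_cst_itv; last by lra.
  by field; rewrite gt_eqF.
rewrite -eg; have [i7 <-] := RintegralD_oo ig i6.
apply: ler_Rintegral_pw => // x /andP[x0 xa]; rewrite /g.
have xi : (2 * a - x)^-1 <= x^-1 by clear -a0 x0 xa; rewrite lef_pV2 ?posrE; lra.
case: ifPn => [/andP[h1 h2]|_]; last by rewrite add0r ler_wpM2l.
rewrite -lerBrDr -mulrBr.
have q : ip u u / 8 <= p x by apply: (@corr_quarter a) => //; exact: ltW.
apply: (@le_trans _ _ (ip u u / 8 * (x^-1 - (2 * a - x)^-1))); last first.
  by rewrite ler_wpM2r// subr_ge0.
rewrite (_ : ip u u / (18 * a) = ip u u / 8 * (4 / (9 * a))); last by field; rewrite gt_eqF.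
apply: ler_wpM2l; first by rewrite divr_ge0.
clear -a0 x0 xa h1 h2.
rewrite (_ : x^-1 - _ = (2 * a - 2 * x) / (x * (2 * a - x))); last first.
  by field; apply/andP; split; apply/lt0r_neq0; lra.
rewrite ler_pdivrMr ?mulr_gt0// mulrAC ler_pdivlMr; last by rewrite mulr_gt0; lra.
nra.
Qed.

(* Fubini turns [int corr] into [(int u)^2], here over ]0, 2a[ by evenness. *)
Lemma Rintegral_corr_mean0 a u : 0 < a -> L2on a u -> ip u (window a) = 0 ->
  \int[mu]_(x in `]0, 2 * a[) corr u u x = 0.
Proof.
move=> a0 lu m0; have su := lu.1; have c0 := ip_ge0 u.
have mc := measurable_corr su su.
have ui : mu.-integrable setT (EFin \o u).
  apply: eq_integrable (sqM su (sq_window a)) => // x _.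
  by congr EFin; rewrite /= (mul_window _ lu).
have m0' : \int[mu]_x u x = 0.
  by rewrite -m0; apply: eq_Rintegral => x _; rewrite (mul_window _ lu).
pose f (z : T * T) : \bar R := (u z.2 * u (z.2 - z.1))%:E.
have mf : measurable_fun setT f.
  apply/measurable_EFinP; apply: measurable_funM.
    by apply: (measurableT_comp su.1); exact: measurable_snd.
  by apply: (measurableT_comp su.1); apply: measurable_funB;
    [exact: measurable_snd|exact: measurable_fst].
(* For fixed x the inner integral of |f| is the autocorrelation of |u|: at most [ip u u], and zero
   for |x| >= 2a. An indicator function times [ip u u] therefore dominates it. *)
have fi : (mu \x mu)%E.-integrable setT f.
  apply/integrable12ltyP => //.
  have ib : mu.-integrable `]- (2 * a), 2 * a[ (EFin \o (fun=> ip u u)).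
    exact: integrable_cst_itv.
  have /(integrable_mkcond _ (measurable_itvT _)) := ib.
  move=> /integrableP[_]; apply: le_lt_trans.
  apply: ge0_le_integral => //.
  - by move=> x _; exact: integral_ge0.
  - apply: (@measurable_fun_fubini_tonelli_F _ _ T T R mu (abse \o f)) => //.
      exact: measurableT_comp.
    by move=> z; exact: abse_ge0.
  - apply: measurableT_comp => //; apply/(measurable_restrictT _ (measurable_itvT _)).
    exact/measurable_EFinP.
  - move=> x _; rewrite patchE mem_setE in_itv/=.
    have sx := sq_sh x su.
    have -> : (\int[mu]_y `|f (x, y)| = (ip (fun y => `|u y|) (sh x (fun y => `|u y|)))%:E)%E.
      rewrite /ip /Rintegral fineK.
        by apply: eq_integral => y _; rewrite /f/= normrM.
      apply: integrable_fin_num => //.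
      have := integrable_abse (sqM su sx); apply: eq_integrable => // y _.
      by rewrite /= normrM.
    have sa : sq (fun y => `|u y|).
      split; first by apply: measurableT_comp => //; exact: su.1.
      by apply: eq_integrable su.2 => // y _ /=; rewrite real_normK ?num_real.
    have ia : ip (fun y => `|u y|) (fun y => `|u y|) = ip u u.
      by apply: eq_Rintegral => y _; rewrite -expr2 real_normK ?num_real// expr2.
    have la : L2on a (fun y => `|u y|) by split => // y ya; rewrite lu.2// normr0.
    case: ifPn => xa.
      rewrite lee_fin ger0_norm//.
      have := corr_bound x sa sa; rewrite ia /corr => h.
      by apply: (le_trans (ler_norm _)); lra.
    have -> : ip (fun y => `|u y|) (sh x (fun y => `|u y|)) = 0.
      apply: (corr_far la la); rewrite leNgt; apply: contra xa.
      by rewrite ltr_norml => /andP[h1 h2]; rewrite h1 h2.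
    exact: abse_ge0.
(* With y fixed, the substitution of y - x for x turns the inner integral into u(y) times the
   integral of u. *)
have z2 : (\int[mu]_y \int[mu]_x f (x, y) = 0)%E.
  apply: integral0_eq => y _; rewrite /f /=.
  have m1 : - 1 != 0 :> R by rewrite oppr_eq0 oner_eq0.
  have ri := integrable_affine y m1 ui.
  have z : \int[mu]_x (u y * u (-1 * x + y)) = 0.
    rewrite RintegralZl// -[X in _ * X]mul1r -{1}(@normr1 R) -(normrN 1).
    by rewrite -(@Rintegral_affine _ (-1) y u)// ?m0' ?mulr0// oppr_eq0 oner_eq0.
  transitivity (\int[mu]_x (u y * u (-1 * x + y)))%:E; last by rewrite z.
  rewrite /Rintegral fineK.
    by apply: eq_integral => x _; congr ((_ * u _)%:E); ring.
  by apply: integrable_fin_num => //; exact: (integrableZl measurableT (u y) ri).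
have z1 : \int[mu]_x corr u u x = 0.
  rewrite /Rintegral (_ : (\int[mu]_x _ = 0)%E)// -[RHS]z2 -(Fubini fi).
  apply: eq_integral => x _; rewrite /corr /ip /Rintegral fineK//.
  by apply: integrable_fin_num => //; exact: (sqM su (sq_sh x su)).
have far x : 2 * a <= `|x| -> corr u u x = 0 by exact: corr_far.
have e : \int[mu]_x corr u u x = \int[mu]_(x in `]- (2 * a), 2 * a[) corr u u x.
  rewrite Rintegral_mkif; apply: eq_Rintegral => x _; case: ifPn => // xa.
  by apply: far; rewrite leNgt; apply: contra xa; rewrite ltr_norml; lra.
(* The autocorrelation is even, so the two halves of the integral are equal and both vanish. *)
move: z1; rewrite e (@Rintegral_split _ _ 0); try lra; last exact: corr_integrable_oo.
rewrite (Rintegral_reflect 0); last exact: corr_integrable_oo.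
rewrite opprK !subr0 add0r.
rewrite (_ : \int[mu]_(x in `]0, 2 * a[) corr u u (0 - x) =
  \int[mu]_(x in `]0, 2 * a[) corr u u x); first by lra.
by apply: eq_Rintegral => x _; rewrite sub0r corrC.
Qed.

(* Bathtub principle: [p = ip u u - corr u u] lies between 0 and [2 ip u u]
   and has integral [2 a ip u u], so [int p / x] is smallest when [p] is
   concentrated on ]a, 2a[. *)
Lemma energy_mean0 a u : 0 < a -> jump_dom (fun x => (2 * x)^-1) a u -> ip u (window a) = 0 ->
  2 * ln 2 * ip u u <= E a u.
Proof.
move=> a0 [lu ui] m0; have su := lu.1; have c0 := ip_ge0 u.
have ci := Rintegral_corr_mean0 a0 lu m0.
have a2 : a < 2 * a by lra.
pose p x := ip u u - corr u u x.
have p0 x : 0 <= p x by have := corr_diff_ge0 x su; rewrite corr_diffE// /p; lra.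
have pM x : p x <= 2 * ip u u by have := corr_diff_le x su; rewrite corr_diffE// /p; lra.
have i1 : mu.-integrable `]0, 2 * a[ (EFin \o (fun x => - 1 * corr u u x)).
  exact: (RintegralZ_oo _ (corr_integrable_oo _ _ su)).1.
have [i2 e2] := RintegralD_oo (@integrable_cst_itv R 0 (2 * a) (ip u u)) i1.
have [i3 e3] := RintegralZ_oo (a^-1) i2.
(* The bathtub comparison at level 1/a: p/x >= p/a + g, since 1/x >= 1/a and p >= 0 before a, while
   1/x <= 1/a and p <= 2 [ip u u] after a. The term p/a integrates to 2 [ip u u] by the mean-zero
   condition, and g to 2 (ln 2 - 1) [ip u u]. *)
pose g x := if a < x < 2 * a then 2 * ip u u * (x^-1 - a^-1) else 0.
have [i4 e4] : mu.-integrable `]a, 2 * a[ (EFin \o (fun x => 2 * ip u u * (x^-1 + - a^-1))) /\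
   \int[mu]_(x in `]a, 2 * a[) (2 * ip u u * (x^-1 + - a^-1)) =
   2 * ip u u * (ln 2 - 1).
  have [h1 h2] := RintegralD_oo (@integrable_inv R a (2 * a) a0)
                    (@integrable_cst_itv R a (2 * a) (- a^-1)).
  have [h3 ->] := RintegralZ_oo (2 * ip u u) h1; split=> //.
  rewrite h2 Rintegral_inv// Rintegral_cst_itv ?(ltW a2)// lnM ?posrE//.
  by field; rewrite gt_eqF.
have [ig eg] : mu.-integrable `]0, 2 * a[ (EFin \o g) /\
    \int[mu]_(x in `]0, 2 * a[) g x = 2 * ip u u * (ln 2 - 1).
  split.
    have /(integrable_mkcond _ (measurable_itvT _)) h := i4.
    apply: (@integrableS _ T R mu setT) => //.
    apply: eq_integrable h => // x _; rewrite patchE mem_setE in_itv/= /g.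
    by case: ifP.
  rewrite -e4 !Rintegral_mkif; apply: eq_Rintegral => x _; rewrite /g.
  have [/andP[h1 h2]|//] := boolP (a < x < 2 * a); last by rewrite if_same.
  by rewrite (_ : 0 < x < 2 * a)//; clear -a0 h1 h2; lra.
have [i5 e5] := RintegralD_oo i3 ig.
have -> : 2 * ln 2 * ip u u =
    \int[mu]_(x in `]0, 2 * a[) (a^-1 * (ip u u + - 1 * corr u u x) + g x).
  rewrite e5 eg e3 e2 Rintegral_cst_itv; last by rewrite mulr_ge0// ltW.
  have [_ ->] := RintegralZ_oo (-1) (corr_integrable_oo 0 (2 * a) su).
  by rewrite ci; field; rewrite gt_eqF.
apply: ler_Rintegral_pw => // x /andP[x0 xa]; rewrite (energyE lu x0) /g.
rewrite mulN1r -/(p x) [leRHS]mulrC.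
case: ifPn => [/andP[ax _]|h].
  have : x^-1 <= a^-1 by rewrite lef_pV2 ?posrE//; exact: ltW.
  have := pM x; clear -c0.
  by move: (p x) (ip u u) c0 (x^-1) (a^-1) => P I c0 X Y; nra.
have xa' : x <= a by rewrite leNgt; apply: contra h => ax; rewrite ax.
by rewrite addr0 ler_wpM2r// lef_pV2 ?posrE.
Qed.

Lemma L2on_dilate a s u : 0 < s -> L2on (s * a) u -> L2on a (fun x => u (s * x)).
Proof.
move=> s0 [su u0]; split.
  have := @sq_affine _ s 0 u (lt0r_neq0 s0) su.
  by under eq_fun do rewrite addr0.
move=> x; rewrite in_itv/= => xa; apply: u0; apply: contra xa.
by rewrite in_itv/= -mulrN !ltr_pM2l.
Qed.

Lemma ip_dilate s u w : 0 < s -> sq u -> sq w ->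
  ip u w = s * ip (fun x => u (s * x)) (fun x => w (s * x)).
Proof.
move=> s0 su sw; rewrite (@ip_affine _ s 0 u w)// ?gt_eqF// gtr0_norm//.
by congr (_ * _); apply: eq_Rintegral => x _; rewrite addr0.
Qed.

Lemma corr_diff_dilate s u x : 0 < s -> sq u ->
  corr_diff u u (s * x) = s * corr_diff (fun x => u (s * x)) (fun x => u (s * x)) x.
Proof.
move=> s0 su; have su' : sq (fun x => u (s * x)).
  have := @sq_affine _ s 0 u (lt0r_neq0 s0) su.
  by under eq_fun do rewrite addr0.
rewrite !corr_diffE// /corr (ip_dilate s0 su su) (ip_dilate s0 su (sq_sh _ su)).
rewrite (_ : (fun y => sh (s * x) u (s * y)) = sh x (fun y => u (s * y))); first by ring.
by apply/funext => y; rewrite /sh; congr u; ring.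
Qed.

(** The kernel is homogeneous of degree -1 and cancels the scaling of dx; the remaining factor s is
    the one of [ip_dilate], so Rayleigh quotients are preserved. *)
Lemma energy_dilate a s u : 0 < s -> jump_dom (fun x => (2 * x)^-1) (s * a) u ->
  jump_dom (fun x => (2 * x)^-1) a (fun x => u (s * x)) /\
  E (s * a) u = s * E a (fun x => u (s * x)).
Proof.
move=> s0 [lu ui]; have su := lu.1.
pose f x := corr_diff u u x * (2 * x)^-1.
have es : s * (2 * a) = 2 * (s * a) by ring.
have fE x : f (s * x) = corr_diff (fun x => u (s * x)) (fun x => u (s * x)) x * (2 * x)^-1.
  rewrite /f corr_diff_dilate// [s * x]mulrC [2 * (x * s)]mulrA invfM.
  by rewrite [s * _]mulrC -mulrA [s * _]mulrCA divff ?mulr1// gt_eqF.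
have fi : mu.-integrable `]0, s * (2 * a)[ (EFin \o f) by rewrite es.
split; last first.
  rewrite /jump_form -es (Rintegral_dilate s0 fi); congr (_ * _).
  by apply: eq_Rintegral => x _; exact: fE.
split; first exact: L2on_dilate.
have := fi => /(integrable_mkcond _ (measurable_itvT _)).
rewrite restrict_EFin => /(integrable_affine 0 (lt0r_neq0 s0)) h.
apply/(integrable_mkcond _ (measurable_itvT _)).
apply: eq_integrable h => // x _; rewrite restrict_EFin /= addr0 !patchE !mem_setE !in_itv/=.
by rewrite pmulr_rgt0// ltr_pM2l// fE.
Qed.

End forms.

(** * Existence of minimizers *)

Section fatou_bound.
Context {R : realType}.
Local Notation mu := (@lebesgue_measure R).
Local Notation T := (measurableTypeR R).

Lemma half_expn_cvg0 : ((2^-1 : R) ^+ n) @[n --> \oo] --> (0 : R).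
Proof. by apply: cvg_expr; rewrite ger0_norm// invf_lt1// ltr1n. Qed.

Lemma le0_half_expn (x B : R) : (forall n, x <= B * 2^-1 ^+ n) -> x <= 0.
Proof.
move=> h.
have c : (B * (2^-1 : R) ^+ n) @[n --> \oo] --> (B * 0 : R).
  by apply: cvgM; [exact: cvg_cst|exact: half_expn_cvg0].
rewrite mulr0 in c.
by rewrite -(cvg_lim _ c)//; apply: limr_ge; [exact: cvgP c|exact: nearW].
Qed.

(** Fatou's lemma with upper bounds converging geometrically. It serves twice: for completeness of
    the square-integrable functions and for lower semicontinuity of the form. *)
Lemma fatou_bound (D : set R) (f : nat -> R -> R) (g : R -> R) (c B : R) :
  measurable (D : set T) ->
  (forall n, measurable_fun (D : set T) (f n)) ->
  (forall n x, D x -> 0 <= f n x) ->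
  (forall x, D x -> f n x @[n --> \oo] --> g x) ->
  (forall n, (\int[mu]_(x in D) (f n x)%:E <= (c + B * 2^-1 ^+ n)%:E)%E) ->
  (\int[mu]_(x in D) (g x)%:E <= c%:E)%E.
Proof.
move=> mD mf f0 fg fB.
have mf' n : measurable_fun (D : set T) (EFin \o f n) by exact/measurable_EFinP.
have f0' n x : D x -> (0 <= (EFin \o f n) x)%E by move=> Dx; rewrite lee_fin f0.
have := @fatou _ T R mu D mD (fun n => EFin \o f n) mf' f0'.
have <- : (\int[mu]_(x in D) (g x)%:E =
    \int[mu]_(x in D) limn_einf (fun n => (EFin \o f n) x))%E.
  apply: eq_integral => x /set_mem Dx; apply/esym.
  have h : (f n x)%:E @[n --> \oo] --> (g x)%:E by apply: cvg_EFin; [exact: nearW|exact: fg].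
  by have [] := cvg_limn_einf_sup h.
move=> /le_trans; apply.
have cc : ((c + B * 2^-1 ^+ n)%:E) @[n --> \oo] --> c%:E.
  apply: cvg_EFin; first exact: nearW.
  rewrite -[X in _ --> X]addr0 -(mulr0 B).
  by apply: cvgD; [exact: cvg_cst|apply: cvgM; [exact: cvg_cst|exact: half_expn_cvg0]].
rewrite limn_einf_lim -(cvg_lim _ cc)//.
apply: lee_lim; [exact: is_cvg_einfs|exact: cvgP cc|].
apply: nearW => n; apply: le_trans (fB n).
by apply: ereal_inf_lbound; exists n => //=.
Qed.

End fatou_bound.

(** * Completeness along rapidly Cauchy sequences *)

Section completeness.
Context {R : realType}.
Local Notation mu := (@lebesgue_measure R).
Local Notation T := (measurableTypeR R).
Implicit Types (u v w K : R -> R) (a c x : R).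

Lemma ip_lc2 c u w : sq u -> sq w ->
  ip (lc c u w) (lc c u w) = ip u u + 2 * c * ip u w + c ^+ 2 * ip w w.
Proof.
move=> su sw; have s1 := sq_lc c su sw.
rewrite ip_lcl// !ip_lcr// (ipC w u); ring.
Qed.

Lemma dist_step u v w : sq u -> sq v -> sq w ->
  ip (lc (-1) u w) (lc (-1) u w) <=
  2 * ip (lc (-1) u v) (lc (-1) u v) + 2 * ip (lc (-1) v w) (lc (-1) v w).
Proof.
move=> su sv sw; have s1 := sq_lc (-1) su sv; have s2 := sq_lc (-1) sv sw.
have e : lc (-1) u w = lc 1 (lc (-1) u v) (lc (-1) v w).
  by apply/funext => x; rewrite /lc; ring.
have := ip_ge0 (lc (-1) (lc (-1) u v) (lc (-1) v w)).
rewrite e !(ip_lc2 _ s1 s2); lra.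
Qed.

(** Each use of [dist_step] costs a factor 2, which the decay rate 1/4 outweighs: 4 C solves c = 2 C
    + 2 c / 4. *)
Lemma dist_tail (u : nat -> R -> R) (C : R) : (forall n, sq (u n)) -> 0 <= C ->
  (forall n, ip (lc (-1) (u n.+1) (u n)) (lc (-1) (u n.+1) (u n)) <= C * (4^-1) ^+ n) ->
  forall n k, ip (lc (-1) (u (n + k)%N) (u n)) (lc (-1) (u (n + k)%N) (u n)) <= 4 * C * (4^-1) ^+ n.
Proof.
move=> su C0 hd n k; elim: k n => [|k IH] n.
  rewrite addn0 ip_lc2// (_ : _ + _ = 0); last by ring.
  by rewrite !mulr_ge0// exprn_ge0.
rewrite addnS -addSn.
apply: le_trans (dist_step (su _) (su n.+1) (su n)) _.
have := IH n.+1; have := hd n; rewrite exprS; lra.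
Qed.

(** The Riesz-Fischer argument: the sum of the absolute increments is integrable, hence finite
    almost everywhere, and the sequence converges there. Fatou's lemma then bounds the distance from
    the limit to each term. *)
Lemma sq_complete a (u : nat -> R -> R) (C : R) :
  0 < a -> (forall n, L2on a (u n)) -> 0 <= C ->
  (forall n, ip (lc (-1) (u n.+1) (u n)) (lc (-1) (u n.+1) (u n)) <= C * (4^-1) ^+ n) ->
  exists2 v, L2on a v &
    forall n, ip (lc (-1) v (u n)) (lc (-1) v (u n)) <= 4 * C * (4^-1) ^+ n.
Proof.
move=> a0 lu C0 hd.
have su n := (lu n).1.
pose d n := lc (-1) (u n.+1) (u n).
have sd n : sq (d n) by exact: sq_lc.
have ld n : L2on a (d n) by exact: L2on_lc.
pose g n (x : T) : \bar R := `|d n x|%:E.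
have mg n : measurable_fun setT (g n).
  by apply/measurable_EFinP; apply: measurableT_comp => //; exact: (sd n).1.
have g0 n x : (0 <= g n x)%E by rewrite lee_fin.
(* With q = 2^-n, positivity of [ip] at |d n| - q window gives 2 q int |d n| <= C q^2 + 2 a q^2.
   This trades the squared norm 4^-n for the integral 2^-n. *)
have ig n : (\int[mu]_x g n x <= ((C + 2 * a) * 2^-1 ^+ n)%:E)%E.
  have sa : sq (fun y => `|d n y|).
    split; first by apply: measurableT_comp => //; exact: (sd n).1.
    by apply: eq_integrable (sd n).2 => // y _ /=; rewrite real_normK ?num_real.
  have la : L2on a (fun y => `|d n y|) by split => // y ya; rewrite (ld n).2// normr0.
  have ia : ip (fun y => `|d n y|) (fun y => `|d n y|) = ip (d n) (d n).
    by apply: eq_Rintegral => y _; rewrite -expr2 real_normK ?num_real// expr2.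
  have -> : (\int[mu]_x g n x = (ip (fun y => `|d n y|) (window a))%:E)%E.
    rewrite /ip /Rintegral fineK.
      by apply: eq_integral => y _; rewrite /g (mul_window _ la).
    by apply: integrable_fin_num => //; exact: (sqM sa (sq_window a)).
  rewrite lee_fin; have := ip_ge0 (lc (- (2^-1) ^+ n) (fun y => `|d n y|) (window a)).
  rewrite ip_lc2//; last exact: sq_window.
  rewrite ia ip_window// => h; have := hd n; rewrite -/(d n).
  have e4 : (4^-1 : R) ^+ n = (2^-1) ^+ n * (2^-1) ^+ n.
    by rewrite -exprMn; congr (_ ^+ _); field.
  rewrite e4; set q := 2^-1 ^+ n in h *.
  have q0 : 0 < q by rewrite exprn_gt0.
  move=> h2; rewrite -(ler_pM2l q0); set I := ip _ (window a) in h *; nra.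
have sumfin : (\int[mu]_x (\sum_(n <oo) g n x) < +oo)%E.
  rewrite integral_nneseries//.
  apply: (@le_lt_trans _ _ (\sum_(n <oo) ((C + 2 * a) * 2^-1 ^+ n)%:E)%E).
    by apply: lee_nneseries => n *; [exact: integral_ge0|exact: ig].
  rewrite (_ : (\sum_(n <oo) _)%E = (2 * (C + 2 * a) / 2 ^+ 0)%:E) ?ltry//.
  apply/cvg_lim => //; have := @cvg_geometric_eseries_half R (2 * (C + 2 * a)) 0.
  rewrite (_ : (fun k => _) = fun n => ((C + 2 * a) * 2^-1 ^+ n)%:E)//.
  apply/funext => k; congr EFin; rewrite addn1 natrX exprS invfM exprVn.
  by rewrite [2 * _]mulrC -mulrA (mulrA 2) divff// mul1r.
pose S (x : T) := (\sum_(n <oo) g n x)%E.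
have mS : measurable_fun setT S by exact: ge0_emeasurable_sum.
have S0 x : (0 <= S x)%E by apply: nneseries_ge0.
have iS : mu.-integrable setT S.
  apply/integrableP; split => //.
  by under eq_integral do rewrite gee0_abs//.
pose G : set T := [set x | S x \is a fin_num].
have mG : measurable G.
  by have := emeasurable_fin_num measurableT mS; rewrite setTI.
have Gae : {ae mu, forall x, G x}.
  by apply: filterS (integrable_ae measurableT iS) => x /(_ I).
have gE x : G x -> cvgn (fun n => u n x).
  move=> Gx.
  have cn : cvgn [normed series (fun n => d n x)].
    apply: nondecreasing_is_cvgn.
      by apply: nondecreasing_series => n _ _; exact: normr_ge0.
    exists (fine (S x)) => _ [n _ <-].
    rewrite -lee_fin fineK// /series /= -sumEFin.
    exact: (@nneseries_lim_ge R (fun i => g i x) xpredT).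
  have := normed_cvg cn => /cvg_ex[l cl]; apply/cvg_ex; exists (u 0%N x + l).
  have -> : (fun n => u n x) = (fun n => u 0%N x + series (fun n => d n x) n).
    apply/funext => n; rewrite (@eq_sum_telescope _ (fun n => u n x) n); congr (_ + _).
    by apply: eq_bigr => k _; rewrite /telescope /d /lc mulN1r.
  by apply: cvgD => //; exact: cvg_cst.
(* Cut to G, the sequence converges at every point, and only a null set has been changed. *)
pose u' n := u n \_ G.
have su' n : sq (u' n) by exact: sq_cut.
pose v x := limn (fun n => u' n x).
have cv x : u' n x @[n --> \oo] --> v x.
  rewrite /v /u'; have [Gx|nGx] := pselect (G x).
    have e : (fun n => (u n \_ G) x) = fun n => u n x.
      by apply/funext => n; rewrite patchE mem_set.
    by rewrite e; exact: gE.
  have e : (fun n => (u n \_ G) x) = fun=> 0.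
    by apply/funext => n; rewrite patchE memNset.
  by rewrite e; exact: is_cvg_cst.
have mv : measurable_fun [set: T] v.
  by apply: (@measurable_fun_cvg _ T R setT u') => [m|x _]; [exact: (su' m).1|exact: cv].
have bv n : (\int[mu]_x ((v x - u' n x) ^+ 2)%:E <= (4 * C * 4^-1 ^+ n)%:E)%E.
  apply: (@fatou_bound R setT (fun k x => (u' (n + k)%N x - u' n x) ^+ 2) _ _ 0) => //.
  - move=> k; apply: measurable_funX; apply: measurable_funB; exact: (su' _).1.
  - by move=> k x _; exact: sqr_ge0.
  - move=> x _.
    have h : (u' (n + k)%N x - u' n x) @[k --> \oo] --> v x - u' n x.
      apply: cvgB; last exact: cvg_cst.
      by have := cv x; rewrite -(cvg_shiftn n); under eq_fun do rewrite addnC; exact.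
    under eq_fun do rewrite expr2.
    by rewrite expr2; apply: cvgM.
  - move=> k; rewrite mul0r addr0.
    apply: (@le_trans _ _ (ip (lc (-1) (u (n + k)%N) (u n)) (lc (-1) (u (n + k)%N) (u n)))%:E).
      have sl : sq (lc (-1) (u (n + k)%N) (u n)) by exact: sq_lc.
      rewrite /ip /Rintegral fineK; last first.
        by apply: integrable_fin_num => //; exact: (sqM sl sl).
      apply: ge0_le_integral => //.
      + by move=> x _; rewrite lee_fin sqr_ge0.
      + apply/measurable_EFinP; apply: measurable_funX; apply: measurable_funB; exact: (su' _).1.
      + by apply/measurable_EFinP; apply: measurable_funM; exact: sl.1.
      + move=> x _; rewrite lee_fin /u' /lc !patchE; case: ifP => _; last first.
          by rewrite subr0 expr0n -expr2 sqr_ge0.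
        by rewrite mulN1r expr2.
    by rewrite lee_fin; exact: dist_tail.
have sv0 n : sq (lc (-1) v (u' n)).
  split; first by apply: measurable_funD => //; apply: measurable_funM => //; exact: (su' n).1.
  apply/integrableP; split.
    apply/measurable_EFinP; apply: measurable_funX; apply: measurable_funD => //.
    by apply: measurable_funM => //; exact: (su' n).1.
  apply: le_lt_trans (ltry (4 * C * 4^-1 ^+ n)); apply: le_trans (bv n).
  rewrite le_eqVlt; apply/orP; left; apply/eqP; apply: eq_integral => x _ /=.
  by rewrite ger0_norm ?sqr_ge0// /lc mulN1r.
have sv : sq v.
  have := sq_lc 1 (sv0 0%N) (su' 0%N).
  rewrite (_ : lc 1 _ _ = v)//; apply/funext => x; rewrite /lc; ring.
have v0 x : x \notin `]- a, a[ -> v x = 0.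
  move=> xa; rewrite /v (_ : (fun n => _) = fun=> 0); first exact: lim_cst.
  by apply/funext => n; rewrite /u' patchE (lu n).2// if_same.
exists v => [//|n].
have <- : ip (lc (-1) v (u' n)) (lc (-1) v (u' n)) = ip (lc (-1) v (u n)) (lc (-1) v (u n)).
  rewrite /ip /Rintegral; congr fine.
  have su1 := sq_lc (-1) sv (su n).
  apply: ae_eq_integral => //.
  - by have /integrableP[] := sqM (sv0 n) (sv0 n).
  - by have /integrableP[] := sqM su1 su1.
  - apply: filterS Gae => x Gx _ /=.
    by rewrite /lc /u' patchE mem_set.
rewrite -lee_fin; apply: le_trans (bv n).
rewrite /ip /Rintegral fineK; last first.
  by apply: integrable_fin_num => //; exact: (sqM (sv0 n) (sv0 n)).
rewrite le_eqVlt; apply/orP; left; apply/eqP; apply: eq_integral => x _ /=.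
by rewrite /lc mulN1r expr2.
Qed.

End completeness.

(** * A spectral gap on mean-zero functions yields a minimizer *)

Section minimizer.
Context {R : realType}.
Local Notation mu := (@lebesgue_measure R).
Local Notation T := (measurableTypeR R).
Implicit Types (u v w : R -> R) (c x : R).
Variables (K : R -> R) (a m delta : R).
Hypothesis a0 : 0 < a.
Hypothesis mK : measurable_fun (`]0, 2 * a[ : set T) K.
Hypothesis K0 : forall x, 0 < x < 2 * a -> 0 <= K x.
Hypothesis K1 : forall x, 0 < x < 2 * a -> K x <= x^-1.
Hypothesis m_le : forall u, jump_dom K a u -> m * ip u u <= jump_form K a u u.
Hypothesis m_inf : forall e, 0 < e ->
  exists u, [/\ jump_dom K a u, ip u u = 1 & jump_form K a u u <= m + e].
Hypothesis delta0 : 0 < delta.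
Hypothesis gap : forall u, jump_dom K a u -> ip u (window a) = 0 ->
  (m + delta) * ip u u <= jump_form K a u u.

(** Shifted by its infimum [m], the form is positive semi-definite, and near-minimizers are the
    functions where it is small. *)
Let J u w := jump_form K a u w - m * ip u w.

Let sqd u : jump_dom K a u -> sq u.
Proof. by case=> -[]. Qed.

Let J_lc2 c u w : jump_dom K a u -> jump_dom K a w ->
  J (lc c u w) (lc c u w) = J u u + 2 * c * J u w + c ^+ 2 * J w w.
Proof.
move=> du dw; have su := sqd du; have sw := sqd dw.
have dl := jump_dom_lc mK K0 c du dw.
rewrite /J ip_lc2// (jump_form_lcl mK K0)// (jump_formC du dl) (jump_formC dw dl)
  !(jump_form_lcl mK K0)// (jump_formC dw du).
move: (jump_form K a u u) (jump_form K a u w) (jump_form K a w w) (ip u u) (ip u w) (ip w w) =>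
  *; ring.
Qed.

Let J_ge0 u : jump_dom K a u -> 0 <= J u u.
Proof. by move=> du; rewrite subr_ge0 m_le. Qed.

(** The parallelogram law for [J], without the nonnegative term at u - c w. *)
Let J_dist c u w : jump_dom K a u -> jump_dom K a w ->
  J (lc c u w) (lc c u w) <= 2 * J u u + 2 * c ^+ 2 * J w w.
Proof.
move=> du dw; have := J_ge0 (jump_dom_lc mK K0 (- c) du dw).
by rewrite !J_lc2//; lra.
Qed.

(** A null vector of a positive semi-definite form is orthogonal to everything for that form. *)
Lemma euler_lagrange v w : jump_dom K a v -> jump_dom K a w ->
  jump_form K a v v = m * ip v v -> jump_form K a v w = m * ip v w.
Proof.
move=> dv dw Ev; apply/eqP; rewrite -subr_eq0 -/(J v w); apply/eqP.
have Jv : J v v = 0 by rewrite /J Ev subrr.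
have W := J_ge0 dw.
have W1 : 0 < J w w + 1 by lra.
(* The +1 keeps the denominator positive even if [J w w = 0]; the value of the form is still a
   negative multiple of the square of [J v w]. *)
have := J_ge0 (jump_dom_lc mK K0 (- (J v w / (J w w + 1))) dv dw).
rewrite J_lc2// Jv add0r (_ : _ + _ = - (J v w ^+ 2 * ((J w w + 2) / (J w w + 1) ^+ 2)));
  last first.
  by field; rewrite gt_eqF.
rewrite oppr_ge0 pmulr_lle0; last by rewrite divr_gt0 ?exprn_gt0//; lra.
by move=> h; apply/eqP; rewrite -sqrf_eq0; apply/eqP/le_anti; rewrite h sqr_ge0.
Qed.

Let dw1 : jump_dom K a (window a).
Proof. by apply: jump_dom_window => // x xa; rewrite K0// K1. Qed.

Let scale c u : jump_dom K a u -> exists w, [/\ jump_dom K a w,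
  ip w (window a) = c * ip u (window a), ip w w = c ^+ 2 * ip u u & J w w = c ^+ 2 * J u u].
Proof.
move=> du; exists (lc (c - 1) u u); split.
- exact: jump_dom_lc.
- by rewrite ip_lcl//; [ring|exact: sqd|exact: sqd|exact: sq_window].
- by rewrite ip_lc2//; [ring|exact: sqd|exact: sqd].
- by rewrite J_lc2//; ring.
Qed.

Opaque ip jump_form corr_diff corr.

(** Near-minimizers of norm 1 cannot have small mean: subtracting a multiple of the normalized
    window would give a function of mean zero, norm close to 1 and energy below the gap. Dividing by
    the mean therefore keeps [J] small. *)
Lemma minimizing_normalized e : 0 < e ->
  exists u, [/\ jump_dom K a u, ip u (window a) = 1 & J u u <= e].
Proof.
move=> e0.
have [phi [dphi phi1 _ _]] := scale (2 * a)^-1 dw1.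
rewrite ip_window// mulVf in phi1; last by rewrite gt_eqF// mulr_gt0.
have sphi := sqd dphi.
(* Chosen so that the mean c of a near-minimizer satisfies c^2 P >= 1/2. *)
pose P := 4 * J phi phi / delta + 2 * ip phi phi.
have P0 : 0 <= P.
  by rewrite addr_ge0// ?divr_ge0 ?mulr_ge0 ?J_ge0 ?ip_ge0// ltW.
(* The first bound yields the lower bound on c; the second absorbs the division by c^2, whose
   inverse is at most 2 P. *)
pose eta := Num.min (delta / 8) (e / (2 * P + 1)).
have eta0 : 0 < eta by rewrite lt_min !divr_gt0//; lra.
have [w [dw w1 hw]] := m_inf eta0.
have sw := sqd dw.
have Jw : J w w <= eta by rewrite /J w1; lra.
have Jw0 := J_ge0 dw.
pose c := ip w (window a).
have dz := jump_dom_lc mK K0 (- c) dw dphi.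
have sz := sqd dz.
have z0 : ip (lc (- c) w phi) (window a) = 0.
  by rewrite ip_lcl// ?phi1 -/c; [ring|exact: sq_window].
have gz := gap dz z0.
have Jz : delta * ip (lc (- c) w phi) (lc (- c) w phi) <= 2 * eta + 2 * c ^+ 2 * J phi phi.
  have := J_dist (- c) dw dphi; rewrite sqrrN.
  have : delta * ip (lc (- c) w phi) (lc (- c) w phi) <= J (lc (- c) w phi) (lc (- c) w phi).
    by rewrite /J lerBrDl -mulrDl.
  by move=> h h'; apply: (le_trans h); apply: (le_trans h'); rewrite lerD2r ler_pM2l.
have h1 : 1 <= 2 * ip (lc (- c) w phi) (lc (- c) w phi) + 2 * c ^+ 2 * ip phi phi.
  have := ip_ge0 (lc (- (2 * c)) w phi).
  by rewrite !ip_lc2// w1; move: (ip w phi) (ip phi phi) (c) => A B C; lra.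
have e8 : eta <= delta / 8 by rewrite ge_min lexx.
have eP : eta <= e / (2 * P + 1) by rewrite ge_min lexx orbT.
have h2 : 1 / 2 <= c ^+ 2 * P.
  have : delta * 1 <= delta * (2 * ip (lc (- c) w phi) (lc (- c) w phi) + 2 * c ^+ 2 * ip phi phi).
    by rewrite ler_pM2l.
  move=> h; rewrite -(ler_pM2l delta0) (_ : delta * (c ^+ 2 * P) =
     4 * c ^+ 2 * J phi phi + 2 * c ^+ 2 * (delta * ip phi phi)); last first.
    by rewrite /P; move: (J phi phi) (ip phi phi) => *; field; rewrite gt_eqF.
  move: h Jz e8; move: (J phi phi) (ip phi phi) (ip (lc _ _ _) _) (c ^+ 2) => A B D C h Jz e8.
  lra.
have c0 : c != 0 by apply: contraTneq h2 => ->; rewrite expr0n mul0r -ltNge divr_gt0.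
have [u [du u1 _ Ju]] := scale c^-1 dw.
exists u; split=> //; first by rewrite u1 mulVf.
rewrite Ju exprVn mulrC ler_pdivrMr ?exprn_even_gt0//.
apply: (le_trans Jw); apply: (le_trans eP).
rewrite ler_pdivrMr; last by rewrite ltr_wpDl// mulr_ge0.
rewrite -mulrA ler_peMr ?ltW//.
have c2 : 0 < c ^+ 2 by rewrite exprn_even_gt0.
by move: h2 c2; move: (c ^+ 2) (P) => C Q h2 C0; lra.
Qed.

(* A positive semi-definite form is close at [v] and [v - d] when it is small
   at [d]: apply positivity to [e v - d] and [e v + d]. *)
Let psd_close (e A B D A' : R) : 0 < e -> 0 <= D -> D <= A' * e ^+ 2 ->
  0 <= e ^+ 2 * A + 2 * e * B + D -> 0 <= e ^+ 2 * A - 2 * e * B + D ->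
  `|- (2 * B) + D| <= e * (A + A' + A' * e).
Proof.
move=> e0 D0 De h1 h2.
have k1 : 0 <= e * A + 2 * B + A' * e by rewrite -(pmulr_rge0 _ e0); lra.
have k2 : 0 <= e * A - 2 * B + A' * e by rewrite -(pmulr_rge0 _ e0); lra.
by rewrite ler_norml; apply/andP; split; lra.
Qed.

(** Write u as v - d and apply [psd_close] to [corr_diff] at fixed x, with constant 4 from
    [corr_diff_le], and to [ip], with constant 1. *)
Lemma form_close u v (e : R) x : sq u -> sq v -> 0 < e ->
  ip (lc (-1) v u) (lc (-1) v u) <= e ^+ 2 ->
  `|corr_diff u u x - corr_diff v v x| <= e * (4 * ip v v + 4 + 4 * e) /\
  `|ip u u - ip v v| <= e * (ip v v + 1 + e).
Proof.
move=> su sv e0; set d := lc (-1) v u => he.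
have sd : sq d by exact: sq_lc.
have ud : u = lc (-1) v d by apply/funext => y; rewrite /d /lc; ring.
have de := corr_diff_le x sd; have dd := corr_diff_ge0 x sd; have dv := corr_diff_le x sv.
have i0 := ip_ge0 v; have id0 := ip_ge0 d.
split.
  have p1 := corr_diff_ge0 x (sq_lc e sd sv); rewrite corr_diff_lc2// (corr_diffC x sd sv) in p1.
  have p2 := corr_diff_ge0 x (sq_lc (- e) sd sv);
    rewrite corr_diff_lc2// (corr_diffC x sd sv) in p2.
  rewrite ud corr_diff_lc2// (_ : _ - _ = - (2 * corr_diff v d x) + corr_diff d d x); last by ring.
  apply: le_trans (@psd_close e (corr_diff v v x) _ _ 4 e0 dd _ _ _) _; try lra.
  by rewrite ler_pM2l//; lra.
have p1 := ip_ge0 (lc e d v); rewrite ip_lc2// (ipC d v) in p1.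
have p2 := ip_ge0 (lc (- e) d v); rewrite ip_lc2// (ipC d v) in p2.
have -> : ip u u = ip v v + 2 * (- 1) * ip v d + (- 1) ^+ 2 * ip d d.
  by rewrite -ip_lc2// -ud.
rewrite (_ : _ - _ = - (2 * ip v d) + ip d d); last by ring.
rewrite -[X in e * (_ + _ + X)]mul1r; apply: psd_close => //; lra.
Qed.

Transparent ip jump_form corr_diff corr.

Lemma minimizer : exists v,
  [/\ jump_dom K a v, ip v (window a) = 1 & jump_form K a v v = m * ip v v].
Proof.
have sw := sq_window a.
have he n : 0 < delta * (4^-1 : R) ^+ n by rewrite mulr_gt0// exprn_gt0.
have [u hu] := choice (fun n => minimizing_normalized (he n)).
have du n : jump_dom K a (u n) by have [] := hu n.
have u1 n : ip (u n) (window a) = 1 by have [] := hu n.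
have Ju n : J (u n) (u n) <= delta * 4^-1 ^+ n by have [] := hu n.
have su n := sqd (du n).
(* Both terms have mean 1, so the gap applies to their difference. By [J_dist] its squared norm is
   at most (2 + 2/4) 4^-n. *)
have hd n : ip (lc (-1) (u n.+1) (u n)) (lc (-1) (u n.+1) (u n)) <= 4 * 4^-1 ^+ n.
  have dd := jump_dom_lc mK K0 (-1) (du n.+1) (du n).
  have z : ip (lc (-1) (u n.+1) (u n)) (window a) = 0.
    by rewrite ip_lcl// !u1 mulr1 subrr.
  have := gap dd z; have := J_dist (-1) (du n.+1) (du n).
  have h0 := Ju n; have h1 := Ju n.+1; rewrite exprS in h1.
  have q0 := he n; have hg := gap dd z; have hJ := J_dist (-1) (du n.+1) (du n).
  have h2 : delta * ip (lc (-1) (u n.+1) (u n)) (lc (-1) (u n.+1) (u n)) <=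
      J (lc (-1) (u n.+1) (u n)) (lc (-1) (u n.+1) (u n)).
    by move: hg; rewrite /J mulrDl lerBrDl.
  suff h3 : delta * ip (lc (-1) (u n.+1) (u n)) (lc (-1) (u n.+1) (u n)) <= delta * (4 * 4^-1 ^+ n).
    by rewrite ler_pM2l in h3.
  apply: (le_trans h2); apply: (le_trans hJ); rewrite sqrrN expr1n.
  by move: (J _ _) (J _ _) (4^-1 ^+ n) h0 h1 q0 => j1 j2 q *; lra.
have [v lv hv] := sq_complete a0 (fun n => (du n).1) (ler0n _ 4) hd.
have sv := lv.1.
have q4 n : (4^-1 : R) ^+ n = (2^-1 ^+ n) ^+ 2.
  by rewrite -exprM mulnC exprM; congr (_ ^+ _); field.
have q0 n : 0 < (2^-1 : R) ^+ n by rewrite exprn_gt0.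
have q1 n : (2^-1 : R) ^+ n <= 1 by rewrite exprn_ile1// invf_le1// ler1n.
have hv' n : ip (lc (-1) v (u n)) (lc (-1) v (u n)) <= (4 * 2^-1 ^+ n) ^+ 2.
  by have := hv n; rewrite q4 exprMn; lra.
have e0 n : 0 < 4 * (2^-1 : R) ^+ n by rewrite mulr_gt0.
have fc n x := form_close x (su n) sv (e0 n) (hv' n).
have v0 := ip_ge0 v.
have fdB n x : `|corr_diff (u n) (u n) x - corr_diff v v x| <= 16 * (ip v v + 5) * 2^-1 ^+ n.
  have [h _] := fc n x; apply: (le_trans h); have := q0 n; have := q1 n.
  set q := 2^-1 ^+ n; nra.
have fiB n : `|ip (u n) (u n) - ip v v| <= 4 * (ip v v + 5) * 2^-1 ^+ n.
  have [_ h] := fc n 0; apply: (le_trans h); have := q0 n; have := q1 n.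
  set q := 2^-1 ^+ n; nra.
have cdf x : corr_diff (u n) (u n) x @[n --> \oo] --> corr_diff v v x.
  pose B := 16 * (ip v v + 5).
  have cB : B * (2^-1 : R) ^+ n @[n --> \oo] --> (0 : R).
    rewrite -(mulr0 B); apply: cvgM; [exact: cvg_cst|exact: half_expn_cvg0].
  apply: (@squeeze_cvgr _ _ _ _ (fun n => corr_diff v v x - B * 2^-1 ^+ n)
                                (fun n => corr_diff v v x + B * 2^-1 ^+ n)).
  - by apply: nearW => n; have := fdB n x; rewrite ler_norml -/B => /andP[h1 h2];
       apply/andP; split; lra.
  - by rewrite -[X in _ --> X]subr0; apply: cvgB => //; exact: cvg_cst.
  - by rewrite -[X in _ --> X]addr0; apply: cvgD => //; exact: cvg_cst.
have mfd w : sq w -> measurable_fun (`]0, 2 * a[ : set T) (fun x => corr_diff w w x * K x).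
  by move=> s; apply: measurable_funM => //; apply: measurable_funTS; exact: measurable_corr_diff.
have fv0 w x : sq w -> `]0, 2 * a[%classic x -> 0 <= corr_diff w w x * K x.
  by move=> s; rewrite /= in_itv/= => xa; rewrite mulr_ge0 ?corr_diff_ge0// K0.
(* This single inequality gives both finite energy of the limit and its minimality. *)
have F : (\int[mu]_(x in `]0%R, (2 * a)%R[) (corr_diff v v x * K x)%R%:E <= (m * ip v v)%R%:E)%E.
  apply: (@fatou_bound R `]0, 2 * a[ (fun n x => corr_diff (u n) (u n) x * K x) _ _
            (delta + `|m| * (4 * (ip v v + 5)))).
  - exact: measurable_itvT.
  - by move=> n; exact: mfd.
  - by move=> n x; exact: fv0.
  - by move=> x _; apply: cvgM; [exact: cdf|exact: cvg_cst].
  - move=> n.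
    have -> : (\int[mu]_(x in `]0%R, (2 * a)%R[) (corr_diff (u n) (u n) x * K x)%R%:E =
       (jump_form K a (u n) (u n))%:E)%E.
      rewrite /jump_form /Rintegral fineK//; apply: integrable_fin_num; last exact: (du n).2.
      exact: measurable_itvT.
    rewrite lee_fin.
    have : m * (ip (u n) (u n) - ip v v) <= `|m| * (4 * (ip v v + 5) * 2^-1 ^+ n).
      by apply: le_trans (ler_norm _) _; rewrite normrM ler_wpM2l.
    have := Ju n; rewrite /J q4.
    have : delta * (2^-1 ^+ n) ^+ 2 <= delta * 2^-1 ^+ n.
      by rewrite ler_pM2l// expr2 ler_piMr// ltW.
    lra.
have dv : jump_dom K a v.
  split=> //; apply/integrableP; split; first by apply/measurable_EFinP; exact: mfd.
  apply: le_lt_trans (ltry (m * ip v v)); apply: le_trans F.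
  rewrite le_eqVlt; apply/orP; left; apply/eqP; apply: eq_integral => x /set_mem xa /=.
  by rewrite ger0_norm// fv0.
exists v; split=> //.
  (* The mean passes to the limit by Cauchy-Schwarz against the window: with q = 2^-n its squared
     deviation from 1 is at most 16 q^2 * 2 a. *)
  apply/eqP; rewrite -subr_eq0 -sqrf_eq0; apply/eqP/le_anti; rewrite sqr_ge0 andbT.
  apply: (@le0_half_expn R _ (32 * a)) => n.
  have sd : sq (lc (-1) v (u n)) by exact: sq_lc.
  have := ip_CS sd sw; rewrite ip_lcl// u1 mulr1 ip_window// => h.
  apply: (le_trans h); have := hv' n; have := q0 n; have := q1 n.
  have := ip_ge0 (lc (-1) v (u n)); set q := 2^-1 ^+ n; set I := ip (lc _ _ _) _.
  move=> I0 qq1 qq0 hI.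
  apply: (@le_trans _ _ (16 * q * (2 * a))); last by lra.
  rewrite ler_pM2r ?mulr_gt0//; apply: (le_trans hI); rewrite expr2; nra.
apply/le_anti; rewrite m_le// andbT.
rewrite -lee_fin; apply: le_trans F; rewrite /jump_form /Rintegral fineK//.
by apply: integrable_fin_num; [exact: measurable_itvT|exact: dv.2].
Qed.

End minimizer.

(** * The Weil functional on functions of small support *)

Section weil_form.
Context {R : realType}.
Local Notation mu := (@lebesgue_measure R).
Local Notation T := (measurableTypeR R).
Implicit Types (a x : R) (g : R -> R).

Definition weil_kernel x : R := expR (x / 2) / (expR x - expR (- x)).
Definition cosh2 x : R := expR (x / 2) + expR (- x / 2).
(** The total weight of [second_diff g] on ]0, 2a[: [weil_kernel] from the last integral of W, and
    [- cosh2] from the first, where g(x) + g(-x) is written as 2 g(0) minus the second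
    difference. *)
Definition local_kernel x : R := weil_kernel x - cosh2 x.
(** The weight left on g(0) when 2 exp(-x/2) g(0) is replaced by 2 g(0) in the last integral; it is
    bounded near 0. *)
Definition rem_kernel x : R := 2 * (1 - expR (- x / 2)) * weil_kernel x.
Definition csch x : R := 2 / (expR x - expR (- x)).

Lemma sinh_gt0 x : 0 < x -> 0 < expR x - expR (- x).
Proof. by move=> x0; rewrite subr_gt0 ltr_expR; lra. Qed.

(** The upper bound is exp(-2x) >= 1 - 2x multiplied by exp x. For the lower one, the difference of
    the two sides has derivative exp y + exp(-y) - 2, nonnegative since the exponentials have
    product 1. *)
Lemma sinh_bounds x : 0 <= x -> 2 * x <= expR x - expR (- x) <= 2 * x * expR x.
Proof.
move=> x0; apply/andP; split; last first.
  have h := expR_ge1Dx (- (2 * x)).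
  have := ler_wpM2l (expR_ge0 x) h.
  rewrite -expRD (_ : x + - (2 * x) = - x); last by ring.
  by move: (expR x) (expR (- x)) => A B; lra.
pose f y : R := expR y - expR (- y) - 2 * y.
have corr_diff (y : R) : is_derive y 1 f (expR y + expR (- y) - 2).
  by rewrite /f; apply: is_derive_eq; rewrite /GRing.scale/=; ring.
have dfp (y : R) : 0 <= expR y + expR (- y) - 2.
  have := expRxMexpNx_1 y; have := expR_gt0 y; have := expR_gt0 (- y).
  move: (expR y) (expR (- y)) => A B B0 A0 AB.
  have : 0 <= (A - B) ^+ 2 by exact: sqr_ge0.
  have : (A + B) ^+ 2 = (A - B) ^+ 2 + 4 * (A * B) by ring.
  rewrite AB; nra.
have : f 0 <= f x.
  apply: (@ger0_derive1_le_cc _ f 0 x) => //.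
  - by move=> y _; rewrite derive1E; have [_ ->] := corr_diff y; exact: dfp.
  - apply: continuous_subspaceT => y; apply: differentiable_continuous.
    by apply/derivable1_diffP; apply: ex_derive.
  - by rewrite in_itv/= lexx.
  - by rewrite in_itv/= lexx andbT.
by rewrite /f oppr0 expR0 subrr mulr0 subr0; move: (expR x) (expR (- x)) => A B; lra.
Qed.

Lemma expR_half_bounds x : 0 <= x -> x <= 1 / 2 ->
  1 <= expR (x / 2) <= 1 + x /\ 1 - x / 2 <= expR (- x / 2) <= 1.
Proof.
move=> x0 x1.
have h1 := expR_ge1Dx (x / 2); have h2 := expR_ge1Dx (- x / 2).
have h3 : expR (- x / 2) <= 1 by rewrite expR_le1; lra.
have := expRxMexpNx_1 (x / 2); rewrite -mulNr.
move: (expR (x / 2)) (expR (- x / 2)) h1 h2 h3 => A B h1 h2 h3 AB.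
by split; apply/andP; split; nra.
Qed.

(** By [sinh_bounds] the kernel lies between exp(-x/2) / (2x) and exp(x/2) / (2x); the numerators
    are at least 1 - x/2 and at most 1 + x. *)
Lemma weil_kernel_bounds x : 0 < x -> x <= 1 / 2 ->
  (2 * x)^-1 - 1 / 4 <= weil_kernel x <= (2 * x)^-1 + 1 / 2.
Proof.
move=> x0 x1; have [/andP[a1 a2] /andP[b1 b2]] := expR_half_bounds (ltW x0) x1.
have /andP[s1 s2] := sinh_bounds (ltW x0); have s0 := sinh_gt0 x0.
have x20 : 0 < 2 * x by rewrite mulr_gt0.
apply/andP; split.
  rewrite /weil_kernel ler_pdivlMr//.
  have e : expR x = expR (x / 2) * expR (x / 2) by rewrite -expRD; congr expR; field.
  have AB : expR (x / 2) * expR (- x / 2) = 1 by rewrite mulNr expRxMexpNx_1.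
  rewrite (_ : (2 * x)^-1 - 1 / 4 = (2 - x) / (4 * x)); last by field; rewrite gt_eqF.
  rewrite mulrAC ler_pdivrMr ?mulr_gt0//.
  apply: (@le_trans _ _ ((2 - x) * (2 * x * expR x))); first by rewrite ler_wpM2l//; lra.
  rewrite e; move: (expR (x / 2)) (expR (- x / 2)) AB b1 a1 => A B AB b1 a1.
  have h : (2 - x) * A <= 2.
    have : (2 * B) * A = 2 by rewrite -mulrA [B * A]mulrC AB mulr1.
    nra.
  have xA : 0 <= 2 * x * A by rewrite mulr_ge0 ?ltW//; lra.
  have := ler_wpM2l xA h; lra.
apply: (@le_trans _ _ ((1 + x) / (2 * x))).
  rewrite /weil_kernel; apply: ler_pM => //; rewrite ?expR_ge0 ?invr_ge0 ?(ltW s0)//.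
  by rewrite lef_pV2 ?posrE.
by rewrite le_eqVlt; apply/orP; left; apply/eqP; field; rewrite gt_eqF.
Qed.

Lemma cosh2_bounds x : 0 < x -> x <= 1 / 2 -> 0 <= cosh2 x <= 3.
Proof.
move=> x0 x1; have [/andP[a1 a2] /andP[b1 b2]] := expR_half_bounds (ltW x0) x1.
rewrite /cosh2; move: (expR (x / 2)) (expR (- x / 2)) a1 a2 b1 b2 => A B *.
by apply/andP; split; lra.
Qed.

Lemma local_kernel_bounds x : 0 < x -> x <= 1 / 2 -> `|local_kernel x - (2 * x)^-1| <= 4.
Proof.
move=> x0 x1; have := weil_kernel_bounds x0 x1; have := cosh2_bounds x0 x1.
rewrite /local_kernel; move: (weil_kernel x) (cosh2 x) ((2 * x)^-1) => A B C /andP[h1 h2]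
  /andP[h3 h4].
by rewrite ler_norml; apply/andP; split; lra.
Qed.

Lemma rem_kernel_bounds x : 0 < x -> x <= 1 / 2 -> 0 <= rem_kernel x <= 1.
Proof.
move=> x0 x1; have [/andP[a1 a2] /andP[b1 b2]] := expR_half_bounds (ltW x0) x1.
have /andP[k1 k2] := weil_kernel_bounds x0 x1.
have k0 : 0 <= weil_kernel x by rewrite /weil_kernel divr_ge0 ?expR_ge0// ltW// sinh_gt0.
rewrite /rem_kernel mulr_ge0//=; last by rewrite mulr_ge0// subr_ge0.
apply: (@le_trans _ _ (x * ((2 * x)^-1 + 1 / 2))).
  apply: ler_pM => //; first by rewrite mulr_ge0// subr_ge0.
  by move: (expR (- x / 2)) b1 => B b1; lra.
rewrite mulrDr invfM mulrCA divff ?gt_eqF//; lra.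
Qed.

Lemma continuous_sinh : continuous (fun x : R => expR x - expR (- x)).
Proof.
move=> x; apply: cvgB; first exact: continuous_expR.
apply: (@continuous_comp _ _ _ -%R expR); first exact: opp_continuous.
exact: continuous_expR.
Qed.

Lemma continuous_expR_scale c : continuous (fun x : R => expR (x * c)).
Proof.
move=> x; apply: (@continuous_comp _ _ _ (fun x => x * c) expR).
  exact: mulrr_continuous.
exact: continuous_expR.
Qed.

Lemma continuous_expRN_half : continuous (fun x : R => expR (- x / 2)).
Proof.
move=> x; have := @continuous_expR_scale (- 2^-1) x.
by rewrite (_ : (fun x => _) = fun x => expR (- x / 2))//; apply/funext => y; congr expR; ring.
Qed.

Lemma measurable_cosh2 (D : set R) : measurable_fun (D : set T) cosh2.
Proof.
apply: measurable_funTS; apply: measurable_funD; apply: continuous_measurable_fun.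
  exact: continuous_expR_scale.
exact: continuous_expRN_half.
Qed.

Lemma measurable_sinhV b : measurable_fun (`]0, b[ : set T) (fun x : R => (expR x - expR (- x))^-1).
Proof.
apply: open_continuous_measurable_fun; first exact: interval_open.
move=> x; rewrite inE /= in_itv/= => /andP[x0 _].
apply: (@cvgV R R _ _ (fun y : R => expR y - expR (- y))); last exact: continuous_sinh.
by rewrite gt_eqF// sinh_gt0.
Qed.

Lemma measurable_weil_kernel b : measurable_fun (`]0, b[ : set T) weil_kernel.
Proof.
apply: measurable_funM; last exact: measurable_sinhV.
apply: measurable_funTS; apply: continuous_measurable_fun; exact: continuous_expR_scale.
Qed.

Lemma measurable_local_kernel b : measurable_fun (`]0, b[ : set T) local_kernel.
Proof. by apply: measurable_funB; [exact: measurable_weil_kernel|exact: measurable_cosh2]. Qed.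

Lemma measurable_rem_kernel b : measurable_fun (`]0, b[ : set T) rem_kernel.
Proof.
apply: measurable_funM; last exact: measurable_weil_kernel.
apply: measurable_funTS; apply: measurable_funM => //; apply: measurable_funB => //.
apply: continuous_measurable_fun; exact: continuous_expRN_half.
Qed.

(** This is ln (coth a), the source of the term log(1/a). *)
Definition csch_tail a : R := ln (expR (2 * a) + 1) - ln (expR (2 * a) - 1).

Lemma expRB1_gt0 x : 0 < x -> 0 < expR x - 1.
Proof. by move=> x0; rewrite subr_gt0 expR_gt1. Qed.

(** This is ln (tanh (x/2)), the antiderivative of [csch] that vanishes at infinity. *)
Let lth x : R := ln (expR x - 1) - ln (expR x + 1).

Lemma is_derive_lth x : 0 < x -> is_derive x 1 lth (csch x).
Proof.
move=> x0; have e1 := expRB1_gt0 x0.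
have e2 : 0 < expR x + 1 by rewrite addr_gt0 ?expR_gt0.
have d1 : is_derive x 1 (fun x => expR x - 1) (expR x).
  by apply: is_derive_eq; rewrite subr0.
have d2 : is_derive x 1 (fun x => expR x + 1) (expR x).
  by apply: is_derive_eq; rewrite addr0.
have c1 := @is_derive1_comp R (@ln R) (fun x => expR x - 1) x _ _ (is_derive1_ln e1) d1.
have c2 := @is_derive1_comp R (@ln R) (fun x => expR x + 1) x _ _ (is_derive1_ln e2) d2.
have -> : csch x = (expR x - 1)^-1 * expR x - (expR x + 1)^-1 * expR x.
  rewrite /csch expRN; have := expR_gt0 x; have s := sinh_gt0 x0; rewrite expRN in s.
  move: (expR x) e1 e2 s => E e1 e2 s E0.
  by field; rewrite ?gt_eqF//; nra.
have h : is_derive x 1 ((@ln R \o (fun x => expR x - 1)) - (@ln R \o (fun x => expR x + 1)))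
  ((expR x - 1)^-1 * expR x - (expR x + 1)^-1 * expR x) by exact: is_deriveB.
exact: h.
Qed.

Lemma lth_cvg0 : lth x @[x --> +oo] --> (0 : R).
Proof.
have h : (1 - expR (- x)) / (1 + expR (- x)) @[x --> +oo] --> ((1 - 0) / (1 + 0) : R).
  apply: cvgM; first by apply: cvgB; [exact: cvg_cst|exact: cvgr_expR].
  apply: cvgV; first by rewrite addr0 oner_eq0.
  by apply: cvgD; [exact: cvg_cst|exact: cvgr_expR].
rewrite subr0 addr0 divr1 in h.
have l : {for (1 : R), continuous (@ln R)} by exact: continuous_ln.
have := @cvg_comp _ _ _ _ (@ln R) _ _ _ h l; rewrite ln1; apply: cvg_trans.
apply: near_eq_cvg; near=> x => /=.
have x0 : 0 < x by near: x; apply: nbhs_pinfty_gt; exact: num_real.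
have e1 := expRB1_gt0 x0; have e2 : 0 < expR x + 1 by rewrite addr_gt0 ?expR_gt0.
rewrite /lth -ln_div ?posrE//; congr ln; rewrite expRN.
have := expR_gt0 x; move: (expR x) e1 e2 => E e1 e2 E0.
by field; rewrite ?gt_eqF//; lra.
Unshelve. all: by end_near.
Qed.

Lemma integral_csch a : 0 < a -> (\int[mu]_(x in `[(2 * a)%R, +oo[) (csch x)%:E =
  (csch_tail a)%:E)%E.
Proof.
move=> a0; have a20 : 0 < 2 * a by rewrite mulr_gt0.
have pos x : 2 * a <= x -> 0 < x by exact: lt_le_trans.
rewrite (@ge0_continuous_FTC2y _ csch lth (2 * a) 0).
- by rewrite -EFinB /lth /csch_tail sub0r opprB.
- by move=> x /pos x0; rewrite divr_ge0// ltW// sinh_gt0.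
- apply: continuous_in_subspaceT => x; rewrite inE/= in_itv/= andbT => /pos x0.
  apply: cvgM; first exact: cvg_cst.
  apply: (@cvgV R R _ _ (fun y : R => expR y - expR (- y))); last exact: continuous_sinh.
  by rewrite gt_eqF// sinh_gt0.
- exact: lth_cvg0.
- by move=> x /ltW/pos x0; apply: ex_derive; exact: is_derive_lth.
- apply: cvg_at_right_filter; apply: differentiable_continuous.
  by apply/derivable1_diffP; apply: ex_derive; exact: is_derive_lth.
- move=> x; rewrite in_itv/= andbT => /ltW/pos x0; rewrite derive1E.
  by have [_ ->] := is_derive_lth x0.
Qed.

(** The difference is the logarithm of a coth a. Both a coth a and its inverse are at most 1 + 2a,
    because exp(2a) lies between 1 + 2a and 1/(1 - 2a). *)
Lemma csch_tail_bound a : 0 < a -> a <= 1 / 4 -> `|csch_tail a - ln (1 / a)| <= 2 * a.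
Proof.
move=> a0 a1; have a20 : 0 < 2 * a by rewrite mulr_gt0.
have e0 := expRB1_gt0 a20.
have h1 := expR_ge1Dx (2 * a).
have := ler_wpM2l (expR_ge0 (2 * a)) (expR_ge1Dx (- (2 * a))).
rewrite -expRD subrr expR0 => h2.
rewrite div1r lnV ?posrE// opprK /csch_tail.
move: (expR (2 * a)) e0 h1 h2 => E e0 h1 h2.
have e1 : 0 < E + 1 by lra.
have E2 : E <= 2 by nra.
have E3 : E - 1 <= 4 * a by nra.
have -> : ln (E + 1) - ln (E - 1) + ln a = ln (a * (E + 1) / (E - 1)).
  by rewrite ln_div ?posrE ?mulr_gt0// lnM ?posrE//; move: (ln _) (ln _) (ln _) => *; ring.
have q0 : 0 < a * (E + 1) / (E - 1) by rewrite divr_gt0// mulr_gt0.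
have u : a * (E + 1) / (E - 1) <= 1 + 2 * a.
  by rewrite ler_pdivrMr//; nra.
have l : (a * (E + 1) / (E - 1))^-1 <= 1 + 2 * a.
  by rewrite invfM invrK mulrC ler_pdivrMr ?mulr_gt0//; nra.
have a2 : -1 < 2 * a by lra.
have la := le_ln1Dx a2.
have p2 : 0 < 1 + 2 * a by lra.
have u' : ln (a * (E + 1) / (E - 1)) <= 2 * a.
  by apply: le_trans la; rewrite ler_ln ?posrE.
have l' : - ln (a * (E + 1) / (E - 1)) <= 2 * a.
  by rewrite -lnV ?posrE//; apply: le_trans la; rewrite ler_ln ?posrE ?invr_gt0.
by rewrite ler_norml u' andbT lerNl.
Qed.

Lemma half_bound a x : a <= 1 / 4 -> x < 2 * a -> x <= 1 / 2.
Proof. by move=> a1 xa; lra. Qed.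

Lemma integrable_setU (A B : set R) (f : R -> \bar R) :
  measurable (A : set T) -> measurable (B : set T) -> [disjoint A & B] ->
  mu.-integrable A f -> mu.-integrable B f -> mu.-integrable (A `|` B) f.
Proof.
move=> mA mB dj /integrableP[mfA iA] /integrableP[mfB iB].
have mf : measurable_fun (A `|` B : set T) f by apply/measurable_funU.
apply/integrableP; split => //; rewrite ge0_integral_setU//.
  exact: lte_add_pinfty.
exact: measurableT_comp.
Qed.

(* If [g] is supported in [-2a, 2a] and 2a < ln 2, the prime sum vanishes and
   W(g) = weil_const a * g 0 + int_0^2a (2 g(0) - g(x) - g(-x)) local_kernel(x) dx;
   [csch_tail a] is the coefficient of g(0) coming from x > 2a in the last integral. *)
Definition weil_const a : R := 2 * \int[mu]_(x in `]0, 2 * a[) cosh2 x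
  - (ln (4 * pi) + euler_mascheroni) - \int[mu]_(x in `]0, 2 * a[) rem_kernel x + csch_tail a.

Definition second_diff g x : R := 2 * g 0 - g x - g (- x).

(** Equivalently exp(-1/2) > 1/2, from the strict inequality 1 + x < exp x. It serves twice: 2a < ln
    2 removes the primes, and 2 ln 2 - 1 > 0 is the gap. *)
Lemma ln2_gt_half : 1 / 2 < ln 2 :> R.
Proof.
rewrite -(expRK (1 / 2)) ltr_ln ?posrE ?expR_gt0//.
have h : - (1 / 2) != 0 :> R by rewrite oppr_eq0 div1r invr_eq0 pnatr_eq0.
have := expR_gt1Dx h; have := expRxMexpNx_1 (1 / 2 : R); have := expR_gt0 (1 / 2 : R).
move: (expR (1 / 2)) (expR (- (1 / 2))) => A B A0 AB hB.
have : A * (1 / 2) < A * B by rewrite ltr_pM2l//; lra.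
lra.
Qed.

Lemma integrable_cosh2 a : 0 < a -> a <= 1 / 4 -> mu.-integrable `]0, 2 * a[ (EFin \o cosh2).
Proof.
move=> a0 a1; apply: (@bounded_integrable _ _ _ _ 3); first exact: measurable_cosh2.
move=> x /andP[x0 xa]; have x1 := half_bound a1 xa.
by have /andP[h1 h2] := cosh2_bounds x0 x1; rewrite ger0_norm.
Qed.

Lemma integrable_rem_kernel a : 0 < a -> a <= 1 / 4 ->
  mu.-integrable `]0, 2 * a[ (EFin \o rem_kernel).
Proof.
move=> a0 a1; apply: (@bounded_integrable _ _ _ _ 1); first exact: measurable_rem_kernel.
move=> x /andP[x0 xa]; have x1 := half_bound a1 xa.
by have /andP[h1 h2] := rem_kernel_bounds x0 x1; rewrite ger0_norm.
Qed.

Lemma weil_const_bound a : 0 < a -> a <= 1 / 4 ->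
  `|weil_const a - (ln (1 / a) - (ln (4 * pi) + euler_mascheroni))| <= 16 * a.
Proof.
move=> a0 a1; have a2 : 0 <= 2 * a by lra.
have t := csch_tail_bound a0 a1.
have c1 : 0 <= \int[mu]_(x in `]0, 2 * a[) cosh2 x.
  apply: Rintegral_ge0 => x; rewrite /= in_itv/= => /andP[x0 xa].
  by rewrite addr_ge0 ?expR_ge0.
have c2 : \int[mu]_(x in `]0, 2 * a[) cosh2 x <= 3 * (2 * a - 0).
  rewrite -Rintegral_cst_itv//; apply: ler_Rintegral_pw.
  - exact: integrable_cosh2.
  - exact: integrable_cst_itv.
  - move=> x /andP[x0 xa]; have x1 := half_bound a1 xa.
    by have /andP[] := cosh2_bounds x0 x1.
have r1 : 0 <= \int[mu]_(x in `]0, 2 * a[) rem_kernel x.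
  apply: Rintegral_ge0 => x; rewrite /= in_itv/= => /andP[x0 xa].
  have x1 := half_bound a1 xa.
  by have /andP[] := rem_kernel_bounds x0 x1.
have r2 : \int[mu]_(x in `]0, 2 * a[) rem_kernel x <= 1 * (2 * a - 0).
  rewrite -Rintegral_cst_itv//; apply: ler_Rintegral_pw.
  - exact: integrable_rem_kernel.
  - exact: integrable_cst_itv.
  - move=> x /andP[x0 xa]; have x1 := half_bound a1 xa.
    by have /andP[] := rem_kernel_bounds x0 x1.
rewrite /weil_const; move: t c1 c2 r1 r2.
move: (\int[mu]_(x in _) cosh2 x) (\int[mu]_(x in _) rem_kernel x) (ln (4 * pi) +
  _) (ln (1 / a)) (csch_tail a).
move=> I J L l t; rewrite !ler_norml => /andP[t1 t2] c1 c2 r1 r2.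
by apply/andP; split; lra.
Qed.

Section functional.
Variables (a : R) (g : R -> R) (B : R).
Hypothesis a0 : 0 < a.
Hypothesis a1 : a <= 1 / 4.
Hypothesis mg : measurable_fun [set: T] g.
Hypothesis gB : forall x, `|g x| <= B.
Hypothesis g0 : forall x, 2 * a <= `|x| -> g x = 0.

Let mgN : measurable_fun [set: T] (fun x => g (- x)).
Proof. by have := measurableT_comp mg (@oppr_measurable R setT). Qed.

Lemma measurable_second_diff : measurable_fun [set: T] (second_diff g).
Proof. by apply: measurable_funB => //; apply: measurable_funB. Qed.

Lemma weil_prime_sum : (\sum_(1 <= n <oo) (von_mangoldt n / Num.sqrt n%:R *
  (g (ln n%:R) + g (- ln n%:R)))%:E = 0)%E.
Proof.
(* The term n = 1 has von Mangoldt weight 0; for n >= 2, ln n lies outside the support of g. *)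
apply: eseries0 => -[|[|n]]//= _ _; first by rewrite /von_mangoldt/= !mul0r.
have h : 2 * a <= ln n.+2%:R.
  apply: (@le_trans _ _ (ln 2)); first by have := a1; have := ln2_gt_half; lra.
  by rewrite ler_ln ?posrE ?ltr0Sn// ler_nat.
have h0 : 0 <= ln n.+2%:R :> R by apply: le_trans h; rewrite mulr_ge0// ltW.
by rewrite !g0 ?normrN ?ger0_norm// addr0 mulr0.
Qed.

Let gchi : mu.-integrable setT (EFin \o (fun x => g x * cosh2 x)).
Proof.
have h : mu.-integrable `]- (2 * a), 2 * a[ (EFin \o (fun x => g x * cosh2 x)).
  apply: (@bounded_integrable _ _ _ _ (B * 3)).
    by apply: measurable_funM; [exact: measurable_funTS|exact: measurable_cosh2].
  move=> x /andP[x1 x2]; rewrite normrM ler_pM//.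
  have b y : 0 <= y -> y <= 1 / 2 -> `|cosh2 y| <= 3.
    rewrite le_eqVlt => /predU1P[<- _|y0 y1]; last first.
      by have /andP[h1 h2] := cosh2_bounds y0 y1; rewrite ger0_norm.
    by rewrite /cosh2 oppr0 !mul0r expR0 ger0_norm; lra.
  have [x0|x0] := leP 0 x; first by apply: b => //; exact: half_bound a1 x2.
  have -> : cosh2 x = cosh2 (- x) by rewrite /cosh2 opprK addrC.
  by apply: b; have := a1; lra.
have /(integrable_mkcond _ (measurable_itvT _)) := h.
apply: eq_integrable => // x _; rewrite patchE mem_setE in_itv/=.
case: ifPn => // hx; rewrite g0 ?mul0r//.
by rewrite leNgt; apply: contra hx; rewrite ltr_norml => /andP[-> ->].
Qed.

(** As [cosh2] is even, the integral folds onto ]0, 2a[. *)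
Lemma weil_cosh : (\int[mu]_x (g x * (expR (x / 2) + expR (- x / 2)))%:E =
  (\int[mu]_(x in `]0%R, (2 * a)%R[) ((g x + g (- x)) * cosh2 x)%R)%:E)%E.
Proof.
have a20 : 0 < 2 * a by rewrite mulr_gt0.
have i1 b c : mu.-integrable `]b, c[ (EFin \o (fun x => g x * cosh2 x)).
  by apply: (@integrableS _ T R mu setT);
    [exact: measurableT|exact: measurable_itvT|by []|exact: gchi].
transitivity ((\int[mu]_x (g x * cosh2 x))%:E).
  rewrite /Rintegral fineK//; apply: integrable_fin_num => //; exact: gchi.
congr EFin.
transitivity (\int[mu]_(x in `]- (2 * a), 2 * a[) (g x * cosh2 x)).
  rewrite Rintegral_mkif; apply: eq_Rintegral => x _; case: ifPn => // hx.
  by rewrite g0 ?mul0r// leNgt; apply: contra hx; rewrite ltr_norml => /andP[-> ->].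
rewrite (@Rintegral_split _ _ _ 0)//; last by rewrite oppr_lt0.
rewrite (Rintegral_reflect 0)// opprK !subr0 add0r.
have i2 : mu.-integrable `]0, 2 * a[ (EFin \o (fun x => g (- x) * cosh2 x)).
  apply: (@bounded_integrable _ _ _ _ (B * 3)).
    by apply: measurable_funM; [exact: measurable_funTS|exact: measurable_cosh2].
  move=> x /andP[x0 xa]; have x1 := half_bound a1 xa.
  by have /andP[h1 h2] := cosh2_bounds x0 x1; rewrite normrM ler_pM// ger0_norm.
rewrite [X in X + _](_ : _ = \int[mu]_(x in `]0, 2 * a[) (g (- x) * cosh2 x)); last first.
  by apply: eq_Rintegral => x _; rewrite sub0r /cosh2 opprK [expR (x / 2) + _]addrC.
rewrite addrC; have [_ <-] := RintegralD_oo (i1 0 (2 * a)) i2.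
by apply: eq_Rintegral => x _; rewrite mulrDl.
Qed.

Let h x := (g x + g (- x) - 2 * expR (- x / 2) * g 0) * weil_kernel x.

Let B0 : 0 <= B.
Proof. by apply: le_trans (gB 0). Qed.

Let h_near x : h x = - (second_diff g x * weil_kernel x) + g 0 * rem_kernel x.
Proof. by rewrite /h /second_diff /rem_kernel; move: (weil_kernel x) => K; ring. Qed.

(** Beyond the support only the g(0) term remains, and exp(-x/2) cancels exp(x/2). *)
Let h_far x : 2 * a <= x -> h x = - g 0 * csch x.
Proof.
move=> xa; have x0 : 0 <= x by apply: le_trans xa; rewrite mulr_ge0// ltW.
have e : expR (- x / 2) * expR (x / 2) = 1 by rewrite mulrC mulNr expRxMexpNx_1.
have gx : g x = 0 by rewrite g0// ger0_norm.
have gNx : g (- x) = 0 by rewrite g0// normrN ger0_norm.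
rewrite /h gx gNx /weil_kernel /csch;
  move: (expR (- x / 2)) (expR (x / 2)) e ((expR x - _)^-1) (g 0).
move=> E F e S G; transitivity (- G * 2 * (E * F) * S); first by ring.
by rewrite e; ring.
Qed.

Let dgB x : `|second_diff g x| <= 4 * B.
Proof.
rewrite /second_diff; have := gB 0; have := gB x; have := gB (- x); rewrite !ler_norml.
move=> /andP[? ?] /andP[? ?] /andP[? ?]; apply/andP; split; lra.
Qed.

Let dgchi : mu.-integrable `]0, 2 * a[ (EFin \o (fun x => second_diff g x * cosh2 x)).
Proof.
apply: (@bounded_integrable _ _ _ _ (4 * B * 3)).
  by apply: measurable_funM;
    [exact: measurable_funTS measurable_second_diff|exact: measurable_cosh2].
move=> x /andP[x0 xa]; have x1 := half_bound a1 xa.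
by have /andP[h1 h2] := cosh2_bounds x0 x1; rewrite normrM ler_pM// ger0_norm.
Qed.

Let kw_kap : mu.-integrable `]0, 2 * a[ (EFin \o (fun x => second_diff g x * weil_kernel x)) <->
  mu.-integrable `]0, 2 * a[ (EFin \o (fun x => second_diff g x * local_kernel x)).
Proof.
split=> i.
  have [j _] := RintegralZ_oo (- 1) dgchi; have [k _] := RintegralD_oo i j.
  apply: eq_integrable k; first exact: measurable_itvT.
  by move=> x _; congr EFin; rewrite /local_kernel; ring.
have [k _] := RintegralD_oo i dgchi.
apply: eq_integrable k; first exact: measurable_itvT.
by move=> x _; congr EFin; rewrite /local_kernel; ring.
Qed.

Let h_kw : mu.-integrable `]0, 2 * a[ (EFin \o h) <->
  mu.-integrable `]0, 2 * a[ (EFin \o (fun x => second_diff g x * weil_kernel x)).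
Proof.
have [r _] := RintegralZ_oo (g 0) (integrable_rem_kernel a0 a1).
split=> i.
  have [i' _] := RintegralZ_oo (- 1) i; have [k _] := RintegralD_oo r i'.
  apply: eq_integrable k; first exact: measurable_itvT.
  by move=> x _; congr EFin; rewrite h_near; ring.
have [i' _] := RintegralZ_oo (- 1) i; have [k _] := RintegralD_oo i' r.
apply: eq_integrable k; first exact: measurable_itvT.
by move=> x _; congr EFin; rewrite h_near; ring.
Qed.

Let h_tail : mu.-integrable `[2 * a, +oo[ (EFin \o h) /\
  \int[mu]_(x in `[2 * a, +oo[) h x = - g 0 * csch_tail a.
Proof.
have mc : measurable_fun (`[2 * a, +oo[ : set T) (EFin \o (csch : R -> R)).
  apply/measurable_EFinP; apply: subspace_continuous_measurable_fun; first exact: measurable_itvT.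
  apply: continuous_in_subspaceT => x; rewrite inE/= in_itv/= andbT => xa.
  have x0 : 0 < x by apply: lt_le_trans xa; rewrite mulr_gt0.
  apply: cvgM; first exact: cvg_cst.
  apply: (@cvgV R R _ _ (fun y : R => expR y - expR (- y))); last exact: continuous_sinh.
  by rewrite gt_eqF// sinh_gt0.
have ic : mu.-integrable `[2 * a, +oo[ (EFin \o (csch : R -> R)).
  apply/integrableP; split => //.
  apply: le_lt_trans (ltry (csch_tail a)); rewrite -integral_csch// le_eqVlt; apply/orP; left;
    apply/eqP.
  apply: eq_integral => x; rewrite inE /= in_itv/= andbT => xa.
  have x0 : 0 < x by apply: lt_le_trans xa; rewrite mulr_gt0.
  by rewrite ger0_norm// divr_ge0// ltW// sinh_gt0.
have e x : x \in `[2 * a, +oo[%classic -> - g 0 * csch x = h x.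
  by rewrite inE/= in_itv/= andbT => xa; rewrite h_far.
split.
  have := integrableZl (measurable_itvT _) (- g 0) ic.
  apply: eq_integrable; first exact: measurable_itvT.
  by move=> x xa; rewrite /= -e.
transitivity (\int[mu]_(x in `[2 * a, +oo[) (- g 0 * csch x)).
  by apply: eq_Rintegral => x xa; rewrite e.
by rewrite RintegralZl// /Rintegral integral_csch.
Qed.

Let splity : `]0, +oo[%classic = `]0, 2 * a[%classic `|` `[2 * a, +oo[%classic :> set R.
Proof.
have a20 : 0 < 2 * a by rewrite mulr_gt0.
apply/seteqP; split => x /=; rewrite !in_itv/= !andbT.
  by move=> x0; have [xa|xa] := ltP x (2 * a); [left; rewrite x0|right].
by move=> [/andP[]//|]; exact: lt_le_trans.
Qed.

Let dj : [disjoint `]0, 2 * a[%classic & `[2 * a, +oo[%classic : set R].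
Proof.
apply/disj_set2P/seteqP; split => x //=; rewrite !in_itv/= andbT => -[/andP[_ h1] h2].
by move: h1; rewrite ltNge h2.
Qed.

Let h_y : mu.-integrable `]0, 2 * a[ (EFin \o h) -> mu.-integrable `]0, +oo[ (EFin \o h).
Proof.
move=> i; rewrite splity; apply: integrable_setU;
  [exact: measurable_itvT|exact: measurable_itvT|exact: dj|exact: i|].
by have [] := h_tail.
Qed.

Let mh : measurable_fun (`]0, +oo[ : set T) h.
Proof.
rewrite splity; apply/measurable_funU; try exact: measurable_itvT.
split.
  apply: measurable_funM; last exact: measurable_weil_kernel.
  apply: measurable_funTS; apply: measurable_funB; first by apply: measurable_funD.
  apply: measurable_funM => //; apply: measurable_funM => //.
  apply: continuous_measurable_fun; exact: continuous_expRN_half.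
by have [/integrableP[/measurable_EFinP]] := h_tail.
Qed.

(** All other terms of W are finite, so only the singularity of the last integrand at 0 matters;
    there it differs from the local integrand by bounded functions. *)
Lemma weil_finite : (weil_real g \is a fin_num) <->
  mu.-integrable `]0, 2 * a[ (EFin \o (fun x => second_diff g x * local_kernel x)).
Proof.
have iy : (\int[mu]_(x in `]0%R, +oo[) (h x)%:E)%E \is a fin_num <->
    mu.-integrable `]0, 2 * a[ (EFin \o (fun x => second_diff g x * local_kernel x)).
  split.
    (* The integrand has no fixed sign, but a difference of infinities is never finite, so a finite
       value forces integrability. *)
    rewrite -(integral_fin_num_abs mu (measurable_itvT _) mh) => f.
    apply/kw_kap/h_kw; apply: (@integrableS _ T R mu `]0, +oo[); try exact: measurable_itvT.
      by move=> x /=; rewrite !in_itv/= andbT => /andP[].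
    by apply/integrableP; split => //; exact/measurable_EFinP.
  move=> /kw_kap/h_kw i; apply: integrable_fin_num; first exact: measurable_itvT.
  exact: h_y.
rewrite -iy /weil_real weil_prime_sum weil_cosh sube0 -EFinB.
by rewrite fin_numD /= fin_numN.
Qed.

Lemma weilE : mu.-integrable `]0, 2 * a[ (EFin \o (fun x => second_diff g x * local_kernel x)) ->
  weil_real g = (weil_const a * g 0 +
                 \int[mu]_(x in `]0, 2 * a[) (second_diff g x * local_kernel x))%:E.
Proof.
move=> i; have ik := kw_kap.2 i; have ih := h_kw.2 ik.
have [it et] := h_tail.
have exp_half : (\int[mu]_(x in `]0%R, +oo[) (h x)%:E =
    (\int[mu]_(x in `]0, 2 * a[) h x + \int[mu]_(x in `[2 * a, +oo[) h x)%:E)%E.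
  have iy := h_y ih.
  rewrite -Rintegral_setU//; try exact: measurable_itvT; last by rewrite -splity.
  by rewrite -splity /Rintegral fineK//; apply: integrable_fin_num; first exact: measurable_itvT.
have [i1 e1] := RintegralZ_oo (- 1) ik.
have [i2 e2] := RintegralZ_oo (g 0) (integrable_rem_kernel a0 a1).
have [_ e3] := RintegralD_oo i1 i2.
have eh1 : \int[mu]_(x in `]0, 2 * a[) h x =
    - 1 * \int[mu]_(x in `]0, 2 * a[) (second_diff g x * weil_kernel x) +
      g 0 * \int[mu]_(x in `]0, 2 * a[) rem_kernel x.
  by rewrite -e1 -e2 -e3; apply: eq_Rintegral => x _; rewrite h_near mulN1r.
have [i4 e4] := RintegralZ_oo (- 1) dgchi.
have [i5 e5] := RintegralZ_oo (2 * g 0) (integrable_cosh2 a0 a1).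
have [_ e6] := RintegralD_oo i5 i4.
have ec : \int[mu]_(x in `]0, 2 * a[) ((g x + g (- x)) * cosh2 x) =
   2 * g 0 * \int[mu]_(x in `]0, 2 * a[) cosh2 x +
     - 1 * \int[mu]_(x in `]0, 2 * a[) (second_diff g x * cosh2 x).
  by rewrite -e4 -e5 -e6; apply: eq_Rintegral => x _; rewrite /second_diff; ring.
have ek : \int[mu]_(x in `]0, 2 * a[) (second_diff g x * local_kernel x) =
   \int[mu]_(x in `]0, 2 * a[) (second_diff g x * weil_kernel x) +
     - 1 * \int[mu]_(x in `]0, 2 * a[) (second_diff g x * cosh2 x).
  rewrite -e4; have [_ <-] := RintegralD_oo ik i4.
  by apply: eq_Rintegral => x _; rewrite /local_kernel; ring.
rewrite /weil_real weil_prime_sum weil_cosh sube0 -EFinB exp_half -EFinB ec eh1 et ek; congr EFin.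
rewrite /weil_const.
move: (\int[mu]_(x in _) cosh2 x) (\int[mu]_(x in _) rem_kernel x) (\int[mu]_(x in _)
  (second_diff g x * weil_kernel x))
 (\int[mu]_(x in _) (second_diff g x * cosh2 x)) (ln _ + _) (csch_tail a) (g 0) => *; ring.
Qed.

End functional.

End weil_form.

(** * The digamma function at 2 *)

(* [lra] compares atoms up to conversion, which is costly on analytic terms:
   abstract them first. *)
Ltac revert_order := repeat match goal with
  | H : is_true (Order.le _ _) |- _ => revert H
  | H : is_true (Order.lt _ _) |- _ => revert H
  | H : is_true (andb _ _) |- _ => revert H
  end.

Section gamma.
Context {R : realType}.
Local Notation mu := (@lebesgue_measure R).
Local Notation T := (measurableTypeR R).
Implicit Types (x s t p h : R).

Definition gamma_integrand x t : R := t `^ (x - 1) * expR (- t).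

Lemma exp_half_cvg0 : expR (- (t / 2)) @[t --> +oo] --> (0 : R).
Proof.
apply: (@cvg_comp _ _ _ (fun t : R => t / 2) (fun t => expR (- t)) _ +oo); last exact: cvgr_expR.
by apply: gt0_cvgMly => //; exact: cvg_id.
Qed.

(** Apply ln y < y at y = t / (2p) and exponentiate. *)
Lemma powR_le_exp p : 0 < p -> exists2 C : R, 0 < C &
  forall t, 0 <= t -> t `^ p <= C * expR (t / 2).
Proof.
move=> p0; exists (expR (p * ln (2 * p))) => [|t]; first exact: expR_gt0.
rewrite le_eqVlt => /predU1P[<-|t0].
  by rewrite powR0 ?gt_eqF// mulr_ge0// expR_ge0.
rewrite /powR gt_eqF// -expRD ler_expR.
have h : 0 < t / (2 * p) by rewrite divr_gt0// mulr_gt0.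
have := ln_sublinear h; rewrite ln_div ?posrE ?mulr_gt0// => /ltW l.
have := ler_wpM2l (ltW p0) l.
rewrite (_ : p * (t / (2 * p)) = t / 2); last by field; rewrite gt_eqF.
lra.
Qed.

Lemma within_powR p : 0 < p -> {within `[0, +oo[, continuous (fun t => t `^ p)}.
Proof.
move=> p0; apply/continuous_within_itvcyP; split.
  move=> t; rewrite in_itv/= andbT => t0.
  apply: differentiable_continuous; apply/derivable1_diffP.
  by apply: derivable_powR; rewrite in_itv/= t0.
by rewrite powR0 ?gt_eqF//; exact: powR_cvg0.
Qed.

Lemma measurable_gamma_integrand x (D : set R) : measurable_fun (D : set T) (gamma_integrand x).
Proof.
apply: measurable_funTS; apply: measurable_funM; first exact: measurable_powR.
by apply: measurableT_comp => //; exact: measurable_expR.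
Qed.

Definition exp_half t : R := expR (- (t / 2)).

Lemma is_derive_exp_half t : is_derive t 1 (fun t => - 2 * exp_half t) (exp_half t).
Proof.
by rewrite /exp_half; apply: is_derive_eq; rewrite /GRing.scale/=; field.
Qed.

Lemma continuous_exp_half : continuous exp_half.
Proof.
move=> t; apply: (@continuous_comp _ _ _ (fun t => - (t / 2)) expR).
  by apply: cvgN; apply: mulrr_continuous.
exact: continuous_expR.
Qed.

Lemma integral_exp_half : (\int[mu]_(t in `[0%R, +oo[) (exp_half t)%:E = 2%:E)%E.
Proof.
rewrite (@ge0_continuous_FTC2y _ exp_half (fun t => - 2 * exp_half t) 0 0).
- by rewrite /exp_half mul0r oppr0 expR0 mulr1 -EFinB; congr EFin; ring.
- by move=> x _; exact: expR_ge0.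
- by apply: continuous_subspaceT; exact: continuous_exp_half.
- rewrite -(mulr0 (- 2)); apply: cvgM; [exact: cvg_cst|exact: exp_half_cvg0].
- by move=> x _; apply: ex_derive; exact: is_derive_exp_half.
- apply: cvg_at_right_filter; apply: cvgM; [exact: cvg_cst|exact: continuous_exp_half].
- by move=> x _; rewrite derive1E; have [_ ->] := is_derive_exp_half x.
Qed.

Lemma integrable_exp_half : mu.-integrable `]0, +oo[ (EFin \o exp_half).
Proof.
apply: (@integrableS _ T R mu `[0, +oo[ `]0, +oo[);
  [exact: measurable_itvT|exact: measurable_itvT| |].
  by move=> t /=; rewrite !in_itv/= !andbT; exact: ltW.
apply/integrableP; split.
  have h : measurable_fun [set: R] exp_half by apply: continuous_measurable_fun;
    exact: continuous_exp_half.
  by apply/measurable_EFinP; exact: (@measurable_funTS _ _ T T).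
apply: le_lt_trans (ltry 2); rewrite -integral_exp_half le_eqVlt; apply/orP; left; apply/eqP.
by apply: eq_integral => t _ /=; rewrite ger0_norm// expR_ge0.
Qed.

Lemma integrable_gamma_integrand x : 1 < x -> mu.-integrable `]0, +oo[ (EFin \o gamma_integrand x).
Proof.
move=> x1; have p0 : 0 < x - 1 by rewrite subr_gt0.
have [C C0 hC] := powR_le_exp p0.
have ic := integrableZl (measurable_itvT _) C integrable_exp_half.
apply: le_integrable ic; first exact: measurable_itvT.
  by apply/measurable_EFinP; exact: measurable_gamma_integrand.
move=> t; rewrite /= in_itv/= andbT => t0; rewrite lee_fin.
rewrite !ger0_norm ?mulr_ge0 ?powR_ge0 ?expR_ge0 ?(ltW C0)//.
apply: (@le_trans _ _ (C * expR (t / 2) * expR (- t))).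
  by rewrite ler_wpM2r ?expR_ge0// hC// ltW.
by rewrite -mulrA -expRD /exp_half ler_wpM2l ?(ltW C0)// ler_expR; lra.
Qed.

Lemma GammaE x : Gamma x = \int[mu]_(t in `]0, +oo[) gamma_integrand x t.
Proof. by []. Qed.

Lemma RintegralD_y (f g : R -> R) :
  mu.-integrable `]0, +oo[ (EFin \o f) -> mu.-integrable `]0, +oo[ (EFin \o g) ->
  mu.-integrable `]0, +oo[ (EFin \o (fun x => f x + g x)) /\
  \int[mu]_(x in `]0, +oo[) (f x + g x) =
  \int[mu]_(x in `]0, +oo[) f x + \int[mu]_(x in `]0, +oo[) g x.
Proof.
move=> fi gi; split; last by apply: RintegralD => //; exact: measurable_itvT.
exact: (integrableD (measurable_itvT _) fi gi).
Qed.

Lemma RintegralZ_y c (f : R -> R) :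
  mu.-integrable `]0, +oo[ (EFin \o f) ->
  mu.-integrable `]0, +oo[ (EFin \o (fun x => c * f x)) /\
  \int[mu]_(x in `]0, +oo[) (c * f x) = c * \int[mu]_(x in `]0, +oo[) f x.
Proof.
move=> fi; split; last by apply: RintegralZl => //; exact: measurable_itvT.
exact: (integrableZl (measurable_itvT _) c fi).
Qed.

Lemma ler_Rintegral_y (f g : R -> R) :
  mu.-integrable `]0, +oo[ (EFin \o f) -> mu.-integrable `]0, +oo[ (EFin \o g) ->
  (forall x, 0 < x -> f x <= g x) ->
  \int[mu]_(x in `]0, +oo[) f x <= \int[mu]_(x in `]0, +oo[) g x.
Proof.
move=> fi gi fg; apply: le_Rintegral; [exact: measurable_itvT|exact: fi|exact: gi|].
move=> x; rewrite /= in_itv/= andbT; exact: fg.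
Qed.

Lemma powR_exp_bound x C t : (forall t, 0 <= t -> t `^ x <= C * expR (t / 2)) ->
  0 <= t -> t `^ x * expR (- t) <= C * exp_half t.
Proof.
move=> hC t0; apply: (@le_trans _ _ (C * expR (t / 2) * expR (- t))).
  by rewrite ler_wpM2r ?expR_ge0// hC.
by rewrite -mulrA -expRD /exp_half (_ : t / 2 + - t = - (t / 2))//; field.
Qed.

Lemma within_gamma_integrand x : 1 < x -> {within `[0, +oo[, continuous (gamma_integrand x)}.
Proof.
move=> x1; have x0 : 0 < x - 1 by rewrite subr_gt0.
have ce : {within `[0, +oo[, continuous (fun t : R => expR (- t))}.
  apply: continuous_subspaceT => t; apply: (@continuous_comp _ _ _ -%R expR).
    exact: opp_continuous.
  exact: continuous_expR.
by move=> t; apply: cvgM; [exact: (within_powR x0)|exact: ce].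
Qed.

Lemma powR_exp_cvg0 x : 0 < x -> t `^ x * expR (- t) @[t --> +oo] --> (0 : R).
Proof.
move=> x0; have [C C0 hC] := powR_le_exp x0.
apply: (@squeeze_cvgr _ _ _ _ (cst 0) (fun t => C * exp_half t)); last 2 first.
+ exact: cvg_cst.
+ by rewrite -(mulr0 C); apply: cvgM; [exact: cvg_cst|exact: exp_half_cvg0].
near=> t; have t0 : 0 <= t by near: t; apply: nbhs_pinfty_ge; exact: num_real.
by rewrite /cst mulr_ge0 ?powR_ge0 ?expR_ge0//= powR_exp_bound.
Unshelve. all: by end_near.
Qed.

(* The term [C e^(-t/2)] makes the derivative of [t^x e^(-t)] nonnegative, as
   required by the fundamental theorem on a half-line. *)
Lemma Rintegral_gamma_integrand_diff x C : 1 < x ->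
  (forall t, 0 <= t -> t `^ x <= C * expR (t / 2)) ->
  \int[mu]_(t in `[0, +oo[) (x * gamma_integrand x t + (- 1 * gamma_integrand (x + 1) t +
    C * exp_half t)) = 2 * C.
Proof.
move=> x1 hC; have x0 : 0 < x by apply: lt_trans x1.
have x11 : 1 < x + 1 by rewrite ltrDr.
pose F t := t `^ x * expR (- t) - C * 2 * exp_half t.
rewrite (@Rintegral_ge0_continuous_FTC2y _ _ F 0 0).
- by rewrite /F powR0 ?gt_eqF// /exp_half !mul0r oppr0 expR0; ring.
- move=> t t0; rewrite /gamma_integrand addrK addr_ge0//.
    by rewrite !mulr_ge0 ?powR_ge0 ?expR_ge0// ltW.
  by rewrite mulN1r addrC subr_ge0 powR_exp_bound.
- move=> t; apply: cvgD; first by apply: cvgM; [exact: cvg_cst|exact: within_gamma_integrand].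
  apply: cvgD; apply: cvgM; [exact: cvg_cst|exact: within_gamma_integrand|exact: cvg_cst|].
  by apply: continuous_subspaceT; exact: continuous_exp_half.
- rewrite -[X in _ --> X]subr0; apply: cvgB; first exact: powR_exp_cvg0.
  by rewrite -(mulr0 (C * 2)); apply: cvgM; [exact: cvg_cst|exact: exp_half_cvg0].
- move=> t t0; apply: derivableB.
    apply: derivableM; first by apply: derivable_powR; rewrite in_itv/= t0.
    exact: ex_derive.
  exact: ex_derive.
- apply: cvgB; last first.
    by apply: cvg_at_right_filter; apply: cvgM; [exact: cvg_cst|exact: continuous_exp_half].
  apply: cvgM; first by rewrite powR0 ?gt_eqF//; exact: powR_cvg0.
  apply: cvg_at_right_filter; apply: (@continuous_comp _ _ _ -%R expR).
    exact: opp_continuous.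
  exact: continuous_expR.
- move=> t; rewrite in_itv/= andbT => t0; rewrite derive1E.
  have d1 : is_derive t 1 (fun t => t `^ x) (x * t `^ (x - 1)).
    apply: DeriveDef; first by apply: derivable_powR; rewrite in_itv/= t0.
    by rewrite -derive1E powR_derive1 ?in_itv/= ?t0.
  have d3 : is_derive t 1 F (t `^ x * - expR (- t) + x * t `^ (x - 1) * expR (- t) +
    C * exp_half t).
    by rewrite /F /exp_half; apply: is_derive_eq; rewrite /GRing.scale/=; field.
  by have [_ ->] := d3; rewrite /gamma_integrand addrK; ring.
Qed.

Lemma GammaD1 x : 1 < x -> Gamma (x + 1) = x * Gamma x :> R.
Proof.
move=> x1; have x0 : 0 < x by apply: lt_trans x1.
have x11 : 1 < x + 1 by rewrite ltrDr.
have num (A B C : R) : x * A + (- 1 * B + C * 2) = 2 * C -> B = x * A by lra.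
have [C C0 hC] := powR_le_exp x0.
have [i1 e1] := RintegralZ_y x (integrable_gamma_integrand x1).
have [i2 e2] := RintegralZ_y (- 1) (integrable_gamma_integrand x11).
have [i3 e3] := RintegralZ_y C integrable_exp_half.
have [i4 e4] := RintegralD_y i2 i3.
have [i5 e5] := RintegralD_y i1 i4.
have ehE : \int[mu]_(t in `]0, +oo[) exp_half t = 2.
  rewrite Rintegral_itv_obnd_cbnd; last exact: integrable_exp_half.
  by rewrite /Rintegral integral_exp_half.
have := Rintegral_gamma_integrand_diff x1 hC.
rewrite -(Rintegral_itv_obnd_cbnd i5).
by rewrite e5 e1 e4 e2 e3 ehE -!GammaE; exact: num.
Qed.

Lemma Gamma_gt0 x : 1 < x -> 0 < Gamma x :> R.
Proof.
move=> x1; rewrite GammaE.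
have i1 := integrable_gamma_integrand x1.
have h c : 1 < c < 2 -> expR (- 2) <= gamma_integrand x c.
  move=> /andP[c1 c2]; rewrite /gamma_integrand -[leLHS]mul1r ler_pM ?expR_ge0//.
    by rewrite -[leLHS](powRr0 c); apply: ler_powR; rewrite ?subr_ge0; exact: ltW.
  by rewrite ler_expR lerN2 ltW.
have s : `]1, 2[%classic `<=` (`]0, +oo[%classic : set R).
  by move=> t /=; rewrite !in_itv/= andbT => /andP[t1 _]; exact: lt_trans t1.
have i2 : mu.-integrable `]1, 2[ (EFin \o gamma_integrand x).
  by apply: (@integrableS _ T R mu `]0, +oo[ `]1, 2[) => //; exact: measurable_itvT.
have l1 : \int[mu]_(t in `]1, 2[) gamma_integrand x t <=
  \int[mu]_(t in `]0, +oo[) gamma_integrand x t.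
  rewrite /Rintegral fine_le//.
  - by apply: integrable_fin_num; [exact: measurable_itvT|exact: i2].
  - by apply: integrable_fin_num; [exact: measurable_itvT|exact: i1].
  - apply: ge0_subset_integral => //; try exact: measurable_itvT.
      by apply/measurable_EFinP; exact: measurable_gamma_integrand.
    by move=> t _; rewrite lee_fin mulr_ge0 ?powR_ge0 ?expR_ge0.
apply: lt_le_trans l1.
have l2 := @ler_Rintegral_pw R 1 2 (fun=> expR (- 2)) _ (integrable_cst_itv _ _ _) i2 h.
apply: lt_le_trans l2; rewrite Rintegral_cst_itv; last by rewrite ler1n.
by rewrite mulr_gt0 ?expR_gt0// subr_gt0 ltr1n.
Qed.

(* Weighted AM-GM: [r^s <= 1 - s + s r]. *)
Lemma powR_le_affine s (r : R) : 0 <= s <= 1 -> 0 < r -> r `^ s <= 1 - s + s * r.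
Proof.
move=> /andP[s0 s1] r0; rewrite /powR gt_eqF//.
set z := s * ln r; have ez := expR_gt0 z.
have h1 := ler_wpM2l (ltW ez) (expR_ge1Dx (- z)).
have h2 := ler_wpM2l (ltW ez) (expR_ge1Dx (ln r - z)).
rewrite -expRD subrr expR0 in h1.
rewrite -expRD (addrC z) subrK lnK ?posrE// in h2.
have s1' : 0 <= 1 - s by rewrite subr_ge0.
have h3 := ler_wpM2l s1' h1; have h4 := ler_wpM2l s0 h2.
have : expR z = (1 - s) * (expR z * (1 - z)) + s * (expR z * (1 + (ln r - z))).
  by rewrite /z; ring.
move: h3 h4; move: (expR z * (1 - z)) (expR z * (1 + (ln r - z))) => A B.
by move: (expR z) => E; lra.
Qed.

(** The tangent at r = 1 of the convex function r^(-q). *)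
Lemma powR_ge_affine q (r : R) : 0 <= q -> 0 < r -> 1 + q - q * r <= r `^ (- q).
Proof.
move=> q0 r0; rewrite /powR gt_eqF//; apply: le_trans (expR_ge1Dx _).
have r1 : -1 < r - 1 by rewrite ltrBrDr addNr.
have := ler_wpM2l q0 (le_ln1Dx r1); rewrite addrC subrK; move: (ln r) => L; lra.
Qed.

(** [powR_le_affine] at r = t/x, integrated against t^(x-1) exp(-t). The weights 1 - s and s
    recombine because Gamma(x + 1) / x = Gamma(x). *)
Lemma Gamma_upper x s : 1 < x -> 0 <= s <= 1 -> Gamma (x + s) <= x `^ s * Gamma x :> R.
Proof.
move=> x1 s01; have /andP[s0 s1] := s01.
have x0 : 0 < x by apply: lt_trans x1.
have x11 : 1 < x + 1 by rewrite ltrDr.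
have xs1 : 1 < x + s by apply: lt_le_trans x1 _; rewrite lerDl.
have [i1 e1] := RintegralZ_y (x `^ s * (1 - s)) (integrable_gamma_integrand x1).
have [i2 e2] := RintegralZ_y (x `^ s * (s / x)) (integrable_gamma_integrand x11).
have [i3 e3] := RintegralD_y i1 i2.
have -> : x `^ s * Gamma x = x `^ s * (1 - s) * Gamma x + x `^ s * (s / x) * Gamma (x + 1).
  rewrite (GammaD1 x1); move: (Gamma x) (x `^ s) => A B.
  by clear -x0; field; rewrite gt_eqF.
rewrite !GammaE -e1 -e2 -e3; apply: ler_Rintegral_y; [exact: integrable_gamma_integrand|exact: i3|].
move=> t t0; rewrite /gamma_integrand addrK.
have tx : 0 < t / x by rewrite divr_gt0.
have := ler_wpM2l (powR_ge0 x s) (powR_le_affine s01 tx).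
rewrite -powRM ?(ltW x0) ?(ltW tx)// mulrCA divff ?gt_eqF// mulr1 => h.
rewrite (_ : x + s - 1 = (x - 1) + s); last by ring.
rewrite powRD; last by apply/implyP => _; rewrite gt_eqF.
have k : 0 <= t `^ (x - 1) * expR (- t) by rewrite mulr_ge0 ?powR_ge0 ?expR_ge0.
have -> : t `^ (x - 1) * t `^ s * expR (- t) = t `^ s * (t `^ (x - 1) * expR (- t)) by ring.
apply: (le_trans (ler_wpM2r k h)).
have -> : t `^ x = t * t `^ (x - 1) by rewrite mulr_powRB1// ltW.
by rewrite le_eqVlt; apply/orP; left; apply/eqP; field; rewrite gt_eqF.
Qed.

(** [powR_ge_affine] with q = 1 - s at r = t/(x + 1), integrated against t^x exp(-t); the two terms
    in 1 - s cancel by the functional equation. *)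
Lemma Gamma_lower x s : 1 < x -> 0 <= s <= 1 ->
  x * (x + 1) `^ (s - 1) * Gamma x <= Gamma (x + s) :> R.
Proof.
move=> x1 /andP[s0 s1].
have x0 : 0 < x by apply: lt_trans x1.
have x11 : 1 < x + 1 by rewrite ltrDr.
have x21 : 1 < x + 1 + 1 by apply: lt_trans x11 _; rewrite ltrDl.
have y0 : 0 < x + 1 by apply: lt_trans x11.
have xs1 : 1 < x + s by apply: lt_le_trans x1 _; rewrite lerDl.
set y := x + 1 in x11 x21 y0 *.
have q0 : 0 <= 1 - s by rewrite subr_ge0.
have [i1 e1] := RintegralZ_y (y `^ (s - 1) * (1 + (1 - s))) (integrable_gamma_integrand x11).
have [i2 e2] := RintegralZ_y (- (y `^ (s - 1) * ((1 - s) / y))) (integrable_gamma_integrand x21).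
have [i3 e3] := RintegralD_y i1 i2.
have -> : x * y `^ (s - 1) * Gamma x = y `^ (s - 1) * (1 + (1 - s)) * Gamma y +
    - (y `^ (s - 1) * ((1 - s) / y)) * Gamma (y + 1).
  rewrite (GammaD1 x11) {3}/y (GammaD1 x1); move: (Gamma x) (y `^ (s - 1)) => A B.
  by clear -y0; field; rewrite gt_eqF.
rewrite !GammaE -e1 -e2 -e3; apply: ler_Rintegral_y; [exact: i3|exact: integrable_gamma_integrand|].
move=> t t0; rewrite /gamma_integrand addrK.
have ty : 0 < t / y by rewrite divr_gt0.
have := ler_wpM2l (powR_ge0 y (s - 1)) (powR_ge_affine q0 ty).
rewrite opprB -powRM ?(ltW y0) ?(ltW ty)// [y * _]mulrCA divff ?gt_eqF// mulr1 => h.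
rewrite (_ : x + s - 1 = x + (s - 1)); last by ring.
rewrite [t `^ (x + (s - 1))]powRD; last by apply/implyP => _; rewrite gt_eqF.
have k : 0 <= t `^ x * expR (- t) by rewrite mulr_ge0 ?powR_ge0 ?expR_ge0.
have -> : t `^ x * t `^ (s - 1) * expR (- t) = t `^ (s - 1) * (t `^ x * expR (- t)) by ring.
apply: le_trans (ler_wpM2r k h).
rewrite (addrK 1 y).
have -> : t `^ y = t * t `^ x.
  by rewrite -[in RHS](addrK 1 x) mulr_powRB1// ltW.
by rewrite le_eqVlt; apply/orP; left; apply/eqP; field; rewrite gt_eqF.
Qed.

(** * The logarithm of Gamma and its derivative at 2 *)

Definition lgamma x : R := ln (Gamma x).

Lemma lgammaD1 x : 1 < x -> lgamma (x + 1) = ln x + lgamma x.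
Proof.
move=> x1; have x0 : 0 < x by apply: lt_trans x1.
by rewrite /lgamma GammaD1// lnM ?posrE// Gamma_gt0.
Qed.

Lemma ln_incr x : 0 < x -> ln (x + 1) - ln x <= x^-1.
Proof.
move=> x0; have x1 : 0 < x + 1 by apply: addr_gt0.
rewrite -ln_div ?posrE// mulrDl divff ?gt_eqF// mul1r.
by apply: le_ln1Dx; apply: (@lt_trans _ _ 0); rewrite ?ltrN10// invr_gt0.
Qed.

Lemma ln_incr_ge x : 0 < x -> (x + 1)^-1 <= ln (x + 1) - ln x.
Proof.
move=> x0; have x1 : 0 < x + 1 by apply: addr_gt0.
rewrite -lerN2 opprB -ln_div ?posrE//.
rewrite (_ : x / (x + 1) = 1 + - (x + 1)^-1); last by field; rewrite gt_eqF.
by apply: le_ln1Dx; rewrite ltrN2 invf_lt1// ltrDr.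
Qed.

(** From ln z <= z - 1 at z = 1/(1 + y), ln (1 + y) is at least y / (1 + y). *)
Lemma ln1D_ge (y : R) : `|y| <= 1 / 2 -> y - 2 * y ^+ 2 <= ln (1 + y).
Proof.
rewrite ler_norml => /andP[y1 y2].
have y0 : 0 < 1 + y by lra.
have h : -1 < (1 + y)^-1 - 1 by rewrite ltrBrDr addNr invr_gt0.
have := le_ln1Dx h; rewrite addrC subrK lnV ?posrE// => l.
suff : y - 2 * y ^+ 2 <= 1 - (1 + y)^-1 by move: (ln _) l => L; lra.
rewrite (_ : 1 - (1 + y)^-1 = y / (1 + y)); last by field; rewrite gt_eqF.
rewrite ler_pdivlMr//.
have : 0 <= y ^+ 2 * (1 + 2 * y) by rewrite mulr_ge0 ?sqr_ge0//; lra.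
lra.
Qed.

Lemma lgamma_upper x s : 1 < x -> 0 <= s <= 1 -> lgamma (x + s) <= s * ln x + lgamma x.
Proof.
move=> x1 s01; have x0 : 0 < x by apply: lt_trans x1.
have xs1 : 1 < x + s by case/andP: s01 => s0 _; apply: lt_le_trans x1 _; rewrite lerDl.
rewrite -ln_powR -lnM ?posrE ?powR_gt0 ?Gamma_gt0//.
by rewrite ler_ln ?posrE ?mulr_gt0 ?powR_gt0 ?Gamma_gt0//; exact: Gamma_upper.
Qed.

Lemma lgamma_lower x s : 1 < x -> 0 <= s <= 1 ->
  ln x + (s - 1) * ln (x + 1) + lgamma x <= lgamma (x + s).
Proof.
move=> x1 s01; have x0 : 0 < x by apply: lt_trans x1.
have x2 : 0 < x + 1 by apply: addr_gt0.
have xs1 : 1 < x + s by case/andP: s01 => s0 _; apply: lt_le_trans x1 _; rewrite lerDl.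
rewrite -ln_powR -!lnM ?posrE ?mulr_gt0 ?powR_gt0 ?Gamma_gt0//.
by rewrite ler_ln ?posrE ?mulr_gt0 ?powR_gt0 ?Gamma_gt0//; exact: Gamma_lower.
Qed.

(** Gamma(M + h) / Gamma(M) behaves like M^h; the error is the growth of ln over steps of length at
    most 1 near M. *)
Lemma lgamma_asymp (M h : R) : 2 <= M -> `|h| <= 1 / 2 ->
  `|lgamma (M + h) - lgamma M - h * ln M| <= (M - 1)^-1.
Proof.
move=> M2; rewrite ler_norml => /andP[h1 h2].
have M0 : 0 < M by lra.
have M1 : 1 < M by lra.
have Mh1 : 1 < M + h by lra.
have Mh0 : 0 < M + h by lra.
have MM1 : 0 < M - 1 by lra.
have M10 : 0 < M + 1 by lra.
have Mh10 : 0 < M + h + 1 by lra.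
have q0 : 0 <= (M - 1)^-1 by rewrite invr_ge0 ltW.
have [h0|h0] := leP 0 h.
  have MM : M^-1 <= (M - 1)^-1 by rewrite lef_pV2 ?posrE//; lra.
  have h01 : 0 <= h <= 1 by lra.
  have h10 : 0 <= 1 - h by lra.
  have h11 : 1 - h <= 1 by lra.
  have MM' : M <= M + 1 by lra.
  have ll : 0 <= ln (M + 1) - ln M by rewrite subr_ge0 ler_ln.
  have p := ler_pM h10 ll h11 (ln_incr M0).
  have u := lgamma_upper M1 h01; have l := lgamma_lower M1 h01.
  rewrite ler_norml; apply/andP; revert_order.
  move: (lgamma (M + h)) (lgamma M) (ln (M + 1)) (ln M) M^-1 (M - 1)^-1 => *.
  by split; lra.
(* For h < 0 the Gamma bounds are used at M + h with step -h, which leads back to M. *)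
have h01 : 0 <= - h <= 1 by lra.
have xM : (M + h)^-1 <= (M - 1)^-1 by rewrite lef_pV2 ?posrE//; lra.
have MM' : M + h <= M by lra.
have MM'' : M <= M + h + 1 by lra.
have u := lgamma_upper Mh1 h01; have l := lgamma_lower Mh1 h01.
rewrite addrK in u l.
have li' := ln_incr Mh0.
have l1 : ln (M + h) <= ln M by rewrite ler_ln.
have l2 : ln M <= ln (M + h + 1) by rewrite ler_ln.
have l3 : h * ln M <= h * ln (M + h) by rewrite ler_wnM2l// ltW.
have l4 : h * ln (M + h + 1) <= h * ln M by rewrite ler_wnM2l// ltW.
rewrite ler_norml; apply/andP; revert_order.
move: (lgamma (M + h)) (lgamma M) (ln (M + h + 1)) (ln (M + h)) (ln M) (M + h)^-1 (M - 1)^-1 => *.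
by split; lra.
Qed.

Lemma lgamma_shift (N : nat) h : `|h| <= 1 / 2 ->
  lgamma (2 + h + N%:R) = lgamma (2 + h) + \sum_(0 <= k < N) ln (2 + h + k%:R).
Proof.
rewrite ler_norml => /andP[h1 h2].
have pn (n : R) : 0 <= n -> 1 < 2 + h + n by lra.
elim: N => [|N IH]; first by rewrite addr0 big_nil addr0.
have p : 1 < 2 + h + N%:R by exact: pn.
have -> : \sum_(0 <= k < N.+1) ln (2 + h + k%:R) =
    \sum_(0 <= k < N) ln (2 + h + k%:R) + ln (2 + h + N%:R) by rewrite big_nat_recr.
rewrite addrA -IH (_ : N.+1%:R = N%:R + 1); last by rewrite natr1.
by rewrite [2 + h + (_ + _)]addrA (lgammaD1 p) addrC.
Qed.

(** Telescoping, with 1/(n + 2)^2 below 1/((n + 1)(n + 2)). *)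
Lemma sum_inv_sqr (N : nat) : \sum_(0 <= k < N) ((k%:R + 2 : R) ^+ 2)^-1 <= 1 - (N%:R + 1)^-1.
Proof.
elim: N => [|N IH]; first by rewrite big_nil add0r invr1 subrr.
rewrite big_nat_recr//= (_ : N.+1%:R = N%:R + 1); last by rewrite natr1.
have n0 : 0 <= N%:R :> R by exact: ler0n.
move: (N%:R) n0 IH => n n0 IH.
have : ((n + 2) ^+ 2)^-1 <= (n + 1)^-1 - (n + 1 + 1)^-1.
  rewrite (_ : _ - _ = ((n + 1) * (n + 2))^-1); last by field; lra.
  by rewrite lef_pV2 ?posrE ?exprn_gt0 ?mulr_gt0; nra.
lra.
Qed.

(** The coefficient of h after shifting the argument by N: ln (2 + N) from the asymptotics of
    [lgamma], minus the first-order terms of the N logarithms. *)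
Definition psi_approx (N : nat) : R :=
  ln (2 + N%:R) - \sum_(0 <= k < N) (k%:R + 2)^-1.

Lemma ln_term_bound q h : 0 <= q -> `|h| <= 1 / 2 ->
  `|ln (2 + h + q) - ln (2 + q) - h / (q + 2)| <= 2 * h ^+ 2 * ((q + 2) ^+ 2)^-1.
Proof.
move=> q0 hh; have q2 : 0 < q + 2 by lra.
have q2' : 0 < 2 + q by lra.
move: (hh); rewrite ler_norml => /andP[hh1 hh2].
have qh : 0 < 2 + h + q by lra.
have y1 : `|h / (q + 2)| <= 1 / 2.
  rewrite normrM normfV (gtr0_norm q2) ler_pdivrMr//; apply: (le_trans hh); lra.
have y2 : -1 < h / (q + 2).
  by move: y1; move: (h / _) => y; rewrite ler_norml => /andP[]; lra.
have -> : ln (2 + h + q) - ln (2 + q) = ln (1 + h / (q + 2)).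
  by rewrite -ln_div ?posrE//; congr ln; field; rewrite ?gt_eqF.
rewrite (_ : 2 * h ^+ 2 / _ = 2 * (h / (q + 2)) ^+ 2); last by field; rewrite gt_eqF.
have := ln1D_ge y1; have := le_ln1Dx y2.
move: (h / (q + 2)) (ln _) => y L u l.
have s0 : 0 <= y ^+ 2 by exact: sqr_ge0.
by rewrite ler_norml; apply/andP; split; lra.
Qed.

(** Shift 2 + h and 2 by N and compare them there by [lgamma_asymp]. The quadratic error is uniform
    in N because the inverse squares are summable, so N can tend to infinity at fixed h. *)
Lemma lgamma_taylor (N : nat) h : `|h| <= 1 / 2 ->
  `|lgamma (2 + h) - lgamma 2 - h * psi_approx N| <= (1 + N%:R)^-1 + 2 * h ^+ 2.
Proof.
move=> hh; have M2 : 2 <= 2 + N%:R :> R by rewrite lerDl.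
have z0 : `|0 : R| <= 1 / 2 by rewrite normr0.
have := lgamma_shift N z0; rewrite addr0 => e0.
have e1 := lgamma_shift N hh.
have := lgamma_asymp M2 hh.
rewrite (addrAC 2 _ h) e1 e0 (_ : 2 + N%:R - 1 = 1 + N%:R :> R); last by ring.
have d : `|\sum_(0 <= k < N) ln (2 + h + k%:R) - \sum_(0 <= k < N) ln (2 + k%:R)
     - h * \sum_(0 <= k < N) (k%:R + 2)^-1| <= 2 * h ^+ 2.
  rewrite mulr_sumr -!sumrB.
  apply: (le_trans (ler_norm_sum _ _ _)).
  apply: (@le_trans _ _ (\sum_(0 <= k < N) (2 * h ^+ 2 * ((k%:R + 2) ^+ 2)^-1))).
    by apply: ler_sum => k _; exact: ln_term_bound.
  rewrite -mulr_sumr -[leRHS]mulr1; apply: ler_wpM2l.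
    by apply: mulr_ge0; [|exact: sqr_ge0].
  by apply: (le_trans (sum_inv_sqr N)); rewrite gerBl invr_ge0 addr_ge0.
rewrite /psi_approx; move: d.
move: (\sum_(_ <= _ < _) _) (\sum_(_ <= _ < _) _) (\sum_(_ <=
  _ < _) _) (lgamma _) (lgamma _) (ln _) => A B C D E F.
clear e0 e1 M2 z0; move: (_^-1) => q.
rewrite !ler_norml => /andP[a1 a2] /andP[b1 b2]; apply/andP; split; lra.
Qed.

Let eg n : R := series harmonic n - ln n%:R.

Lemma harmonic_ln_ge n : ln n.+1%:R <= series harmonic n :> R.
Proof.
elim: n => [|n IH]; first by rewrite /series/= big_nil ln1.
rewrite seriesSr (_ : harmonic n = n.+1%:R^-1)//.
have := @ln_incr n.+1%:R (ltr0Sn _ n); rewrite natr1.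
by move: (series _ _) IH => S; move: (ln n.+2%:R) (ln _) (_^-1) => A B C; lra.
Qed.

Lemma cvg_euler_mascheroni : eg n.+1 @[n --> \oo] --> (euler_mascheroni : R).
Proof.
(* The shift skips the index 0, where the default [ln 0 = 0] breaks monotonicity. *)
have c : cvgn (fun n => eg n.+1).
  apply: nonincreasing_is_cvgn.
    apply/nonincreasing_seqP => n; rewrite /eg seriesSr (_ : harmonic n.+1 = n.+2%:R^-1)//.
    have := @ln_incr_ge n.+1%:R (ltr0Sn _ n); rewrite natr1.
    by move: (series _ _) (ln n.+2%:R) (ln n.+1%:R) (_^-1) => S A B C; lra.
  exists 0 => _ [n _ <-]; rewrite /eg subr_ge0.
  apply: le_trans (harmonic_ln_ge n.+1).
  by rewrite ler_ln ?posrE ?ltr0Sn// ler_nat.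
have c' : cvgn eg by apply/cvg_ex; case/cvg_ex: c => l; rewrite cvg_shiftS => ?; exists l.
by rewrite cvg_shiftS.
Qed.

Lemma cvg_psi_approx : psi_approx n @[n --> \oo] --> (1 - euler_mascheroni : R).
Proof.
(* The sum of the 1/(k + 2) is a harmonic sum without its first term 1; the logarithm is taken one
   integer later, whence the last difference. *)
have e n : psi_approx n = 1 - eg n.+1 + (ln (n.+1%:R + 1) - ln n.+1%:R).
  rewrite /psi_approx /eg natr1 (_ : 2 + n%:R = n.+2%:R :> R); last by rewrite -natrD.
  have -> : series harmonic n.+1 = 1 + \sum_(0 <= k < n) (k%:R + 2)^-1 :> R.
    rewrite /series/= big_nat_recl//= /harmonic/= invr1; congr (_ + _).
    by apply: eq_bigr => k _; rewrite -natrD addn2.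
  ring.
have -> : psi_approx = fun n => 1 - eg n.+1 + (ln (n.+1%:R + 1) - ln n.+1%:R).
  by apply/funext.
rewrite -[X in _ --> X]addr0; apply: cvgD.
  by apply: cvgB; [exact: cvg_cst|exact: cvg_euler_mascheroni].
apply: (@squeeze_cvgr _ _ _ _ (cst 0) (@harmonic R)); last 2 first.
- exact: cvg_cst.
- exact: cvg_harmonic.
apply: nearW => n; rewrite /cst /harmonic /= ln_incr ?ltr0Sn// andbT.
by rewrite subr_ge0 ler_ln ?posrE ?addr_gt0 ?ltr0Sn// lerDl.
Qed.

Lemma lgamma_taylor2 h : `|h| <= 1 / 2 ->
  `|lgamma (2 + h) - lgamma 2 - h * (1 - euler_mascheroni)| <= 2 * h ^+ 2.
Proof.
move=> hh.
have c : (`|lgamma (2 + h) - lgamma 2 - h * psi_approx n| - harmonic n) @[n --> \oo] -->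
   (`|lgamma (2 + h) - lgamma 2 - h * (1 - euler_mascheroni)| - 0 : R).
  apply: cvgB; last exact: cvg_harmonic.
  apply: cvg_norm; apply: cvgB; first exact: cvg_cst.
  by apply: cvgM; [exact: cvg_cst|exact: cvg_psi_approx].
rewrite subr0 in c; rewrite -(cvg_lim _ c)//.
apply: limr_le; first exact: cvgP c.
apply: nearW => n; rewrite lerBlDr (_ : 2 * h ^+ 2 + harmonic n = (1 + n%:R)^-1 + 2 * h ^+ 2).
  exact: lgamma_taylor.
by rewrite addrC nat1r.
Qed.

Lemma is_derive_lgamma2 : is_derive (2 : R) 1 lgamma (1 - euler_mascheroni).
Proof.
set c := 1 - euler_mascheroni.
have cv : h^-1 *: ((lgamma \o shift 2) (h *: 1) - lgamma 2) @[h --> 0^'] --> (c : R).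
  apply/cvgrPdist_le => e e0; near=> h.
  have h0 : h != 0 by near: h; exact: nbhs_dnbhs_neq.
  have he : `|h| <= Num.min (1 / 2) (e / 2).
    near: h; apply: dnbhs0_le; rewrite lt_min !divr_gt0//.
  move: he; rewrite le_min => /andP[he1 he2].
  have := lgamma_taylor2 he1; rewrite -/c /=.
  rewrite /GRing.scale/= mulr1 (addrC h 2) => t.
  rewrite -(real_normK (num_real h)) in t.
  move: (lgamma (2 + h) - lgamma 2) t => D t.
  rewrite distrC (_ : _ - c = h^-1 * (D - h * c)); last by field.
  have hp : 0 < `|h| by rewrite normr_gt0.
  rewrite normrM normfV mulrC ler_pdivrMr//.
  by apply: (le_trans t); rewrite expr2 mulrA ler_pM2r//; lra.
apply: DeriveDef; first by apply/cvg_ex; exists c.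
exact: cvg_lim cv.
Unshelve. all: by end_near.
Qed.

Theorem digamma2E : digamma 2 = 1 - euler_mascheroni :> R.
Proof.
have d := is_derive_lgamma2.
have d2 := is_derive1_comp (is_derive_expR (lgamma 2)) d.
have g2 : 0 < Gamma 2 :> R by apply: Gamma_gt0; rewrite ltr1n.
have e : {near (2 : R), (expR \o lgamma) =1 Gamma}.
  near=> x => /=; rewrite /lgamma lnK// posrE; apply: Gamma_gt0.
  near: x; apply: lt_nbhsr; exact: ltr1n.
rewrite /digamma derive1E -(near_eq_derive _ e).
have [_ ->] := d2; rewrite /lgamma lnK ?posrE// [X in X / _]mulrC mulfK//.
by rewrite gt_eqF.
Unshelve. all: by end_near.
Qed.

End gamma.

(** * Rayleigh quotients *)

Section kernels.
Context {R : realType}.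
Local Notation mu := (@lebesgue_measure R).
Local Notation T := (measurableTypeR R).
Implicit Types (u v w K : R -> R) (a c x : R).

(** For a <= 1/32 the leading term 1/(2x) is at least 8 and dominates the error 4 of
    [local_kernel_bounds]. *)
Lemma local_kernel_ge0 a x : a <= 1 / 32 -> 0 < x < 2 * a -> 0 <= local_kernel x.
Proof.
move=> a1 /andP[x0 xa]; have x1 : x <= 1 / 16 by lra.
have x2 : x <= 1 / 2 by lra.
have := local_kernel_bounds x0 x2.
have : 8 <= (2 * x)^-1 by rewrite -[leLHS]invrK lef_pV2 ?posrE ?mulr_gt0//; lra.
by move: (local_kernel x) (_^-1) => k y; rewrite ler_norml => h /andP[]; lra.
Qed.

Lemma local_kernel_le a x : a <= 1 / 32 -> 0 < x < 2 * a -> local_kernel x <= x^-1.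
Proof.
move=> a1 /andP[x0 xa]; have x1 : x <= 1 / 16 by lra.
have x2 : x <= 1 / 2 by lra.
have := local_kernel_bounds x0 x2; rewrite invfM.
have : 16 <= x^-1 by rewrite -[leLHS]invrK lef_pV2 ?posrE//; lra.
by move: (local_kernel x) (x^-1) => k y; rewrite ler_norml => h /andP[]; lra.
Qed.

(** The kernels differ by at most 4 and [corr_diff u u] is at most 4 [ip u u]; integration over
    length 2a gives the constant 32. *)
Lemma jump_dom_local_kernel a u : 0 < a -> a <= 1 / 32 ->
  (jump_dom local_kernel a u <-> jump_dom (fun x => (2 * x)^-1) a u) /\
  (jump_dom local_kernel a u ->
    `|jump_form local_kernel a u u - jump_form (fun x => (2 * x)^-1) a u u| <= 32 * a * ip u u).
Proof.
move=> a0 a1.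
have H (lu : L2on a u) : mu.-integrable `]0, 2 * a[ (EFin \o (fun x => corr_diff u u x *
  (local_kernel x - (2 * x)^-1))) /\
   `|\int[mu]_(x in `]0, 2 * a[) (corr_diff u u x * (local_kernel x - (2 * x)^-1))| <=
     32 * a * ip u u.
  have su := lu.1.
  have b x : 0 < x < 2 * a -> `|corr_diff u u x * (local_kernel x - (2 * x)^-1)| <= 16 * ip u u.
    move=> /andP[x0 xa]; have x2 : x <= 1 / 2 by lra.
    rewrite normrM (_ : 16 * ip u u = 4 * ip u u * 4); last by ring.
    apply: ler_pM => //; last exact: local_kernel_bounds.
    by rewrite ger0_norm ?corr_diff_ge0//; exact: corr_diff_le.
  have i : mu.-integrable `]0, 2 * a[ (EFin \o (fun x => corr_diff u u x * (local_kernel x - (2 *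
    x)^-1))).
    apply: (@bounded_integrable _ _ _ _ (16 * ip u u)) => //.
    apply: measurable_funM; first by apply: measurable_funTS; exact: measurable_corr_diff.
    by apply: measurable_funB; [exact: measurable_local_kernel|exact: measurable_inv2].
  split => //.
  apply: (le_trans (le_normr_Rintegral (measurable_itvT _) i)).
  apply: (@le_trans _ _ (16 * ip u u * (2 * a - 0))); last first.
    by rewrite subr0; move: (ip u u) => I; lra.
  rewrite -Rintegral_cst_itv; last by rewrite mulr_ge0// ltW.
  apply: ler_Rintegral_pw => //; last exact: integrable_cst_itv.
  by have := integrable_norm i; apply.
have E K K' : (forall x, corr_diff u u x * K x + corr_diff u u x * (K' x - K x) =
  corr_diff u u x * K' x) by move=> x; ring.
have S : jump_dom local_kernel a u <-> jump_dom (fun x => (2 * x)^-1) a u.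
  split=> -[lu i]; have [j _] := H lu; split => //.
    have [j' _] := RintegralZ_oo (- 1) j; have [k _] := RintegralD_oo i j'.
    apply: eq_integrable k; first exact: measurable_itvT.
    by move=> x _; congr EFin; ring.
  have [k _] := RintegralD_oo i j.
  by apply: eq_integrable k; [exact: measurable_itvT|move=> x _; congr EFin; ring].
split => // dk; have d1 := S.1 dk; have [j jB] := H dk.1.
suff -> : jump_form local_kernel a u u - jump_form (fun x => (2 * x)^-1) a u u =
  \int[mu]_(x in `]0, 2 * a[) (corr_diff u u x * (local_kernel x - (2 * x)^-1)) by [].
have [_ e] := RintegralD_oo d1.2 j.
apply/eqP; rewrite subr_eq addrC -e; apply/eqP; apply: eq_Rintegral => x _; ring.
Qed.

Definition rayleigh_inf K a : R := inf [set r | exists u, [/\ jump_dom K a u, ip u u = 1 & r =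
  jump_form K a u u]].

Section rayleigh.
Variables (K : R -> R) (a : R).
Hypothesis a0 : 0 < a.
Hypothesis mK : measurable_fun (`]0, 2 * a[ : set T) K.
Hypothesis K0 : forall x, 0 < x < 2 * a -> 0 <= K x.
Hypothesis K1 : forall x, 0 < x < 2 * a -> K x <= x^-1.

Lemma jump_dom_normalize u : jump_dom K a u -> ip u u != 0 ->
  exists w, [/\ jump_dom K a w, ip w w = 1 & jump_form K a w w = jump_form K a u u / ip u u].
Proof.
move=> du u0; have su := du.1.1; have up : 0 < ip u u by rewrite lt_def u0 ip_ge0.
pose c := (Num.sqrt (ip u u))^-1.
have c2 : c ^+ 2 = (ip u u)^-1 by rewrite exprVn sqr_sqrtr// ltW.
have dl := jump_dom_lc mK K0 (c - 1) du du.
exists (lc (c - 1) u u); split => //.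
  rewrite ip_lc2// (_ : _ + _ = c ^+ 2 * ip u u); last by ring.
  by rewrite c2 mulVf.
rewrite (jump_form_lcl mK K0)// (jump_formC du dl) (jump_form_lcl mK K0)//.
rewrite (_ : _ + _ = c ^+ 2 * jump_form K a u u); last by move: (jump_form K a u u) => *; ring.
by rewrite c2 mulrC.
Qed.

Let S := [set r | exists u, [/\ jump_dom K a u, ip u u = 1 & r = jump_form K a u u]].

Let S_lb : has_lbound S.
Proof. by exists 0 => _ [u [du _ ->]]; exact: jump_form_ge0. Qed.

Let S_inf : has_inf S.
Proof.
split => //; have dw : jump_dom K a (window a) by apply: jump_dom_window => // x xa;
  rewrite K0// K1.
have w0 : ip (window a) (window a) != 0 by rewrite ip_window// gt_eqF// mulr_gt0.
by have [w [dw' w1 _]] := jump_dom_normalize dw w0; exists (jump_form K a w w), w.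
Qed.

Lemma rayleigh_ge0 : 0 <= rayleigh_inf K a.
Proof. by apply: lb_le_inf; [exact: S_inf.1|move=> _ [u [du _ ->]]; exact: jump_form_ge0]. Qed.

Lemma rayleigh_le u : jump_dom K a u -> rayleigh_inf K a * ip u u <= jump_form K a u u.
Proof.
move=> du; have [u0|u0] := eqVneq (ip u u) 0; first by rewrite u0 mulr0; exact: jump_form_ge0.
have [w [dw w1 e]] := jump_dom_normalize du u0.
rewrite -ler_pdivlMr; last by rewrite lt_def u0 ip_ge0.
by apply: ge_inf => //; exists w; rewrite e.
Qed.

Lemma rayleigh_approx e : 0 < e -> exists u, [/\ jump_dom K a u, ip u u = 1 &
  jump_form K a u u <= rayleigh_inf K a + e].
Proof.
move=> e0; have [_ [u [du u1 ->]] l] := inf_adherent e0 S_inf.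
by exists u; split => //; exact: ltW.
Qed.

Lemma rayleigh_ge c : (forall u, jump_dom K a u -> c * ip u u <= jump_form K a u u) -> c <=
  rayleigh_inf K a.
Proof.
move=> h; apply: lb_le_inf; first exact: S_inf.1.
by move=> _ [u [du u1 ->]]; have := h _ du; rewrite u1 mulr1.
Qed.

End rayleigh.

Local Notation K1 := (fun x : R => (2 * x)^-1).

Lemma inv2_le a x : 0 < x < 2 * a -> (2 * x)^-1 <= x^-1.
Proof.
move=> /andP[x0 _]; rewrite lef_pV2 ?posrE ?mulr_gt0//.
by rewrite ler_pMl// ler1n.
Qed.

(** Energy and squared norm scale alike; [key] is applied with factors 1/a and a. *)
Lemma rayleigh_dilate a : 0 < a -> rayleigh_inf K1 a = rayleigh_inf K1 1.
Proof.
have key (b s : R) : 0 < s -> 0 < b -> rayleigh_inf K1 b <= rayleigh_inf K1 (s * b).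
  move=> s0 b0; have sb : 0 < s * b by rewrite mulr_gt0.
  apply: (@rayleigh_ge K1 _ sb (@measurable_inv2 R _) (@inv2_ge0 R _) (@inv2_le _)) => u du.
  have [dU eU] := energy_dilate s0 du.
  rewrite eU (ip_dilate s0 du.1.1 du.1.1) mulrCA ler_pM2l//.
  exact: (@rayleigh_le K1 _ (@measurable_inv2 R _) (@inv2_ge0 R _)).
move=> a0; apply/le_anti/andP; split.
  have ai : 0 < a^-1 by rewrite invr_gt0.
  by have := key a a^-1 ai a0; rewrite mulVf// gt_eqF.
by have := key 1 a a0 ltr01; rewrite mulr1.
Qed.

Definition rayleigh0 : R := rayleigh_inf K1 1.

Lemma rayleigh0_lower : ln 2 + 72^-1 <= rayleigh0.
Proof.
apply: (@rayleigh_ge K1 _ ltr01 (@measurable_inv2 R _) (@inv2_ge0 R _) (@inv2_le _)) => u du.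
exact: energy_lower.
Qed.

Lemma rayleigh0_upper : rayleigh0 <= 1.
Proof.
have dw : jump_dom K1 1 (window 1).
  apply: jump_dom_window => [|x xa]; first exact: measurable_inv2.
  by rewrite (inv2_ge0 xa) (inv2_le xa).
have := @rayleigh_le K1 _ (@measurable_inv2 R _) (@inv2_ge0 R _) _ dw.
by rewrite energy_window// ip_window// -/rayleigh0 mulr1 => h;
  rewrite -(ler_pM2r (ltr0n _ 2)) mul1r.
Qed.

Lemma rayleigh_local_kernel a : 0 < a -> a <= 1 / 32 ->
  `|rayleigh_inf local_kernel a - rayleigh0| <= 32 * a.
Proof.
move=> a0 a1; rewrite ler_norml; apply/andP.
have kk := local_kernel_ge0 a1; have kl := local_kernel_le a1.
have mk : measurable_fun (`]0, 2 * a[%classic : set T) (@local_kernel R) :=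
  @measurable_local_kernel R _.
split.
  suff : rayleigh0 - 32 * a <=
    rayleigh_inf local_kernel a by move: (rayleigh_inf _ _) (rayleigh0) => *; lra.
  apply: (rayleigh_ge a0 mk kk kl) => u du; have [e b] := jump_dom_local_kernel u a0 a1.
  have := @rayleigh_le K1 _ (@measurable_inv2 R _) (@inv2_ge0 R _) _ (e.1 du).
  rewrite (rayleigh_dilate a0) -/rayleigh0; have := b du.
  move: (jump_form local_kernel a u u) (jump_form _ a u u) (ip u u) rayleigh0 => A B I m;
    rewrite ler_norml => /andP[h1 h2].
  rewrite mulrBl; lra.
suff : rayleigh_inf local_kernel a - 32 * a <=
  rayleigh0 by move: (rayleigh_inf _ _) (rayleigh0) => *; lra.
rewrite /rayleigh0 -(rayleigh_dilate a0).
apply: (@rayleigh_ge K1 _ a0 (@measurable_inv2 R _) (@inv2_ge0 R _) (@inv2_le _)) => u du.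
have [e b] := jump_dom_local_kernel u a0 a1; have du' := e.2 du.
have := rayleigh_le mk kk du'; have := b du'.
move: (jump_form local_kernel a u u) (jump_form _ a u u) (ip u u) (rayleigh_inf local_kernel a)
  => A B I m; rewrite ler_norml => /andP[h1 h2].
rewrite mulrBl; lra.
Qed.

(** The energy bound 2 ln 2 loses 32 a by the change of kernel, while [rayleigh_inf] is at most 1 +
    32 a. *)
Lemma local_kernel_gap a u : 0 < a -> a <= 1 / 32 -> jump_dom local_kernel a u ->
  ip u (window a) = 0 ->
  (rayleigh_inf local_kernel a + (2 * ln 2 - 1 - 64 * a)) * ip u u <= jump_form local_kernel a u u.
Proof.
move=> a0 a1 du m0; have [e b] := jump_dom_local_kernel u a0 a1.
have h := energy_mean0 a0 (e.1 du) m0; have := b du.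
have := rayleigh_local_kernel a0 a1; have := rayleigh0_upper; have i0 := ip_ge0 u.
move: h; move: (jump_form local_kernel a u u) (jump_form _ a u u) (ip u u) i0
  (rayleigh_inf local_kernel a) (rayleigh0) (ln 2) => A B I i0 r m l.
rewrite !ler_norml => h m1 /andP[h1 h2] /andP[h3 h4].
apply: (@le_trans _ _ ((2 * l - 32 * a) * I)); last by rewrite mulrBl; lra.
by rewrite ler_wpM2r//; lra.
Qed.

End kernels.

(** * Reduction to real-valued functions *)

Section complex_form.
Local Open Scope complex_scope.
Context {R : realType}.
Local Notation mu := (@lebesgue_measure R).
Local Notation T := (measurableTypeR R).
Implicit Types (u w : R -> R) (v h : R -> R[i]) (a c x l : R).

Definition re v x := complex.Re (v x).
Definition im v x := complex.Im (v x).

Lemma L2_re_im a v : L2 a v <-> L2on a (re v) /\ L2on a (im v).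
Proof.
split=> [[/Lfun2E s1 /Lfun2E s2 z]|[[s1 z1] [s2 z2]]].
  by split; split => // x /z; rewrite /re /im => ->.
split; [exact/Lfun2E|exact/Lfun2E|move=> x xa].
by apply/eqP; rewrite eq_complex /= -/(re v x) -/(im v x) z1 ?z2// eqxx.
Qed.

Lemma cintegral_mul_conj v h : sq (re v) -> sq (im v) -> sq (re h) -> sq (im h) ->
  cintegral (fun y => v y * (h y)^*) =
  (ip (re v) (re h) + ip (im v) (im h)) +i* (ip (im v) (re h) - ip (re v) (im h)).
Proof.
move=> s1 s2 t1 t2; have i11 := sqM s1 t1; have i22 := sqM s2 t2.
have i21 := sqM s2 t1; have i12 := sqM s1 t2.
rewrite /cintegral; congr (_ +i* _).
  rewrite /ip -RintegralD//; apply: eq_Rintegral => y _.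
  by rewrite /re /im; case: (v y) (h y) => [? ?] [? ?] /=; ring.
rewrite /ip -RintegralB//; apply: eq_Rintegral => y _.
by rewrite /re /im; case: (v y) (h y) => [? ?] [? ?] /=; ring.
Qed.

Lemma convolution_involution v h x : sq (re v) -> sq (im v) -> sq (re h) -> sq (im h) ->
  convolution v (involution h) x =
  (corr (re v) (re h) x + corr (im v) (im h) x) +i* (corr (im v) (re h) x - corr (re v) (im h) x).
Proof.
move=> s1 s2 t1 t2.
have -> : convolution v (involution h) x = cintegral (fun y => v y * (h (y - x))^*).
  by congr cintegral; apply/funext => y; rewrite /involution opprB.
by rewrite (cintegral_mul_conj s1 s2 (sq_sh x t1) (sq_sh x t2)).
Qed.

Lemma ip_zero u : ip u (cst 0) = 0.
Proof. by rewrite /ip (_ : (fun x => _) = cst 0) ?/Rintegral ?integral0//; apply/funext => x;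
  rewrite mulr0. Qed.

Lemma sq_zero : sq (cst (0 : R)).
Proof.
split; first exact: measurable_cst.
rewrite (_ : EFin \o _ = cst 0%E); first exact: integrable0.
by apply/funext => x /=; rewrite expr0n.
Qed.

Lemma sqZ c u : sq u -> sq (fun x => c * u x).
Proof.
move=> su; have := sq_lc (c - 1) su su; congr sq; apply/funext => x; rewrite /lc; ring.
Qed.

Lemma ipZl c u w : sq u -> sq w -> ip (fun x => c * u x) w = c * ip u w.
Proof.
move=> su sw; rewrite (_ : (fun x => _) = lc (c - 1) u u); last by apply/funext => x;
  rewrite /lc; ring.
by rewrite ip_lcl//; ring.
Qed.

Lemma corr_diff_zero u : corr_diff u (cst 0) = cst 0.
Proof.
apply/funext => x; rewrite /corr_diff ip_zero /corr.
have e y : sh y (cst 0) = cst (0 : R) by [].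
by rewrite !e ip_zero /=; ring.
Qed.

Lemma jump_form_zero K a u : jump_form K a u (cst 0) = 0.
Proof.
rewrite /jump_form corr_diff_zero (_ : (fun x => _) = cst 0) ?/Rintegral ?integral0//.
by apply/funext => x; rewrite mul0r.
Qed.

Lemma jump_dom_zero K a : jump_dom K a (cst 0).
Proof.
split; first by split => //; exact: sq_zero.
rewrite corr_diff_zero (_ : EFin \o _ = cst 0%E); first exact: integrable0.
by apply/funext => x /=; rewrite mul0r.
Qed.

Lemma ip0_ae u : sq u -> ip u u = 0 <-> {ae mu, forall x, u x = 0}.
Proof.
move=> su; have i := sqM su su.
have mu2 : measurable_fun [set: T] (EFin \o (fun x => u x * u x)) by have /integrableP[] := i.
have e : (\int[mu]_x `|(u x * u x)%:E|)%E = (ip u u)%:E.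
  rewrite /ip /Rintegral fineK; last exact: integrable_fin_num.
  by apply: eq_integral => x _; rewrite abse_EFin ger0_norm// -expr2 sqr_ge0.
have [k1 k2] := ae_eq_integral_abs mu measurableT mu2.
split=> h.
  have : ae_eq mu setT (EFin \o (fun x => u x * u x)) (cst 0%E) by apply: k1; rewrite e h.
  by apply: filterS => x /(_ I) /= [] /eqP; rewrite mulf_eq0 orbb => /eqP.
have : (\int[mu]_x `|(u x * u x)%:E|)%E = 0%E.
  apply: k2; apply: (@filterS _ _ (ae_filter_ringOfSetsType mu) _ _ _ h) => x ux _.
  by rewrite /= ux mulr0.
by rewrite e => -[].
Qed.

End complex_form.

(** * The eigenvalue equation for real and imaginary parts *)

Section spectrum.
Local Open Scope complex_scope.
Context {R : realType}.
Local Notation mu := (@lebesgue_measure R).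
Local Notation T := (measurableTypeR R).
Implicit Types (u w : R -> R) (v h : R -> R[i]) (c x l : R).
Variable a : R.
Hypothesis a0 : 0 < a.
Hypothesis a1 : a <= 1 / 32.

Let mk : measurable_fun (`]0, 2 * a[%classic : set T) (@local_kernel R) :=
  @measurable_local_kernel R _.
Let k0 x : 0 < x < 2 * a -> 0 <= local_kernel x := @local_kernel_ge0 R a x a1.
Let a4 : a <= 1 / 4.
Proof. by have := a1; lra. Qed.

Definition real_weil_form u w := weil_const a * ip u w + jump_form local_kernel a u w.

Section weil_correlation.
Variables (c : R) (u1 w1 u2 w2 : R -> R).
Hypothesis lu1 : L2on a u1.
Hypothesis lw1 : L2on a w1.
Hypothesis lu2 : L2on a u2.
Hypothesis lw2 : L2on a w2.

(** The common shape of the real part (c = 1) and the imaginary part (c = -1) of the convolution. *)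
Let g x := corr u1 w1 x + c * corr u2 w2 x.

Let mg : measurable_fun [set: T] g.
Proof.
apply: measurable_funD; first exact: (measurable_corr lu1.1 lw1.1).
by apply: measurable_funM; [exact: measurable_cst|exact: (measurable_corr lu2.1 lw2.1)].
Qed.

Let B := (ip u1 u1 + ip w1 w1) / 2 + `|c| * ((ip u2 u2 + ip w2 w2) / 2).

Let gB x : `|g x| <= B.
Proof.
apply: (le_trans (ler_normD _ _)); rewrite lerD//; first exact: (corr_bound x lu1.1 lw1.1).
by rewrite normrM ler_wpM2l//; exact: (corr_bound x lu2.1 lw2.1).
Qed.

Let g0 x : 2 * a <= `|x| -> g x = 0.
Proof. by move=> ax; rewrite /g !(@corr_far _ a)// mulr0 addr0. Qed.

Let dgE x : second_diff g x = corr_diff u1 w1 x + c * corr_diff u2 w2 x.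
Proof. by rewrite /second_diff /g /corr_diff !corr0; ring. Qed.

Lemma weil_corr_finite : weil_real g \is a fin_num <->
  mu.-integrable `]0, 2 * a[ (EFin \o (fun x => (corr_diff u1 w1 x +
    c * corr_diff u2 w2 x) * local_kernel x)).
Proof.
rewrite (_ : (fun x => _) = (fun x => second_diff g x * local_kernel x));
  first exact: (weil_finite a0 a4 mg gB g0).
by apply/funext => x; rewrite dgE.
Qed.

Lemma weil_corr : jump_dom local_kernel a u1 -> jump_dom local_kernel a w1 ->
  jump_dom local_kernel a u2 -> jump_dom local_kernel a w2 ->
  weil_real g = (real_weil_form u1 w1 + c * real_weil_form u2 w2)%:E.
Proof.
move=> du1 dw1 du2 dw2; have i1 := jump_form_integrable mk k0 du1 dw1;
  have i2 := jump_form_integrable mk k0 du2 dw2.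
have [i3 e3] := RintegralZ_oo c i2; have [i e] := RintegralD_oo i1 i3.
have ei : (fun x => second_diff g x * local_kernel x) =
  (fun x => corr_diff u1 w1 x * local_kernel x + c * (corr_diff u2 w2 x * local_kernel x)).
  by apply/funext => x; rewrite dgE; ring.
rewrite (weilE a0 a4 mg gB g0); last by rewrite ei.
congr EFin; rewrite ei e e3 /g !corr0 /real_weil_form -/(jump_form local_kernel a u1 w1)
  -/(jump_form local_kernel a u2 w2).
move: (weil_const a) (ip u1 w1) (ip u2 w2) (jump_form local_kernel a u1 w1)
  (jump_form local_kernel a u2 w2) => *; ring.
Qed.

End weil_correlation.

Lemma re_convolution v h : L2on a (re v) -> L2on a (im v) -> L2on a (re h) -> L2on a (im h) ->
  (fun x => complex.Re (convolution v (involution h) x)) =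
  (fun x => corr (re v) (re h) x + 1 * corr (im v) (im h) x).
Proof.
move=> [s1 _] [s2 _] [t1 _] [t2 _]; apply/funext => x.
by rewrite (convolution_involution _ s1 s2 t1 t2) mul1r.
Qed.

Lemma im_convolution v h : L2on a (re v) -> L2on a (im v) -> L2on a (re h) -> L2on a (im h) ->
  (fun x => complex.Im (convolution v (involution h) x)) =
  (fun x => corr (im v) (re h) x + (- 1) * corr (re v) (im h) x).
Proof.
move=> [s1 _] [s2 _] [t1 _] [t2 _]; apply/funext => x.
by rewrite (convolution_involution _ s1 s2 t1 t2) mulN1r.
Qed.

(** Finiteness of the real part makes a sum of two nonnegative integrands integrable, hence each of
    them. Conversely both parts have finite energy, and [weil_corr] evaluates W. *)
Lemma form_domain_re_im v : form_domain a v <-> jump_dom local_kernel a (re v) /\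
  jump_dom local_kernel a (im v).
Proof.
split=> [[/L2_re_im[l1 l2]]|[d1 d2]].
  rewrite /QW_finite /reW re_convolution// => -[/(weil_corr_finite _ l1 l1 l2 l2) i _].
  have dom u : L2on a u -> (forall x, 0 < x < 2 * a ->
      corr_diff u u x <= corr_diff (re v) (re v) x + 1 * corr_diff (im v) (im v) x) ->
        jump_dom local_kernel a u.
    move=> lu h; split => //; apply: (le_integrable (measurable_itvT _) _ _ i).
      apply/measurable_EFinP; apply: measurable_funM => //.
      by apply: measurable_funTS; exact: (measurable_corr_diff lu.1 lu.1).
    move=> x /=; rewrite in_itv/= => xa; rewrite lee_fin.
    have kx := k0 xa; have dx := corr_diff_ge0 x lu.1; have hx := h _ xa.
    by rewrite !ger0_norm ?mulr_ge0//; [rewrite ler_wpM2r|exact: le_trans hx].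
  have := corr_diff_ge0 _ l1.1; have := corr_diff_ge0 _ l2.1.
  by split; apply: dom => // x _; rewrite mul1r ?lerDl ?lerDr.
have l1 := d1.1; have l2 := d2.1; split; first exact/L2_re_im.
rewrite /QW_finite /reW /imW re_convolution// im_convolution//.
by rewrite !weil_corr.
Qed.

Lemma QW_re_im v h : form_domain a v -> form_domain a h ->
  QW v h = (real_weil_form (re v) (re h) + real_weil_form (im v) (im h)) +i*
    (real_weil_form (im v) (re h) - real_weil_form (re v) (im h)).
Proof.
move=> /form_domain_re_im[d1 d2] /form_domain_re_im[e1 e2].
have l1 := d1.1; have l2 := d2.1; have m1 := e1.1; have m2 := e2.1.
rewrite /QW /reW /imW.
rewrite re_convolution// im_convolution//.
by rewrite !weil_corr//= mul1r mulN1r.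
Qed.

Definition eigen l u := jump_dom local_kernel a u /\ forall w, jump_dom local_kernel a w ->
  real_weil_form u w = l * ip u w.

Lemma re_real u : re (fun x => (u x)%:C) = u. Proof. by []. Qed.
Lemma im_real u : im (fun x => (u x)%:C) = cst 0. Proof. by []. Qed.

Lemma re_scale l v : re (fun x => l%:C * v x) = (fun x => l * re v x).
Proof. by apply/funext => x; rewrite /re; case: (v x) => p q /=; ring. Qed.

Lemma im_scale l v : im (fun x => l%:C * v x) = (fun x => l * im v x).
Proof. by apply/funext => x; rewrite /im; case: (v x) => p q /=; ring. Qed.

Lemma L2on_scale l u : L2on a u -> L2on a (fun x => l * u x).
Proof. by move=> [su zu]; split; [exact: sqZ|move=> x /zu ->; rewrite mulr0]. Qed.

(** The form has real coefficients, so testing against real w already separates the equation: its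
    real part concerns [re v], its imaginary part [im v]. *)
Lemma weil_operator_eigen l v :
  weil_operator a v (fun x => l%:C * v x) <-> eigen l (re v) /\ eigen l (im v).
Proof.
split=> [[dv _ h]|[[d1 h1] [d2 h2]]].
  have [d1 d2] := (form_domain_re_im v).1 dv.
  have key w : jump_dom local_kernel a w -> real_weil_form (re v) w = l * ip (re v) w /\
    real_weil_form (im v) w = l * ip (im v) w.
    move=> dw; have dW : form_domain a (fun x => (w x)%:C).
      by apply/form_domain_re_im; split => //; exact: jump_dom_zero.
    have := h _ dW; rewrite QW_re_im// /inner cintegral_mul_conj; last 4 first.
    - by rewrite re_scale; exact: sqZ d1.1.1.
    - by rewrite im_scale; exact: sqZ d2.1.1.
    - exact: dw.1.1.
    - exact: sq_zero.
    rewrite re_real im_real re_scale im_scale /real_weil_form !ip_zero !jump_form_zero.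
    rewrite !(ipZl _ d1.1.1 dw.1.1) !(ipZl _ d2.1.1 dw.1.1).
    move: (weil_const a) (ip (re v) w) (ip (im v) w) (jump_form local_kernel a (re v) w)
      (jump_form local_kernel a (im v) w).
    by move=> p q r s t; rewrite !mulr0 !addr0 !subr0 => -[].
  by split; split => // w /key[].
have dv : form_domain a v by apply/form_domain_re_im.
split => //.
  by apply/L2_re_im; rewrite re_scale im_scale; split; apply: L2on_scale; [exact: d1.1|exact: d2.1].
move=> w dw; have [e1 e2] := (form_domain_re_im w).1 dw.
rewrite QW_re_im// /inner cintegral_mul_conj; last 4 first.
- by rewrite re_scale; exact: sqZ d1.1.1.
- by rewrite im_scale; exact: sqZ d2.1.1.
- exact: e1.1.1.
- exact: e2.1.1.
rewrite re_scale im_scale !(ipZl _ d1.1.1 e1.1.1) !(ipZl _ d2.1.1 e2.1.1).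
rewrite !(ipZl _ d2.1.1 e1.1.1) !(ipZl _ d1.1.1 e2.1.1).
by rewrite !h1// !h2.
Qed.

Lemma ae_zero_re_im v : jump_dom local_kernel a (re v) -> jump_dom local_kernel a (im v) ->
  {ae mu, forall x, v x = 0} <-> ip (re v) (re v) = 0 /\ ip (im v) (im v) = 0.
Proof.
move=> d1 d2; split=> [h|[/(ip0_ae d1.1.1) h1 /(ip0_ae d2.1.1) h2]].
  split; [apply/(ip0_ae d1.1.1)|apply/(ip0_ae d2.1.1)];
    by apply: (@filterS _ _ (ae_filter_ringOfSetsType mu) _ _ _ h) => x; rewrite /re /im => ->.
apply: (@filterS2 _ _ (ae_filter_ringOfSetsType mu) _ _ _ _ h1 h2) => x.
by rewrite /re /im; case: (v x) => p q /= -> ->.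
Qed.

End spectrum.

(** * The ground state *)

Section ground_state.
Local Open Scope complex_scope.
Context {R : realType}.
Local Notation mu := (@lebesgue_measure R).
Local Notation T := (measurableTypeR R).
Implicit Types (u w K : R -> R) (v h : R -> R[i]) (c x l a : R).

Definition refl u x := u (- x).

Lemma reflK u : refl (refl u) = u.
Proof. by apply/funext => x; rewrite /refl opprK. Qed.

Let reflE u : refl u = fun x => u (- 1 * x + 0).
Proof. by apply/funext => x; rewrite mulN1r addr0. Qed.

Let n1 : - 1 != 0 :> R.
Proof. by rewrite oppr_eq0 oner_eq0. Qed.

Lemma sq_refl u : sq u -> sq (refl u).
Proof. by rewrite reflE; exact: sq_affine. Qed.

Lemma ip_refl u w : sq u -> sq w -> ip (refl u) (refl w) = ip u w.
Proof.
by move=> su sw; rewrite (ip_affine 0 n1 su sw) normrN1 mul1r -!reflE.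
Qed.

Lemma ip_refll u w : sq u -> sq w -> ip (refl u) w = ip u (refl w).
Proof. by move=> su sw; rewrite -(ip_refl su (sq_refl sw)) reflK. Qed.

(** Reflecting one argument reverses the sign of the translation, and [corr_diff] sums over both
    signs. *)
Lemma corr_diff_refl u w : sq u -> sq w -> corr_diff (refl u) w = corr_diff u (refl w).
Proof.
move=> su sw; have H x : corr (refl u) w x = corr u (refl w) (- x).
  rewrite /corr ip_refll//; last exact: sq_sh.
  by congr ip; apply/funext => y; rewrite /refl /sh; congr w; ring.
by apply/funext => x; rewrite /corr_diff ip_refll// !H opprK; ring.
Qed.

Lemma jump_form_refl K a u w : sq u -> sq w -> jump_form K a (refl u) w = jump_form K a u (refl w).
Proof. by move=> su sw; rewrite /jump_form corr_diff_refl. Qed.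

Lemma jump_dom_refl K a u : jump_dom K a u -> jump_dom K a (refl u).
Proof.
move=> [[su zu] i]; split; last by rewrite corr_diff_refl ?reflK//; exact: sq_refl.
split; first exact: sq_refl.
move=> x xa; apply: zu; apply: contraNN xa; rewrite !in_itv/=.
by rewrite ltrN2 (ltrNl x) andbC.
Qed.

Lemma refl_window a : refl (window a) = window a.
Proof.
apply/funext => x; rewrite /refl /window !indicE !mem_setE !in_itv/=.
by rewrite ltrNl opprK ltrNl andbC.
Qed.

Variable a : R.
Hypothesis a0 : 0 < a.
Hypothesis a1 : a <= 1 / 32.
Hypothesis a2 : 64 * a < 2 * ln 2 - 1.

Let mk : measurable_fun (`]0, 2 * a[%classic : set T) (@local_kernel R) :=
  @measurable_local_kernel R _.
Let k0 x : 0 < x < 2 * a -> 0 <= local_kernel x := @local_kernel_ge0 R a x a1.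
Let k1 x : 0 < x < 2 * a -> local_kernel x <= x^-1 := @local_kernel_le R a x a1.

Definition bottom := weil_const a + rayleigh_inf local_kernel a.

Lemma eigen_ge l u : eigen a l u -> ip u u != 0 -> bottom <= l.
Proof.
move=> [du e] u0; have up : 0 < ip u u by rewrite lt_def u0 ip_ge0.
have := e _ du; have := rayleigh_le mk k0 du; rewrite /real_weil_form => h h'.
by rewrite -(ler_pM2r up) -h' /bottom mulrDl lerD2l.
Qed.

Lemma eigen_lc c l u w : eigen a l u -> eigen a l w -> eigen a l (lc c u w).
Proof.
move=> [du eu] [dw ew]; split; first exact: jump_dom_lc.
move=> z dz; have := eu _ dz; have := ew _ dz;
  rewrite /real_weil_form (ip_lcl _ du.1.1 dw.1.1 dz.1.1).
rewrite (jump_form_lcl mk k0)//.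
move: (weil_const a) (ip u z) (ip w z) (jump_form local_kernel a u z)
  (jump_form local_kernel a w z) => p q r s t.
by move=> h1 h2; rewrite [RHS]mulrDr -h2 mulrCA -h1; ring.
Qed.

Lemma eigen_refl l u : eigen a l u -> eigen a l (refl u).
Proof.
move=> [du e]; split; first exact: jump_dom_refl.
move=> w dw; have := e _ (jump_dom_refl dw).
by rewrite /real_weil_form ip_refll ?jump_form_refl//;
  [exact: du.1.1|exact: dw.1.1|exact: du.1.1|exact: dw.1.1].
Qed.

(** Tested against itself, u has energy exactly [rayleigh_inf] times [ip u u], which the gap forbids
    unless u vanishes. *)
Lemma eigen_mean0 u : eigen a bottom u -> ip u (window a) = 0 -> ip u u = 0.
Proof.
move=> [du e] m0; have := local_kernel_gap a0 a1 du m0; have := e _ du; have := a2.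
rewrite /real_weil_form /bottom.
move: (weil_const a) (ip_ge0 u) (rayleigh_inf local_kernel a) (ln 2)
  (jump_form local_kernel a u u) => p i0 r l f.
move: (ip u u) i0 => i i0 d e' g; have f' : f = r * i by lra.
apply/le_anti; rewrite i0 andbT -(ler_pM2l (_ : 0 < 2 * l - 1 - 64 * a)); last by lra.
by move: g; rewrite f' mulrDl; lra.
Qed.

Lemma ground_state : exists u, eigen a bottom u /\ ip u (window a) = 1.
Proof.
have d0 : 0 < 2 * ln 2 - 1 - 64 * a by have := a2; lra.
have ml u : jump_dom local_kernel a u -> rayleigh_inf local_kernel a * ip u u <=
  jump_form local_kernel a u u by exact: (rayleigh_le mk k0).
have mi e : 0 < e -> exists u, [/\ jump_dom local_kernel a u, ip u u = 1 &
  jump_form local_kernel a u u <= rayleigh_inf local_kernel a + e].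
  exact: (rayleigh_approx a0 mk k0 k1).
have [u [du u1 e]] := minimizer a0 mk k0 k1 ml mi d0 (fun u => @local_kernel_gap R a u a0 a1).
exists u; split => //; split => // w dw.
by rewrite /real_weil_form (euler_lagrange mk k0 ml du dw e) -mulrDl.
Qed.

Let sq_w : sq (window a) := sq_window a.

(** Subtracting from w the multiple of u with the same mean leaves an eigenfunction of mean zero. *)
Lemma eigen_proportional u w : eigen a bottom u -> ip u (window a) = 1 -> eigen a bottom w ->
  {ae mu, forall x, w x = ip w (window a) * u x}.
Proof.
move=> eu u1 ew; have el := eigen_lc (- ip w (window a)) ew eu.
have z : ip (lc (- ip w (window a)) w u) (window a) = 0.
  by rewrite ip_lcl ?u1//; [ring|exact: ew.1.1.1|exact: eu.1.1.1].
have /ip0_ae := eigen_mean0 el z => /(_ el.1.1.1) h.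
apply: (@filterS _ _ (ae_filter_ringOfSetsType mu) _ _ _ h) => x.
by rewrite /lc mulNr => /eqP; rewrite subr_eq0 => /eqP.
Qed.

Lemma eigen_even u : eigen a bottom u -> {ae mu, forall x, u (- x) = u x}.
Proof.
move=> eu; have el := eigen_lc (- 1) (eigen_refl eu) eu; have su := eu.1.1.1.
have z : ip (lc (- 1) (refl u) u) (window a) = 0.
  by rewrite ip_lcl ?ip_refll ?refl_window//; [ring|exact: sq_refl].
have /ip0_ae := eigen_mean0 el z => /(_ el.1.1.1) h.
apply: (@filterS _ _ (ae_filter_ringOfSetsType mu) _ _ _ h) => x.
by rewrite /lc mulN1r => /eqP; rewrite subr_eq0 => /eqP.
Qed.

Lemma eigenfunction_re_im l v : eigenfunction a l v <->
  [/\ eigen a l (re v), eigen a l (im v) & ~ (ip (re v) (re v) = 0 /\ ip (im v) (im v) = 0)].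
Proof.
split=> [[/(weil_operator_eigen a0 a1)[e1 e2]]|[e1 e2 n]].
  by rewrite (ae_zero_re_im e1.1 e2.1) => n.
split; first exact/(weil_operator_eigen a0 a1).
by rewrite (ae_zero_re_im e1.1 e2.1).
Qed.

Lemma is_eigenvalue_bottom : is_eigenvalue a bottom.
Proof.
have [u [eu u1]] := ground_state; exists (fun x => (u x)%:C).
apply/eigenfunction_re_im; rewrite re_real im_real; split => //.
  split; first exact: jump_dom_zero.
  move=> w dw; rewrite /real_weil_form ipC ip_zero (jump_formC (jump_dom_zero _ _) dw)
    jump_form_zero.
  by rewrite !mulr0 addr0.
(* A function of mean 1 is not zero, by Cauchy-Schwarz against the window. *)
move=> [/(ip0_ae eu.1.1.1) z _]; have := ip_CS eu.1.1.1 sq_w.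
by move/(ip0_ae eu.1.1.1) : z => ->; rewrite u1 expr1n mul0r ler10.
Qed.

Lemma lambda_bottom : lambda a = bottom.
Proof.
apply/le_anti/andP; split.
  apply: ge_inf; last exact: is_eigenvalue_bottom.
  exists bottom => l [v /eigenfunction_re_im[e1 e2 n]].
  have [z1|] := eqVneq (ip (re v) (re v)) 0; last exact: eigen_ge.
  have [z2|] := eqVneq (ip (im v) (im v)) 0; last exact: eigen_ge.
  by case: n.
apply: lb_le_inf; first by exists bottom; exact: is_eigenvalue_bottom.
move=> l [v /eigenfunction_re_im[e1 e2 n]].
have [z1|] := eqVneq (ip (re v) (re v)) 0; last exact: eigen_ge.
have [z2|] := eqVneq (ip (im v) (im v)) 0; last exact: eigen_ge.
by case: n.
Qed.

Lemma eigenfunction_proportional u v : eigen a bottom u -> ip u (window a) = 1 ->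
  eigenfunction a bottom v ->
  exists2 c : R[i], c != 0 & {ae mu, forall x, v x = c * (u x)%:C}.
Proof.
move=> eu u1 /eigenfunction_re_im[e1 e2 n].
have h1 := eigen_proportional eu u1 e1; have h2 := eigen_proportional eu u1 e2.
exists (ip (re v) (window a) +i* ip (im v) (window a)).
  apply/eqP => -[z1 z2]; apply: n; split; exact: eigen_mean0.
apply: (@filterS2 _ _ (ae_filter_ringOfSetsType mu) _ _ _ _ h1 h2) => x.
move: (ip _ _) (ip _ _) => p q; rewrite /re /im; case: (v x) => r s /= -> ->.
by apply/eqP; rewrite eq_complex /=; apply/andP; split; apply/eqP; ring.
Qed.

Lemma simple_bottom : is_simple_eigenvalue a bottom.
Proof.
split=> [|v w ev ew]; first exact: is_eigenvalue_bottom.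
have [u [eu u1]] := ground_state.
have [c c0 hv] := eigenfunction_proportional eu u1 ev.
have [d _ hw] := eigenfunction_proportional eu u1 ew.
exists (d / c).
apply: (@filterS2 _ _ (ae_filter_ringOfSetsType mu) _ _ _ _ hv hw) => x -> ->.
by rewrite mulrA divfK.
Qed.

Lemma even_bottom v : eigenfunction a bottom v -> ae_even v.
Proof.
move=> /eigenfunction_re_im[e1 e2 _].
have h1 := eigen_even e1; have h2 := eigen_even e2.
apply: (@filterS2 _ _ (ae_filter_ringOfSetsType mu) _ _ _ _ h1 h2) => x.
by rewrite /re /im; case: (v x) (v (- x)) => p q [r s] /= -> ->.
Qed.

End ground_state.

(** * Asymptotics and positivity of the lowest eigenvalue *)

Lemma bottom_asymptotics (R : realType) (a : R) : 0 < a -> a <= 1 / 32 ->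
  `|bottom a - (ln (1 / a) + (rayleigh0 - ln 2) - ln (2 * pi) + digamma 2 - 1)| <= 48 * a.
Proof.
move=> a0 a1; have a4 : a <= 1 / 4 by lra.
have := weil_const_bound a0 a4; have := rayleigh_local_kernel a0 a1.
rewrite digamma2E /bottom.
(* This produces the [- ln 2] of mu_1. The error 48 a is 16 a from [weil_const_bound] plus 32 a from
   [rayleigh_local_kernel]. *)
have -> : ln (4 * pi) = ln 2 + ln (2 * pi) :> R.
  rewrite -lnM ?posrE ?mulr_gt0 ?pi_gt0//; congr ln; ring.
move: (rayleigh_inf local_kernel a) rayleigh0 (weil_const a) (ln (1 / a)) (ln 2) (ln (2 * pi))
  euler_mascheroni.
move=> r m p l s t e; rewrite !ler_norml => /andP[h1 h2] /andP[h3 h4].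
by apply/andP; split; lra.
Qed.

(** The +1 in the exponent absorbs the error 16 a <= 1/2 of [weil_const_bound], and [rayleigh_inf]
    is nonnegative. *)
Lemma bottom_gt0 (R : realType) (a : R) : 0 < a -> a <= 1 / 32 ->
  a < expR (- (ln (4 * pi) + euler_mascheroni + 1)) -> 0 < bottom a.
Proof.
move=> a0 a1 ae; have a4 : a <= 1 / 4 by lra.
have := weil_const_bound a0 a4.
have r0 : 0 <= rayleigh_inf local_kernel a.
  by apply: rayleigh_ge0 => //; [exact: measurable_local_kernel|move=> x;
    exact: local_kernel_ge0|move=> x; exact: local_kernel_le].
have : ln a < - (ln (4 * pi) + euler_mascheroni + 1) by rewrite -ltr_expR lnK.
rewrite div1r lnV ?posrE// /bottom.
move: (rayleigh_inf local_kernel a) r0 (weil_const a) (ln a) (ln (4 * pi)) euler_mascheroni.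
move=> r r0 p l s e h; rewrite ler_norml => /andP[h1 h2]; lra.
Qed.

Theorem theorem1p4 (R : realType) :
  [/\ \forall a \near (0 : R)^'+,
        0 < lambda a /\ is_simple_eigenvalue a (lambda a),
      exists2 mu1 : R, 0 < mu1 &
        exists C : R, \forall a \near (0 : R)^'+,
          `| lambda a
             - (ln (1 / a) + mu1 - ln (2 * pi) + digamma 2 - 1) | <= C * a &
      \forall a \near (0 : R)^'+,
        forall v : R -> complex R, eigenfunction a (lambda a) v -> ae_even v].
Proof.
(* The three thresholds are those of the kernel bounds, of a positive gap and of a positive
   eigenvalue. *)
pose e : R := Num.min (1 / 32) (Num.min ((2 * ln 2 - 1) / 64)
  (expR (- (ln (4 * pi) + euler_mascheroni + 1)))).
have e0 : 0 < e.
  rewrite !lt_min expR_gt0 divr_gt0//= andbT divr_gt0//.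
  by have := @ln2_gt_half R; lra.
have small : \forall a \near (0 : R)^'+, [/\ 0 < a, a <= 1 / 32,
    64 * a < 2 * ln 2 - 1 & a < expR (- (ln (4 * pi) + euler_mascheroni + 1))].
  near=> a; have a0 : 0 < a by near: a; exact: nbhs_right_gt.
  have : a < e by near: a; exact: nbhs_right_lt.
  rewrite !lt_min => /and3P[h1 h2 h3]; split => //; first exact: ltW.
  by move: h2; rewrite ltr_pdivlMr// mulrC.
split.
- apply: filterS small => a [a0 a1 a2 a3]; rewrite lambda_bottom//.
  by split; [exact: bottom_gt0|exact: simple_bottom].
- exists (rayleigh0 - ln 2).
    by have := @rayleigh0_lower R; have : 0 < 72^-1 :> R by []; move: rayleigh0 (ln 2) => *; lra.
  exists 48; apply: filterS small => a [a0 a1 a2 _].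
  by rewrite lambda_bottom//; exact: bottom_asymptotics.
- apply: filterS small => a [a0 a1 a2 _] v; rewrite lambda_bottom//.
  exact: even_bottom.
Unshelve. all: by end_near. Qed.
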